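(* Let $k\ge 1$ and let $\Lambda$ be a row-finite $k$-graph. Let $\Sigma=\{\lambda\in\Lambda : d(\lambda)=(1,1,\ldots,1)\}$, and let $A=\{A_{\lambda\mu}\}_{\lambda,\mu\in\Sigma}$ be the $0$-$1$ matrix such that $A_{\lambda\mu}=1$ if and only if $s(\lambda)=r(\mu)$. Let $X_A\subseteq\Sigma^{\mathbf N}$ be the Markov space of $A$. Then there are $k$ pairwise commuting cellular automata $S_1,S_2,\ldots,S_k:X_A\to X_A$ whose product $S_1S_2\cdots S_k$ coincides with the shift on $X_A$. Each $S_i$ is moreover a local homeomorphism and, denoting by $\tau$ the action of $\mathbf N^k$ on $X_A$ obtained by iterating the $S_i$, i.e. $\tau_n=S_1^{n_1}S_2^{n_2}\cdots S_k^{n_k}$ for $n=(n_1,\ldots,n_k)\in\mathbf N^k$, the semidirect product groupoid $X_A\rtimes_\tau\mathbf N^k$ is a model for the higher rank graph C*-algebra of $\Lambda$, in the sense that $C^*(X_A\rtimes_\tau\mathbf N^k)$ and $C^*(\Lambda)$ are isomorphic.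
   Context: $\mathbf N$ includes $0$. A $k$-graph is a small category $\Lambda$ (identified with its set of morphisms; objects are identified with identity morphisms) with source and range maps $s,r$, where $\lambda\mu$ is defined iff $s(\lambda)=r(\mu)$, equipped with a degree functor $d:\Lambda\to\mathbf N^k$ satisfying the unique factorization property: if $d(\lambda)=m+n$ then there are unique $\alpha,\beta\in\Lambda$ with $\lambda=\alpha\beta$, $d(\alpha)=m$, $d(\beta)=n$. For an object $v$ and $n\in\mathbf N^k$ put $\Lambda^n(v)=\{\lambda\in\Lambda: d(\lambda)=n,\ r(\lambda)=v\}$; $\Lambda$ is row-finite if every $\Lambda^n(v)$ is finite. The higher rank graph C*-algebra $C^*(\Lambda)$ (Kumjian–Pask) is the universal C*-algebra generated by partial isometries $\{s_\lambda:\lambda\in\Lambda\}$ such that: (i) $\{s_v: v \text{ an object}\}$ are mutually orthogonal projections; (ii) $s_{\lambda\mu}=s_\lambda s_\mu$ whenever $s(\lambda)=r(\mu)$; (iii) $s_\lambda^*s_\lambda=s_{s(\lambda)}$ for all $\lambda$; (iv) $s_v=\sum_{\lambda\in\Lambda^n(v)}s_\lambda s_\lambda^*$ for every object $v$ and every $n\in\mathbf N^k$. The alphabet $\Sigma$ has the discrete topology and $\Sigma^{\mathbf N}$ the product topology. The Markov space of $A$ is $X_A=\{(\lambda_i)_{i\in\mathbf N}\in\Sigma^{\mathbf N}: A_{\lambda_i\lambda_{i+1}}=1\ \forall i\}$, with the subspace topology. The shift is $S(x_0,x_1,x_2,\ldots)=(x_1,x_2,x_3,\ldots)$. For a shift-invariant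 closed subset $X\subseteq\Sigma^{\mathbf N}$ and $q\in\mathbf N$, let $\mathcal L_q(X)$ be the set of words of length $q+1$ occurring as a contiguous block in some element of $X$. A map $T:X\to X$ is a cellular automaton if there are $q\in\mathbf N$ and a function (sliding block code) $\psi:\mathcal L_q(X)\to\Sigma$ such that $T(x)_n=\psi(x_n,x_{n+1},\ldots,x_{n+q})$ for all $x\in X$, $n\in\mathbf N$. For an action $\tau$ of $\mathbf N^k\subseteq\mathbf Z^k$ on a locally compact Hausdorff space $X$ by local homeomorphisms, the semidirect product (Renault–Deaconu) groupoid is $$X\rtimes_\tau\mathbf N^k=\{(x,g,y)\in X\times\mathbf Z^k\times X:\exists\, n,m\in\mathbf N^k,\ \tau_n(x)=\tau_m(y),\ g=n-m\},$$ with product $(x,g,y)(y,h,z)=(x,g+h,z)$ and inverse $(x,g,y)^{-1}=(y,-g,x)$. It is an étale groupoid with the topology generated by the sets $U(n,m,A,B)=\{(x,n-m,y): x\in A,\ y\in B,\ \tau_n(x)=\tau_m(y)\}$, for $A,B\subseteq X$ open and $n,m\in\mathbf N^k$. $C^*(\cdot)$ of an étale groupoid denotes its (full) groupoid C*-algebra. *)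

(* Defs.v *)
From HB Require Import structures.
From mathcomp Require Import all_boot all_order all_algebra.
From mathcomp Require Import all_classical all_reals all_analysis.
From mathcomp Require Import complex.

Set Implicit Arguments.
Unset Strict Implicit.
Unset Printing Implicit Defensive.

Import Order.TTheory GRing.Theory Num.Theory numFieldNormedType.Exports.

Local Open Scope classical_set_scope.
Local Open Scope ring_scope.
Local Open Scope complex_scope.

Notation "''N^' k" := {ffun 'I_k -> nat}
  (at level 8, k at level 2, format "''N^' k") : type_scope.
Notation "''Z^' k" := {ffun 'I_k -> int}
  (at level 8, k at level 2, format "''Z^' k") : type_scope.

(* A small category is given by its set of morphisms, the objects being the
   morphisms [v] with [rng v = v].  The composition is a total function, but
   it is only constrained (and only used) on pairs with [src l = rng m]. *)
Record kgraph (k : nat) := KGraph {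
  kg_mor :> choiceType;
  src : kg_mor -> kg_mor;
  rng : kg_mor -> kg_mor;
  kcomp : kg_mor -> kg_mor -> kg_mor;
  deg : kg_mor -> 'N^k;
  src_src : forall l, src (src l) = src l;
  rng_src : forall l, rng (src l) = src l;
  src_rng : forall l, src (rng l) = rng l;
  rng_rng : forall l, rng (rng l) = rng l;
  src_comp : forall l m, src l = rng m -> src (kcomp l m) = src m;
  rng_comp : forall l m, src l = rng m -> rng (kcomp l m) = rng l;
  comp_rng : forall l, kcomp (rng l) l = l;
  comp_src : forall l, kcomp l (src l) = l;
  kcompA : forall l m n, src l = rng m -> src m = rng n ->
    kcomp l (kcomp m n) = kcomp (kcomp l m) n;
  deg_rng : forall l, deg (rng l) = 0;
  deg_comp : forall l m, src l = rng m -> deg (kcomp l m) = deg l + deg m;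
  unique_factorization : forall l m n, deg l = m + n ->
    exists! ab : kg_mor * kg_mor,
      [/\ src ab.1 = rng ab.2, l = kcomp ab.1 ab.2,
          deg ab.1 = m & deg ab.2 = n] }.

Section KGraph.
Context {k : nat} (L : kgraph k).

Definition is_object (v : L) : Prop := rng v = v.

Definition paths (n : 'N^k) (v : L) : set L :=
  [set l | deg l = n /\ rng l = v].

Definition row_finite : Prop :=
  forall (v : L) (n : 'N^k), is_object v -> finite_set (paths n v).

Definition alphabet : choiceType := {l : L | deg l == [ffun=> 1%N]}.

Definition transition (l m : alphabet) : nat := (src (val l) == rng (val m)).

End KGraph.

Definition full_shift (T : choiceType) : topologicalType :=
  prod_topology (fun _ : nat => discrete_topology T).

Section SymbolicDynamics.
Context {T : choiceType}.

Definition markov_space (A : T -> T -> nat) : set (full_shift T) :=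
  [set x | forall i : nat, A (x i) (x i.+1) = 1%N].

Definition left_shift (x : full_shift T) : full_shift T := fun i : nat => x i.+1.

Definition block (q : nat) (x : full_shift T) (n : nat) : q.+1.-tuple T :=
  [tuple (x (n + i)%N : T) | i < q.+1].

Definition language (q : nat) (X : set (full_shift T)) : set (q.+1.-tuple T) :=
  [set w | exists (x : full_shift T) (n : nat), X x /\ w = block q x n].

Arguments language q X _ : clear implicits.

Lemma block_language (q : nat) (X : set (full_shift T)) (x : X) (n : nat) :
  block q (set_val x) n \in language q X.
Proof. by apply/mem_set; exists (set_val x), n; split=> //; exact: set_valP. Qed.

Arguments block_language q X x n : clear implicits.

Definition block_word (q : nat) (X : set (full_shift T)) (x : X) (n : nat) :
  language q X := exist _ (block q (set_val x) n) (block_language q X x n).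

Definition cellular_automaton (X : set (full_shift T)) (F : X -> X) : Prop :=
  exists (q : nat) (psi : language q X -> T),
    forall (x : X) (n : nat), set_val (F x) n = psi (@block_word q X x n).

End SymbolicDynamics.

Definition local_homeomorphism (X Y : topologicalType) (f : X -> Y) : Prop :=
  forall x : X, exists (U : set X) (g : Y -> X),
    [/\ open U, U x & open (f @` U)] /\
    [/\ {in U, cancel f g}, {within U, continuous f}
      & {within f @` U, continuous g}].

Definition pairwise_commuting (I X : Type) (S : I -> X -> X) : Prop :=
  forall i j : I, S i \o S j = S j \o S i.

Record nat_action (k : nat) (X : Type) := NatAction {
  act :> 'N^k -> X -> X;
  act0 : act 0 = id;
  actD : forall m n, act (m + n) = act m \o act n }.

Section IteratedAction.
Context {k : nat} {X : Type} (S : 'I_k -> X -> X).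

Definition iter_act (n : 'N^k) : X -> X :=
  \big[@comp X X X/id]_(i < k) iter (n i) (S i).

Lemma iter_act0 : iter_act 0 = id.
Proof. by rewrite /iter_act; elim/big_ind: _ => [//|f g -> ->//|i _]; rewrite ffunE. Qed.

Hypothesis commS : pairwise_commuting S.

Lemma iter_commute (i j : 'I_k) (a b : nat) (x : X) :
  iter a (S i) (iter b (S j) x) = iter b (S j) (iter a (S i) x).
Proof.
have comm1 c y : S i (iter c (S j) y) = iter c (S j) (S i y).
  elim: c => //= c <-.
  exact: (congr1 (fun f => f (iter c (S j) y)) (commS i j)).
by elim: a => //= a ->; rewrite comm1.
Qed.

Lemma iter_actD (m n : 'N^k) : iter_act (m + n) = iter_act m \o iter_act n.
Proof.
have comm_big (s : seq 'I_k) i a y :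
    iter a (S i) ((\big[@comp X X X/id]_(j <- s) iter (m j) (S j)) y) =
    (\big[@comp X X X/id]_(j <- s) iter (m j) (S j)) (iter a (S i) y).
  elim: s => [|j s IH]; first by rewrite !big_nil.
  by rewrite !big_cons /= iter_commute IH.
rewrite /iter_act; elim: (index_enum _) => [|i s IH]; first by rewrite !big_nil.
rewrite !big_cons /= IH; apply/funext => x /=.
by rewrite ffunE iterD comm_big.
Qed.

Definition iterated_action : nat_action k X := NatAction iter_act0 iter_actD.

End IteratedAction.

(* [gprod a b c] means that [a] and [b] are composable, with product [c].
   Only the algebraic axioms of a groupoid are recorded; the topology is used
   to form the convolution algebra, for groupoids that are etale, locally
   compact and Hausdorff. *)
Record groupoid := Groupoid {
  gr_car :> topologicalType;
  gprod : gr_car -> gr_car -> gr_car -> Prop;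
  ginv : gr_car -> gr_car;
  gprod_fun : forall a b c c', gprod a b c -> gprod a b c' -> c = c';
  gprodA : forall a b c ab bc, gprod a b ab -> gprod b c bc ->
    exists2 abc, gprod ab c abc & gprod a bc abc;
  ginvK : forall a, ginv (ginv a) = a;
  gprodV : forall a, exists u, gprod (ginv a) a u;
  gprodVK : forall a b c, gprod a b c -> gprod (ginv a) c b;
  gprodKV : forall a b c, gprod a b c -> gprod c (ginv b) a }.

Section SemidirectProduct.
Context {k : nat} {X : topologicalType} (tau : nat_action k X).

Definition zsub (n m : 'N^k) : 'Z^k := [ffun i => (n i)%:Z - (m i)%:Z].

Definition sdp_set : set (X * 'Z^k * X) :=
  [set p | exists n m : 'N^k, tau n p.1.1 = tau m p.2 /\ p.1.2 = zsub n m].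

Definition sdp : Type := set_type sdp_set.

HB.instance Definition _ := Choice.on sdp.

Definition mk_sdp (p : X * 'Z^k * X) (h : p \in sdp_set) : sdp := exist _ p h.

Definition sdp_left (a : sdp) : X := (val a).1.1.
Definition sdp_deg (a : sdp) : 'Z^k := (val a).1.2.
Definition sdp_right (a : sdp) : X := (val a).2.

Definition sdp_open (n m : 'N^k) (A B : set X) : set sdp :=
  [set a | [/\ A (sdp_left a), B (sdp_right a),
     tau n (sdp_left a) = tau m (sdp_right a) & sdp_deg a = zsub n m]].

Definition sdp_subbase : set (set sdp) :=
  [set W | exists (n m : 'N^k) (A B : set X),
     [/\ open A, open B & W = sdp_open n m A B]].

HB.instance Definition _ :=
  isSubBaseTopological.Build sdp sdp_subbase id.

Definition sdp_prod (a b c : sdp) : Prop :=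
  sdp_right a = sdp_left b /\
  val c = (sdp_left a, sdp_deg a + sdp_deg b, sdp_right b).

Lemma sdp_invP (a : sdp) :
  (sdp_right a, - sdp_deg a, sdp_left a) \in sdp_set.
Proof.
apply/mem_set; have [n [m [e d]]] := set_valP a.
exists m, n; split=> //=; rewrite /sdp_deg d.
by apply/ffunP => i; rewrite !ffunE opprB.
Qed.

Definition sdp_inv (a : sdp) : sdp := mk_sdp (sdp_invP a).

Lemma sdp_mulP (a b : sdp) : sdp_right a = sdp_left b ->
  (sdp_left a, sdp_deg a + sdp_deg b, sdp_right b) \in sdp_set.
Proof.
move=> eab; apply/mem_set.
have [n [m [e d]]] := set_valP a; have [p [q [e' d']]] := set_valP b.
exists (p + n), (m + q); split=> /=.
  rewrite !actD /= -[tau n _]/(tau n (val a).1.1) e -[(val a).2]/(sdp_right a).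
  rewrite -[RHS]/(tau m (tau q (val b).2)) -e' -[(val b).1.1]/(sdp_left b) -eab.
  by rewrite -2![tau _ (tau _ _)]/((tau _ \o tau _) _) -!actD addrC.
rewrite /sdp_deg d d'; apply/ffunP => i; rewrite !ffunE /= !PoszD.
by rewrite opprD addrACA; congr (_ + _); rewrite addrC.
Qed.

Lemma sdp_prod_fun (a b c c' : sdp) :
  sdp_prod a b c -> sdp_prod a b c' -> c = c'.
Proof. by move=> [_ e] [_ e']; apply: (@val_inj _ _ (set_type sdp_set)); rewrite e e'. Qed.

Lemma sdp_prodA (a b c ab bc : sdp) : sdp_prod a b ab -> sdp_prod b c bc ->
  exists2 abc, sdp_prod ab c abc & sdp_prod a bc abc.
Proof.
move=> [e1 e2] [e3 e4].
have h : sdp_right ab = sdp_left c by rewrite /sdp_right e2.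
exists (mk_sdp (sdp_mulP h)); split=> //=.
- by rewrite e1 /sdp_left e4.
- by rewrite /sdp_left /sdp_deg /sdp_right e2 e4 /= addrA.
Qed.

Lemma sdp_invK (a : sdp) : sdp_inv (sdp_inv a) = a.
Proof.
apply: (@val_inj _ _ (set_type sdp_set)); case: a => [[[x g] y] h].
by rewrite /= /sdp_left /sdp_deg /sdp_right /= opprK.
Qed.

Lemma sdp_prodV (a : sdp) : exists u, sdp_prod (sdp_inv a) a u.
Proof.
have h : sdp_right (sdp_inv a) = sdp_left a by [].
by exists (mk_sdp (sdp_mulP h)).
Qed.

Lemma sdp_prodVK (a b c : sdp) : sdp_prod a b c -> sdp_prod (sdp_inv a) c b.
Proof.
move=> [e1 e2]; split; rewrite /sdp_left /sdp_deg /sdp_right e2 //=.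
rewrite addKr -/(sdp_right a) e1.
by rewrite /sdp_left /sdp_deg /sdp_right; case: b {e1 e2} => [[[x g] y] h].
Qed.

Lemma sdp_prodKV (a b c : sdp) : sdp_prod a b c -> sdp_prod c (sdp_inv b) a.
Proof.
move=> [e1 e2]; split; rewrite /sdp_left /sdp_deg /sdp_right e2 //=.
rewrite addrK -/(sdp_left b) -e1.
by rewrite /sdp_left /sdp_deg /sdp_right; case: a {e1 e2} => [[[x g] y] h].
Qed.

Definition semidirect_product : groupoid :=
  @Groupoid sdp sdp_prod sdp_inv sdp_prod_fun sdp_prodA sdp_invK
    sdp_prodV sdp_prodVK sdp_prodKV.

End SemidirectProduct.

Record cstar_algebra (R : realType) := CStarAlgebra {
  cs_car :> completeNormedModType R[i];
  cs_mul : cs_car -> cs_car -> cs_car;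
  cs_star : cs_car -> cs_car;
  cs_mulA : associative cs_mul;
  cs_mulDl : left_distributive cs_mul +%R;
  cs_mulDr : right_distributive cs_mul +%R;
  cs_mulZl : forall (a : R[i]) x y, cs_mul (a *: x) y = a *: cs_mul x y;
  cs_mulZr : forall (a : R[i]) x y, cs_mul x (a *: y) = a *: cs_mul x y;
  cs_starK : involutive cs_star;
  cs_starD : {morph cs_star : x y / x + y};
  cs_starZ : forall (a : R[i]) x, cs_star (a *: x) = a^* *: cs_star x;
  cs_starM : forall x y, cs_star (cs_mul x y) = cs_mul (cs_star y) (cs_star x);
  cs_normM : forall x y, `|cs_mul x y| <= `|x| * `|y|;
  cs_norm_star : forall x, `|cs_mul (cs_star x) x| = `|x| ^+ 2 }.

Notation "x ** y" := (cs_mul x y) (at level 40, left associativity) : ring_scope.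
Notation "x ^#" := (cs_star x) (at level 2, format "x ^#") : ring_scope.

Section CStarAlgebra.
Context {R : realType}.

Definition star_hom (B D : cstar_algebra R) (phi : B -> D) : Prop :=
  [/\ {morph phi : x y / x + y},
      (forall (a : R[i]) x, phi (a *: x) = a *: phi x),
      {morph phi : x y / x ** y}
    & {morph phi : x / x^#}].

Definition star_isomorphic (B D : cstar_algebra R) : Prop :=
  exists2 phi : B -> D, star_hom phi & bijective phi.

Definition star_subalgebra (B : cstar_algebra R) (M : set B) : Prop :=
  [/\ M 0, (forall x y, M x -> M y -> M (x + y)),
      (forall (a : R[i]) x, M x -> M (a *: x)),
      (forall x y, M x -> M y -> M (x ** y))
    & (forall x, M x -> M x^#)].

Definition generated_by (I : Type) (B : cstar_algebra R) (s : I -> B) : Prop :=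
  forall M : set B, star_subalgebra M -> closed M -> (forall i, M (s i)) ->
    M = setT.

Section GraphAlgebra.
Context {k : nat} (L : kgraph k).

Definition cuntz_krieger_family (B : cstar_algebra R) (s : L -> B) : Prop :=
  [/\ forall l, s l ** (s l)^# ** s l = s l,
      (forall v, is_object v -> (s v)^# = s v /\ s v ** s v = s v) /\
      (forall v w, is_object v -> is_object w -> v <> w -> s v ** s w = 0),
      forall l m, src l = rng m -> s (kcomp l m) = s l ** s m,
      forall l, (s l)^# ** s l = s (src l)
    & forall v n, is_object v -> s v = \sum_(l \in paths n v) (s l ** (s l)^#)].

Definition is_graph_algebra (B : cstar_algebra R) : Prop :=
  exists s : L -> B,
    [/\ cuntz_krieger_family s, generated_by s
      & forall (D : cstar_algebra R) (t : L -> D), cuntz_krieger_family t ->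
          exists2 phi : B -> D, star_hom phi & forall l, phi (s l) = t l].

End GraphAlgebra.

Section GroupoidAlgebra.
Context (G : groupoid).

(* [R[i]^o] is [R[i]] with its usual topology. *)
Definition Cc : set (G -> R[i]) :=
  [set f | continuous (f : G -> R[i]^o) /\
           compact (closure [set a : G | f a != 0])].

(* For [f] and [g] in [Cc] and [G] etale and Hausdorff, the sum has only
   finitely many nonzero terms. *)
Definition convolution (f g : G -> R[i]) : G -> R[i] := fun c =>
  \sum_(p \in [set p : G * G | gprod p.1 p.2 c]) (f p.1 * g p.2).

Definition involution (f : G -> R[i]) : G -> R[i] := fun a => (f (ginv a))^*.

(* The values of [pi] outside [Cc] are irrelevant. *)
Definition Cc_star_hom (D : cstar_algebra R) (pi : (G -> R[i]) -> D) : Prop :=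
  [/\ forall f g, Cc f -> Cc g -> pi (fun a => f a + g a) = pi f + pi g,
      forall (z : R[i]) f, Cc f -> pi (fun a => z * f a) = z *: pi f,
      forall f g, Cc f -> Cc g -> pi (convolution f g) = pi f ** pi g
    & forall f, Cc f -> pi (involution f) = (pi f)^#].

(* The completion of the convolution algebra [Cc] in its largest C*-seminorm,
   expressed by the universal property of this enveloping C*-algebra.  For an
   etale groupoid every *-representation of [Cc] is automatically bounded, so
   no continuity is required of [pi].  As *-homomorphisms between C*-algebras
   are contractive, density of the range makes [phi] unique. *)
Definition is_groupoid_algebra (B : cstar_algebra R) : Prop :=
  exists iota : (G -> R[i]) -> B,
    [/\ Cc_star_hom iota, closure (iota @` Cc) = setT
      & forall (D : cstar_algebra R) (pi : (G -> R[i]) -> D), Cc_star_hom pi ->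
          exists2 phi : B -> D,
            star_hom phi & forall f, Cc f -> phi (iota f) = pi f].

End GroupoidAlgebra.

End CStarAlgebra.

(* Main.v *)
(* X_A is the space of infinite paths x : N^k -> L of the k-graph, because every
   element of N^k lies below a multiple of (1, .., 1), so that a path is determined
   by its pieces of degree (1, .., 1); S_i deletes the initial segment of degree
   e_i.  The sets Z(a, b) = {(ax, d(a) - d(b), bx)}, for s(a) = s(b), are compact
   open bisections and a basis of the groupoid.  A function of Cc is a finite sum
   of functions h(x) on Z(a, b), and in C*(L) such a function corresponds to
   s_a iota(h) s_b^*, where iota maps the indicator of the paths through l to
   s_l s_l^*.  Refining all the a to a common degree shows that the sum does not
   depend on the decomposition, so this is a *-homomorphism from Cc to C*(L).
   Conversely, the indicators of the Z(a, s(a)) form a Cuntz-Krieger family in any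
   *-representation pi of Cc, so that pi factors through C*(L); pi is continuous in
   h because a contraction is the real part of a unitary.  Hence C*(L) itself
   satisfies the universal property of the groupoid algebra. *)
Require Import Defs.
From HB Require Import structures.
From mathcomp Require Import all_boot all_order all_algebra.
From mathcomp Require Import all_classical all_reals all_analysis.
From mathcomp Require Import complex finmap.
From mathcomp Require Import lra zify ring.

Set Implicit Arguments.
Unset Strict Implicit.
Unset Printing Implicit Defensive.

Import Order.TTheory GRing.Theory Num.Theory numFieldNormedType.Exports.

Local Open Scope classical_set_scope.
Local Open Scope ring_scope.
Local Open Scope complex_scope.

Local Notation kcomp := Defs.kcomp.

(** Two facts that the general theory would supply are proved by hand. First, the relations do not
    say that [s_l s_l^*] and [s_m s_m^*] are orthogonal for distinct [l], [m] of equal degree; one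
    usually compares positive elements. Norm estimates replace positivity: the C*-identity and a few
    polynomial identities show that, for a projection [e] and a self-adjoint [g] in its corner,
    [e + g] and [e - g] are both contractions only if [g = 0]. Orthogonality follows from this.
    Second, a vertex may receive no path of a given degree, so a finite path need not extend to an
    infinite one, and statements about infinite paths have to be brought back to finite ones. This
    is always done by one bar induction, [path_bar]: a property that a path inherits from all its
    one-step extensions, and that is met along every infinite path, holds at the root. It shows that
    [s_l = 0] if no infinite path starts with [l], that the bisections are compact, and that
    continuous functions are uniform limits of locally constant ones. *)

(** * Real-valued norms and convergent sequences *)

Section RealNorm.
Context {R : realType} {V : normedModType R[i]}.
Implicit Types x y z : V.

(** The norm of a normed module over [R[i]] takes its values in [R[i]]; estimates are made in the
    ordered field [R] instead. *)
Definition nrm x : R := complex.Re `|x|.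

Lemma nrmE x : `|x| = (nrm x)%:C.
Proof. by rewrite RRe_real ?normr_real. Qed.

Lemma nrm_ge0 x : 0 <= nrm x.
Proof. by rewrite -ler0c -nrmE normr_ge0. Qed.

Lemma Re_norm_ge0 (a : R[i]) : 0 <= complex.Re `|a|.
Proof. by rewrite -ler0c RRe_real ?normr_real ?normr_ge0. Qed.

Lemma nrm0 : nrm (0 : V) = 0.
Proof. by rewrite /nrm normr0. Qed.

Lemma nrm_eq0 x : nrm x = 0 -> x = 0.
Proof. by move=> h; apply/eqP; rewrite -normr_eq0 nrmE h. Qed.

Lemma nrm_le0 x : nrm x <= 0 -> x = 0.
Proof. by move=> h; apply: nrm_eq0; apply/le_anti; rewrite h nrm_ge0. Qed.

Lemma nrmD x y : nrm (x + y) <= nrm x + nrm y.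
Proof. by rewrite -lecR rmorphD /= -!nrmE ler_normD. Qed.

Lemma nrmN x : nrm (- x) = nrm x.
Proof. by rewrite /nrm normrN. Qed.

Lemma nrmB x y : nrm (x - y) = nrm (y - x).
Proof. by rewrite -opprB nrmN. Qed.

Lemma nrmBD x y z : nrm (x - z) <= nrm (x - y) + nrm (y - z).
Proof. by rewrite -[x - z](subrKA y); exact: nrmD. Qed.

Lemma le_halves (a b e : R) : a <= e / 2 -> b <= e / 2 -> a + b <= e.
Proof. lra. Qed.

Lemma nrm_tri x y z (a b c : R) :
  nrm (x - y) <= a -> nrm (y - z) <= b -> a + b <= c -> nrm (x - z) <= c.
Proof. by move=> h1 h2; apply: le_trans; rewrite (le_trans (nrmBD _ y _)) // lerD. Qed.

Lemma nrm_triC x y z (a b c : R) :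
  nrm (x - y) <= a -> nrm (z - y) <= b -> a + b <= c -> nrm (x - z) <= c.
Proof. by rewrite (nrmB z); exact: nrm_tri. Qed.

Lemma nrmZ (a : R[i]) x : nrm (a *: x) = complex.Re `|a| * nrm x.
Proof.
apply: complexI; rewrite rmorphM -[LHS]nrmE -[X in _ * X]nrmE normrZ.
by congr (_ * _); rewrite [RHS]RRe_real ?normr_real.
Qed.

Lemma nrm_sum (I : Type) (r : seq I) (F : I -> V) :
  nrm (\sum_(i <- r) F i) <= \sum_(i <- r) nrm (F i).
Proof.
elim: r => [|i r IH]; first by rewrite !big_nil nrm0.
by rewrite !big_cons (le_trans (nrmD _ _)) // lerD2l.
Qed.

Lemma nrm_eps_eq x y : (forall e : R, 0 < e -> nrm (x - y) <= e) -> x = y.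
Proof.
move=> h; apply/eqP; rewrite -subr_eq0; apply/eqP/nrm_le0.
by apply/ler_addgt0Pr => e e0; rewrite add0r h.
Qed.

Lemma nrm_ball x y (e : R) : ball x e%:C y <-> nrm (x - y) < e.
Proof. by rewrite -ball_normE /ball_ /= nrmE ltcR. Qed.

Lemma posC_real (e : R[i]) : 0 < e -> e = (complex.Re e)%:C /\ 0 < complex.Re e.
Proof.
move=> e0; have ee : e = (complex.Re e)%:C by rewrite RRe_real ?gtr0_real.
by split=> //; rewrite -ltcR -ee.
Qed.

Definition tends (u : nat -> V) (l : V) : Prop :=
  forall e : R, 0 < e -> exists N, forall n, (N <= n)%N -> nrm (u n - l) <= e.

Lemma tends_unique u l l' : tends u l -> tends u l' -> l = l'.
Proof.
move=> h h'; apply: nrm_eps_eq => e e0; have e20 : 0 < e / 2 by lra.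
have [N hN] := h _ e20; have [N' hN'] := h' _ e20.
have := hN _ (leq_maxl N N'); have := hN' _ (leq_maxr N N').
rewrite nrmB (nrmB _ l) => h1 h2; apply: (nrm_triC h2 h1); lra.
Qed.

Lemma tends_ext u u' l : u =1 u' -> tends u l -> tends u' l.
Proof. by move=> e h d d0; have [N hN] := h _ d0; exists N => n /hN; rewrite e. Qed.

Lemma tends_cst l : tends (fun=> l) l.
Proof. by move=> e e0; exists 0%N => n _; rewrite subrr nrm0 ltW. Qed.

Lemma tendsD u u' l l' : tends u l -> tends u' l' ->
  tends (fun n => u n + u' n) (l + l').
Proof.
move=> h h' e e0; have e20 : 0 < e / 2 by lra.
have [N hN] := h _ e20; have [N' hN'] := h' _ e20.
exists (maxn N N') => n; rewrite geq_max => /andP[/hN a /hN' b].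
rewrite opprD addrACA (le_trans (nrmD _ _)) //; lra.
Qed.

Lemma tendsZ (a : R[i]) u l : tends u l -> tends (fun n => a *: u n) (a *: l).
Proof.
move=> h e e0; set c := complex.Re `|a|.
have c0 : 0 <= c by exact: Re_norm_ge0.
have [N hN] := h (e / (c + 1)) ltac:(by apply: divr_gt0 => //; lra).
exists N => n /hN hn; rewrite -scalerBr nrmZ -/c.
apply: (le_trans (ler_wpM2l c0 hn)); rewrite mulrA ler_pdivrMr; last lra.
by rewrite mulrC ler_wpM2l // ?ltW //; lra.
Qed.

Lemma tends_closed (M : set V) u l :
  closed M -> tends u l -> (forall n, M (u n)) -> M l.
Proof.
move=> cM h hu; apply: cM => U /nbhs_ballP [e /= /posC_real [-> e0] hU].
have [N /(_ N (leqnn N)) hN] := h (complex.Re e / 2) ltac:(lra).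
exists (u N); split=> //; apply: hU; apply/nrm_ball; rewrite nrmB; lra.
Qed.

End RealNorm.

Lemma tends_complete {R : realType} {V : completeNormedModType R[i]}
    (u : nat -> V) :
  (forall e : R, 0 < e -> exists N, forall n m, (N <= n)%N -> (N <= m)%N ->
     nrm (u n - u m) <= e) ->
  exists l, tends u l.
Proof.
move=> h; have cu : cauchy (u @ \oo).
  apply: cauchy_exP => e /posC_real [-> e0].
  have [N hN] := h (complex.Re e / 2) ltac:(lra).
  exists (u N); exists N => // n /= hn; apply/nrm_ball.
  by have := hN _ _ (leqnn N) hn; lra.
have [l hl] := (cvg_ex _).1 (cauchy_cvg _ cu); exists l => e e0.
have e0C : 0 < e%:C by rewrite ltcR.
move/cvgrPdist_le: hl => /(_ _ e0C) [N _ hN]; exists N => n hn.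
by rewrite nrmB -lecR -nrmE; exact: hN.
Qed.

Lemma inv_small {R : realType} (e : R) : 0 < e ->
  exists N : nat, forall n, (N <= n)%N -> n.+1%:R^-1 <= e.
Proof.
move=> e0; have [N hN] := ltr_add_invr e0.
exists N => n hn; rewrite add0r in hN; apply: (le_trans _ (ltW hN)).
by rewrite lef_pV2 ?posrE ?ltr0n // ler_nat ltnS.
Qed.

(** * Elementary calculus in a C*-algebra *)

Section CStarNorm.
Context {R : realType} {D : cstar_algebra R}.
Implicit Types x y : D.

Lemma nrmM x y : nrm (x ** y) <= nrm x * nrm y.
Proof. by rewrite -lecR rmorphM /= -!nrmE cs_normM. Qed.

Lemma nrm_starM x : nrm (x^# ** x) = nrm x ^+ 2.
Proof. by apply: complexI; rewrite rmorphXn /= -!nrmE cs_norm_star. Qed.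

(** The C*-identity gives [|x|^2 <= |x^#| |x|], and one may divide by [|x|]; the other inequality is
    the same one at [x^#]. *)
Lemma nrm_star x : nrm (x^#) = nrm x.
Proof.
have le (z : D) : nrm z <= nrm (z^#).
  have [->|z0] := eqVneq z 0; first by rewrite nrm0 nrm_ge0.
  have z0' : 0 < nrm z.
    rewrite lt_neqAle nrm_ge0 andbT eq_sym.
    by apply: contraNneq z0 => /nrm_eq0 ->.
  by rewrite -(ler_pM2r z0'); apply: le_trans (nrmM _ _); rewrite nrm_starM expr2.
by apply/le_anti; rewrite le andbT -{2}(cs_starK x) le.
Qed.

Lemma cs_mul0l x : 0 ** x = 0.
Proof. by apply: (@addIr _ (0 ** x)); rewrite -cs_mulDl !add0r. Qed.

Lemma cs_mul0r x : x ** 0 = 0.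
Proof. by apply: (@addIr _ (x ** 0)); rewrite -cs_mulDr !add0r. Qed.

Lemma cs_mulNl x y : (- x) ** y = - (x ** y).
Proof. by rewrite -scaleN1r cs_mulZl scaleN1r. Qed.

Lemma cs_mulNr x y : x ** (- y) = - (x ** y).
Proof. by rewrite -scaleN1r cs_mulZr scaleN1r. Qed.

Lemma cs_mulBl x y z : (x - y) ** z = x ** z - y ** z.
Proof. by rewrite cs_mulDl cs_mulNl. Qed.

Lemma cs_mulBr x y z : x ** (y - z) = x ** y - x ** z.
Proof. by rewrite cs_mulDr cs_mulNr. Qed.

Lemma cs_star0 : (0 : D)^# = 0.
Proof. by apply: (@addIr _ ((0 : D)^#)); rewrite -cs_starD !add0r. Qed.

Lemma cs_starN x : (- x)^# = - x^#.
Proof. by rewrite -scaleN1r cs_starZ rmorphN rmorph1 scaleN1r. Qed.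

Lemma cs_starB x y : (x - y)^# = x^# - y^#.
Proof. by rewrite cs_starD cs_starN. Qed.

Lemma cs_mul_suml (I : Type) (r : seq I) (F : I -> D) x :
  (\sum_(i <- r) F i) ** x = \sum_(i <- r) F i ** x.
Proof.
elim: r => [|i r IH]; first by rewrite !big_nil cs_mul0l.
by rewrite !big_cons cs_mulDl IH.
Qed.

Lemma cs_mul_sumr (I : Type) (r : seq I) (F : I -> D) x :
  x ** (\sum_(i <- r) F i) = \sum_(i <- r) x ** F i.
Proof.
elim: r => [|i r IH]; first by rewrite !big_nil cs_mul0r.
by rewrite !big_cons cs_mulDr IH.
Qed.

Lemma cs_star_sum (I : Type) (r : seq I) (F : I -> D) :
  (\sum_(i <- r) F i)^# = \sum_(i <- r) (F i)^#.
Proof.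
elim: r => [|i r IH]; first by rewrite !big_nil cs_star0.
by rewrite !big_cons cs_starD IH.
Qed.

Lemma tendsM (u u' : nat -> D) l l' : tends u l -> tends u' l' ->
  tends (fun n => u n ** u' n) (l ** l').
Proof.
move=> h h' e e0; pose c := nrm l + nrm l' + 2.
have l0 := nrm_ge0 l; have l0' := nrm_ge0 l'.
have c0 : 0 < c by rewrite /c; lra.
(* With [d <= 1] the factor [u' n] has norm at most [nrm l' + 1], so the two error terms add up to
   at most [d * c]. *)
pose d := Num.min 1 (e / c).
have d0 : 0 < d by rewrite lt_min ltr01 divr_gt0.
have [N hN] := h _ d0; have [N' hN'] := h' _ d0.
exists (maxn N N') => n; rewrite geq_max => /andP[/hN a /hN' b].
have dc : d * c <= e by rewrite -ler_pdivlMr // ge_min lexx orbT.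
have d1 : d <= 1 by rewrite ge_min lexx.
have -> : u n ** u' n - l ** l' = (u n - l) ** u' n + l ** (u' n - l').
  by rewrite cs_mulBl cs_mulBr subrKA.
apply: (le_trans (nrmD _ _)); apply: le_trans dc.
have hu' : nrm (u' n) <= nrm l' + 1.
  by rewrite -[u' n](subrK l') (le_trans (nrmD _ _)) //; lra.
have := nrmM (u n - l) (u' n); have := nrmM l (u' n - l').
have := nrm_ge0 (u n - l); have := nrm_ge0 (u' n).
have p1 : nrm (u n - l) * nrm (u' n) <= d * (nrm l' + 1).
  by rewrite ler_pM ?nrm_ge0.
have p2 : nrm l * nrm (u' n - l') <= nrm l * d by rewrite ler_wpM2l.
rewrite /c; have p3 : 0 <= d by exact: ltW.
nra.
Qed.

Lemma tends_star (u : nat -> D) l : tends u l -> tends (fun n => (u n)^#) l^#.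
Proof.
move=> h e e0; have [N hN] := h _ e0; exists N => n /hN.
by rewrite -cs_starB nrm_star.
Qed.

Lemma nrm_projection_le1 x : x^# = x -> x ** x = x -> nrm x <= 1.
Proof.
move=> xs xx; have := nrm_starM x; rewrite xs xx expr2.
by have := nrm_ge0 x => h0 h; nra.
Qed.

End CStarNorm.

(** * The C*-algebra universal for a class of bounded families of generators *)

(* The universal algebra is built without a quotient of a free algebra: its
   elements are uniformly Cauchy sequences of formal *-polynomials, and every
   identity is checked in all the representations.  The representations range
   over a large type, but are only quantified over in propositions. *)
Section UniversalCStarAlgebra.
Context {R : realType} (I : Type).
Variable P : forall D : cstar_algebra R, (I -> D) -> Prop.

Inductive star_term : Type :=
| TGen of I
| TZero
| TAdd of star_term & star_term
| TScale of R[i] & star_term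
| TMul of star_term & star_term
| TStar of star_term.

Record representation := Representation {
  rep_alg : cstar_algebra R;
  rep_gen : I -> rep_alg;
  rep_genP : P rep_gen }.

Hypothesis gen_le1 : forall (r : representation) i, nrm (rep_gen r i) <= 1.

Fixpoint term_eval (D : cstar_algebra R) (g : I -> D) (t : star_term) : D :=
  match t with
  | TGen i => g i
  | TZero => 0
  | TAdd t1 t2 => term_eval g t1 + term_eval g t2
  | TScale a t1 => a *: term_eval g t1
  | TMul t1 t2 => term_eval g t1 ** term_eval g t2
  | TStar t1 => (term_eval g t1)^#
  end.

Definition rep_eval (r : representation) := term_eval (@rep_gen r).

(** The bound does not depend on the representation, which is what makes the supremum [unorm]
    finite. *)
Lemma rep_eval_bounded (t : star_term) :
  exists c : R, 0 <= c /\ forall r, nrm (rep_eval r t) <= c.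
Proof.
elim: t => [i||t1 [c1 [p1 h1]] t2 [c2 [p2 h2]]|a t [c [p h]]
           |t1 [c1 [p1 h1]] t2 [c2 [p2 h2]]|t [c [p h]]].
- by exists 1; split=> // r; exact: gen_le1.
- by exists 0; split=> // r; rewrite nrm0.
- exists (c1 + c2); split=> [|r]; first exact: addr_ge0.
  by rewrite (le_trans (nrmD _ _)) // lerD ?h1 ?h2.
- have a0 : 0 <= complex.Re `|a| by exact: Re_norm_ge0.
  exists (complex.Re `|a| * c); split=> [|r]; first exact: mulr_ge0.
  by rewrite /= /rep_eval /= nrmZ ler_wpM2l ?h.
- exists (c1 * c2); split=> [|r]; first exact: mulr_ge0.
  by rewrite (le_trans (nrmM _ _)) // ler_pM ?nrm_ge0 ?h1 ?h2.
- by exists c; split=> // r; rewrite nrm_star.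
Qed.

Definition unif_cauchy (u : nat -> star_term) : Prop :=
  forall e : R, 0 < e -> exists N, forall n m, (N <= n)%N -> (N <= m)%N ->
    forall r, nrm (rep_eval r (u n) - rep_eval r (u m)) <= e.

Definition rep_lim (r : representation) (u : nat -> star_term) : rep_alg r :=
  xget 0 [set l | tends (rep_eval r \o u) l].

Lemma rep_limE r u l : tends (rep_eval r \o u) l -> rep_lim r u = l.
Proof. by move=> h; apply: xget_unique => // l' /tends_unique; apply. Qed.

Lemma rep_lim_tends r u : unif_cauchy u -> tends (rep_eval r \o u) (rep_lim r u).
Proof.
move=> cu; have [l hl] : exists l, tends (rep_eval r \o u) l.
  by apply: tends_complete => e /cu [N hN]; exists N => n m a b; exact: hN.
by rewrite (rep_limE hl).
Qed.

Definition same_limit (u v : nat -> star_term) : Prop :=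
  forall r, rep_lim r u = rep_lim r v.

HB.instance Definition _ := gen_eqMixin star_term.
HB.instance Definition _ := gen_choiceMixin star_term.

(** One chosen sequence in each [same_limit] class. The sequences fixed by this choice form [ucar],
    so two elements of [ucar] are equal as soon as they agree in all representations. *)
Definition representative (u : nat -> star_term) : nat -> star_term :=
  xget (fun=> TZero) [set v | unif_cauchy v /\ same_limit v u].

Lemma representativeP u : unif_cauchy u ->
  unif_cauchy (representative u) /\ same_limit (representative u) u.
Proof.
move=> cu.
by case: (xgetPex (fun=> TZero) (ex_intro (fun v => unif_cauchy v /\ same_limit v u) u
  (conj cu (fun r => erefl)))).
Qed.

Lemma representative_eq u v :
  same_limit u v -> representative u = representative v.
Proof.
move=> h; congr (xget _ _); apply/seteqP.
by split=> w /= [cw hw]; split=> // r; rewrite hw h.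
Qed.

Definition ucar : Type :=
  {u : nat -> star_term | `[< unif_cauchy u /\ representative u = u >]}.

HB.instance Definition _ := gen_eqMixin ucar.
HB.instance Definition _ := gen_choiceMixin ucar.

Definition uev (r : representation) (b : ucar) : rep_alg r := rep_lim r (val b).

Lemma uev_inj (b c : ucar) : (forall r, uev r b = uev r c) -> b = c.
Proof.
case: b c => [u hu] [v hv] h; apply: val_inj => /=.
have [[_ eu] [_ ev]] := (asboolP _ hu, asboolP _ hv).
by rewrite -eu -ev; exact: representative_eq.
Qed.

Definition realizes (d : forall r, rep_alg r) (b : ucar) : Prop :=
  forall r, uev r b = d r.

(** These are the families of the form [uev ^~ b]. Each operation on [ucar] is obtained by applying
    it representation by representation and checking that the resulting family is approximable. *)
Definition approximable (d : forall r, rep_alg r) : Prop :=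
  exists2 u, unif_cauchy u & forall r, tends (rep_eval r \o u) (d r).

Lemma approximable_realizes d : approximable d -> exists b, realizes d b.
Proof.
move=> [u cu hu]; have [cr hr] := representativeP cu.
have hb : `[< unif_cauchy (representative u) /\
  representative (representative u) = representative u >].
  by apply/asboolP; split=> //; exact: representative_eq.
exists (exist (fun u => `[< unif_cauchy u /\ representative u = u >]) _ hb) => r.
by rewrite /uev /= hr; exact: rep_limE.
Qed.

Lemma uev_approximable (b : ucar) : approximable (uev ^~ b).
Proof.
by have [cu _] := asboolP _ (valP b); exists (val b) => // r; exact: rep_lim_tends.
Qed.

Lemma uev_unif (b : ucar) (e : R) : 0 < e ->
  exists t, forall r, nrm (rep_eval r t - uev r b) <= e.
Proof.
move=> e0; have [cu _] := asboolP _ (valP b); have [N hN] := cu _ e0.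
exists (val b N) => r; rewrite nrmB.
have : tends (fun n => (rep_eval r \o val b) n + - rep_eval r (val b N))
    (uev r b - rep_eval r (val b N)).
  by apply: tendsD (tends_cst _); exact: rep_lim_tends.
move=> h; apply/ler_addgt0Pr => e' e0'; have [M hM] := h _ e0'.
set m := maxn N M; have := hM m (leq_maxr _ _).
have /= := hN m N (leq_maxl _ _) (leqnn _) r.
set x := rep_eval r (val b m); set y := rep_eval r (val b N); set z := uev r b.
move=> h1 h2; rewrite -(subrK (x - y) (z - y)).
rewrite (le_trans (nrmD _ _)) // addrC lerD // nrmB //.
Qed.

Lemma unif_approximable (d : forall r, rep_alg r) :
  (forall e : R, 0 < e -> exists t, forall r, nrm (rep_eval r t - d r) <= e) ->
  approximable d.
Proof.
move=> h; have /choice [u hu] : forall n : nat, exists t,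
    forall r, nrm (rep_eval r t - d r) <= n.+1%:R^-1.
  by move=> n; apply: h; rewrite invr_gt0 ltr0n.
exists u => [e e0|r e e0].
- have [N hN] := @inv_small _ (e / 2) ltac:(lra).
  exists N => n m hn hm r; apply: (nrm_triC (hu n r) (hu m r)).
  by rewrite le_halves ?hN.
- by have [N hN] := inv_small e0; exists N => n hn; exact: le_trans (hu n r) (hN n hn).
Qed.

Let op0 : approximable (fun r => 0).
Proof.
exists (fun=> TZero) => [e e0|r]; last exact: tends_cst.
by exists 0%N => n m _ _ r; rewrite subrr nrm0 ltW.
Qed.

(** Uniform continuity on bounded sets, with a modulus common to all representations, is enough for
    an operation to preserve approximable families. Unary operations are treated as binary ones that
    ignore the second argument. *)
Let opN2 (d d' : forall r, rep_alg r) (f : forall r, rep_alg r -> rep_alg r -> rep_alg r)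
    (F : star_term -> star_term -> star_term) :
  (forall r t t', rep_eval r (F t t') = f r (rep_eval r t) (rep_eval r t')) ->
  (forall (e c : R), 0 < e -> 0 <= c -> exists2 e' : R, 0 < e' &
     forall r (x x' y y' : rep_alg r),
       nrm x <= c -> nrm y <= c -> nrm (x' - x) <= e' -> nrm (y' - y) <= e' ->
       nrm (f r x' y' - f r x y) <= e) ->
  approximable d -> approximable d' -> approximable (fun r => f r (d r) (d' r)).
Proof.
move=> hF hf ad ad'; apply: unif_approximable => e e0.
have [b hb] := approximable_realizes ad; have [b' hb'] := approximable_realizes ad'.
have bounded (x : ucar) : exists c : R, 0 <= c /\ forall r, nrm (uev r x) <= c.
  have [t ht] := uev_unif x ltr01; have [c [c0 hc]] := rep_eval_bounded t.
  exists (c + 1); split=> [|r]; first lra.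
  rewrite -(subrK (rep_eval r t) (uev r x)) addrC (le_trans (nrmD _ _)) //.
  by rewrite lerD // nrmB.
have [c [c0 hc]] := bounded b; have [c' [c0' hc']] := bounded b'.
have [e' e0' he'] := hf e (c + c') e0 (addr_ge0 c0 c0').
have [t ht] := uev_unif b e0'; have [t' ht'] := uev_unif b' e0'.
exists (F t t') => r; rewrite hF -hb -hb'; apply: he' => //.
- by have := hc r; lra.
- by have := hc' r; lra.
Qed.

Let opD d d' : approximable d -> approximable d' -> approximable (fun r => d r + d' r).
Proof.
apply: (@opN2 _ _ (fun r x y => x + y) TAdd) => // e c e0 c0.
exists (e / 2) => [|r x x' y y' _ _ hx hy]; first lra.
rewrite opprD addrACA (le_trans (nrmD _ _)) //; lra.
Qed.

Let opZ a d : approximable d -> approximable (fun r => a *: d r).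
Proof.
move=> ad; apply: (@opN2 d d (fun r x y => a *: x) (fun t _ => TScale a t)) => // e c e0 c0.
have a0 : 0 <= complex.Re `|a| by exact: Re_norm_ge0.
exists (e / (complex.Re `|a| + 1)) => [|r x x' y y' _ _ hx hy].
  by apply: divr_gt0 => //; lra.
rewrite -scalerBr nrmZ (le_trans (ler_wpM2l a0 hx)) // mulrA ler_pdivrMr; last lra.
by rewrite mulrC ler_wpM2l ?ltW //; lra.
Qed.

Let opM d d' : approximable d -> approximable d' -> approximable (fun r => d r ** d' r).
Proof.
apply: (@opN2 _ _ (fun r x y => x ** y) TMul) => // e c e0 c0.
pose e' := Num.min 1 (e / (2 * c + 1)).
have h0 : 0 < e' by rewrite lt_min ltr01 divr_gt0 //; lra.
exists e' => // r x x' y y' hx hy hx' hy'.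
have e1 : e' <= 1 by rewrite ge_min lexx.
have e2 : e' * (2 * c + 1) <= e.
  by rewrite -ler_pdivlMr ?ge_min ?lexx ?orbT //; lra.
have -> : x' ** y' - x ** y = (x' - x) ** y' + x ** (y' - y).
  by rewrite cs_mulBl cs_mulBr subrKA.
apply: (le_trans (nrmD _ _)); apply: le_trans e2.
have hu' : nrm y' <= c + 1.
  by rewrite -[y'](subrK y) (le_trans (nrmD _ _)) //; lra.
have := nrmM (x' - x) y'; have := nrmM x (y' - y).
have p1 : nrm (x' - x) * nrm y' <= e' * (c + 1) by rewrite ler_pM ?nrm_ge0.
have p2 : nrm x * nrm (y' - y) <= c * e' by rewrite ler_pM ?nrm_ge0.
nra.
Qed.

Let opS d : approximable d -> approximable (fun r => (d r)^#).
Proof.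
move=> ad; apply: (@opN2 d d (fun r x y => x^#) (fun t _ => TStar t)) => // e c e0 c0.
by exists e => // r x x' y y' _ _ hx _; rewrite -cs_starB nrm_star.
Qed.

Definition uzero : ucar := sval (cid (approximable_realizes op0)).
Definition uadd (b c : ucar) : ucar :=
  sval (cid (approximable_realizes (opD (uev_approximable b) (uev_approximable c)))).
Definition uscale (a : R[i]) (b : ucar) : ucar :=
  sval (cid (approximable_realizes (opZ a (uev_approximable b)))).
Definition uopp (b : ucar) : ucar := uscale (-1) b.
Definition umul (b c : ucar) : ucar :=
  sval (cid (approximable_realizes (opM (uev_approximable b) (uev_approximable c)))).
Definition ustar (b : ucar) : ucar :=
  sval (cid (approximable_realizes (opS (uev_approximable b)))).

Lemma uev0 r : uev r uzero = 0.
Proof. by rewrite /uzero; case: cid. Qed.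
Lemma uevD r b c : uev r (uadd b c) = uev r b + uev r c.
Proof. by rewrite /uadd; case: cid. Qed.
Lemma uevZ r a b : uev r (uscale a b) = a *: uev r b.
Proof. by rewrite /uscale; case: cid. Qed.
Lemma uevN r b : uev r (uopp b) = - uev r b.
Proof. by rewrite uevZ scaleN1r. Qed.
Lemma uevM r b c : uev r (umul b c) = uev r b ** uev r c.
Proof. by rewrite /umul; case: cid. Qed.
Lemma uevS r b : uev r (ustar b) = (uev r b)^#.
Proof. by rewrite /ustar; case: cid. Qed.

Fact uaddA : associative uadd.
Proof. by move=> x y z; apply: uev_inj => r; rewrite !uevD addrA. Qed.
Fact uaddC : commutative uadd.
Proof. by move=> x y; apply: uev_inj => r; rewrite !uevD addrC. Qed.
Fact uadd0 : left_id uzero uadd.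
Proof. by move=> x; apply: uev_inj => r; rewrite uevD uev0 add0r. Qed.
Fact uaddN : left_inverse uzero uopp uadd.
Proof. by move=> x; apply: uev_inj => r; rewrite uevD uevN uev0 addNr. Qed.

HB.instance Definition _ := GRing.isZmodule.Build ucar uaddA uaddC uadd0 uaddN.

Fact uscaleA a b v : uscale a (uscale b v) = uscale (a * b) v.
Proof. by apply: uev_inj => r; rewrite !uevZ scalerA. Qed.
Fact uscale1 : left_id 1 uscale.
Proof. by move=> v; apply: uev_inj => r; rewrite uevZ scale1r. Qed.
Fact uscaleDr : right_distributive uscale +%R.
Proof. by move=> a x y; apply: uev_inj => r; rewrite uevZ !uevD !uevZ scalerDr. Qed.
Fact uscaleDl v : {morph uscale^~ v : a b / a + b >-> a + b}.
Proof. by move=> a b; apply: uev_inj => r; rewrite uevD !uevZ scalerDl. Qed.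

HB.instance Definition _ :=
  GRing.Zmodule_isLmodule.Build R[i] ucar uscaleA uscale1 uscaleDr uscaleDl.

(** The value 0 keeps the set nonempty even when there is no representation. *)
Definition unorm (b : ucar) : R :=
  sup [set x | x = 0 \/ exists r, x = nrm (uev r b)].

Lemma unorm_has_sup b : has_sup [set x : R | x = 0 \/ exists r, x = nrm (uev r b)].
Proof.
split; first by exists 0; left.
have [t ht] := uev_unif b ltr01; have [c [c0 hc]] := rep_eval_bounded t.
exists (c + 1) => _ [->|[r ->]]; first lra.
rewrite -(subrK (rep_eval r t) (uev r b)) addrC (le_trans (nrmD _ _)) //.
by rewrite lerD // nrmB.
Qed.

Lemma unorm_ge0 b : 0 <= unorm b.
Proof. by apply: sup_upper_bound; [exact: unorm_has_sup|left]. Qed.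

Lemma unorm_ub b r : nrm (uev r b) <= unorm b.
Proof. by apply: sup_upper_bound; [exact: unorm_has_sup|right; exists r]. Qed.

Lemma unorm_le b c : 0 <= c -> (forall r, nrm (uev r b) <= c) -> unorm b <= c.
Proof.
move=> c0 h; apply: ge_sup; first by exists 0; left.
by move=> _ [->|[r ->]].
Qed.

Definition unormC (b : ucar) : R[i] := (unorm b)%:C.

Fact unormD x y : unormC (x + y) <= unormC x + unormC y.
Proof.
rewrite /unormC -rmorphD /= lecR; apply: unorm_le => [|r].
  by rewrite addr_ge0 ?unorm_ge0.
by rewrite uevD (le_trans (nrmD _ _)) // lerD ?unorm_ub.
Qed.

Fact unormZ (a : R[i]) x : unormC (a *: x) = `|a| * unormC x.
Proof.
have hle (b : R[i]) y : unorm (b *: y) <= complex.Re `|b| * unorm y.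
  have b0 : 0 <= complex.Re `|b| by exact: Re_norm_ge0.
  apply: unorm_le => [|r]; first by rewrite mulr_ge0 ?unorm_ge0.
  by rewrite uevZ nrmZ ler_wpM2l ?unorm_ub.
have -> : `|a| = (complex.Re `|a|)%:C by rewrite RRe_real ?normr_real.
rewrite /unormC -rmorphM /=; congr (_%:C); apply/le_anti; rewrite hle /=.
have [->|a0] := eqVneq a 0; first by rewrite Normc.normc0 mul0r unorm_ge0.
have p0 : 0 < complex.Re `|a|.
  by have /posC_real [] : 0 < `|a| by rewrite normr_gt0.
rewrite mulrC -ler_pdivlMr //; have := hle a^-1 (a *: x).
rewrite scalerA mulVf // scale1r; congr (_ <= _); rewrite mulrC; congr (_ * _).
exact: Normc.normcV.
Qed.

Fact unorm_eq0 x : unormC x = 0 -> x = 0.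
Proof.
move=> /complexI h; apply: uev_inj => r; rewrite uev0; apply: nrm_le0.
by rewrite -h unorm_ub.
Qed.

HB.instance Definition _ :=
  @Lmodule_isNormed.Build R[i] ucar unormC unormD unormZ unorm_eq0.

Lemma nrm_unorm (b : ucar) : nrm b = unorm b.
Proof. by []. Qed.

Fact uev_is_sub r (b c : ucar) : uev r (b - c) = uev r b - uev r c.
Proof. by rewrite uevD uevN. Qed.

(** The filter is replaced by centres [b n] of balls of radius [1 / (n + 1)] that belong to it.
    Limits are taken in each representation separately; as the estimates do not depend on [r], the
    family of limits is approximable and comes from an element of [ucar]. *)
Fact ucar_complete (F : set_system ucar) : ProperFilter F -> cauchy F -> cvg F.
Proof.
move=> FF /cauchyP cF.
have inv_pos (n : nat) : 0 < (n.+1%:R^-1 : R)%:C by rewrite ltcR invr_gt0 ltr0n.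
have /choice [b hb] : forall n : nat, exists b : ucar, F (ball b (n.+1%:R^-1 : R)%:C).
  by move=> n; exact: cF (inv_pos n).
have bb n m : nrm (b n - b m) <= n.+1%:R^-1 + m.+1%:R^-1.
  have [c [/nrm_ball h1 /nrm_ball h2]] := filter_ex (filterI (hb n) (hb m)).
  exact: (nrm_triC (ltW h1) (ltW h2)).
have [l hl] : exists l : ucar, forall n r, nrm (uev r (b n) - uev r l) <= n.+1%:R^-1.
  have tl r : exists l, tends (fun n => uev r (b n)) l.
    apply: tends_complete => e e0; have [N /(_ N (leqnn N)) hN] := @inv_small _ (e / 2) ltac:(lra).
    exists N => n m hn hm.
    rewrite -uev_is_sub (le_trans (unorm_ub _ _)) // -nrm_unorm (le_trans (bb n m)) //.
    by apply: le_halves; apply: le_trans hN; rewrite lef_pV2 ?posrE ?ltr0n // ler_nat ltnS.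
  have [l hl] : exists l : forall r, rep_alg r, forall r, tends (fun n => uev r (b n)) (l r).
    exists (fun r => sval (cid (tl r))) => r; exact: svalP (cid (tl r)).
  have hl' n r : nrm (uev r (b n) - l r) <= n.+1%:R^-1.
    apply/ler_addgt0Pr => e e0; have [M hM] := hl r (e / 2) ltac:(lra).
    have [N /(_ N (leqnn N)) hN] := @inv_small _ (e / 2) ltac:(lra); set m := maxn M N.
    have h1 : nrm (uev r (b n) - uev r (b m)) <= n.+1%:R^-1 + m.+1%:R^-1.
      by rewrite -uev_is_sub (le_trans (unorm_ub _ _)).
    have h2 : m.+1%:R^-1 <= N.+1%:R^-1 :> R.
      by rewrite lef_pV2 ?posrE ?ltr0n // ler_nat ltnS leq_maxr.
    apply: (nrm_tri h1 (hM m (leq_maxl _ _))).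
    by rewrite -addrA lerD2l le_halves // (le_trans h2).
  have [x hx] : exists x, realizes l x.
    apply: approximable_realizes; apply: unif_approximable => e e0.
    have [N /(_ N (leqnn N)) hN] := @inv_small _ (e / 2) ltac:(lra).
    have [t ht] := @uev_unif (b N) (e / 2) ltac:(lra).
    by exists t => r; exact: (nrm_tri (ht r) (hl' N r) (le_halves (lexx _) hN)).
  by exists x => n r; rewrite hx.
apply/cvg_ex; exists l => U /nbhs_ballP [e /= /posC_real [-> e0] hU].
have [N /(_ N (leqnn N)) hN] := @inv_small _ (complex.Re e / 3) ltac:(lra).
apply: filterS (hb N) => x /nrm_ball hx; apply: hU; apply/nrm_ball.
have h1 : nrm (b N - l) <= N.+1%:R^-1.
  apply: unorm_le => [|r]; first by rewrite invr_ge0 ler0n.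
  by rewrite uev_is_sub.
rewrite nrmB in h1; apply: (le_lt_trans (nrm_tri h1 (ltW hx) (lexx _))).
apply: (@le_lt_trans _ _ (complex.Re e / 3 + complex.Re e / 3)); first exact: lerD.
by move: e0 => /= e0; lra.
Qed.

HB.instance Definition _ := Uniform_isComplete.Build ucar ucar_complete.

Fact umulA : associative umul.
Proof. by move=> x y z; apply: uev_inj => r; rewrite !uevM cs_mulA. Qed.
Fact umulDl : left_distributive umul +%R.
Proof. by move=> x y z; apply: uev_inj => r; rewrite uevM !uevD !uevM cs_mulDl. Qed.
Fact umulDr : right_distributive umul +%R.
Proof. by move=> x y z; apply: uev_inj => r; rewrite uevM !uevD !uevM cs_mulDr. Qed.
Fact umulZl (a : R[i]) (x y : ucar) : umul (a *: x) y = a *: umul x y.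
Proof. by apply: uev_inj => r; rewrite uevM !uevZ uevM cs_mulZl. Qed.
Fact umulZr (a : R[i]) (x y : ucar) : umul x (a *: y) = a *: umul x y.
Proof. by apply: uev_inj => r; rewrite uevM !uevZ uevM cs_mulZr. Qed.
Fact ustarK : involutive ustar.
Proof. by move=> x; apply: uev_inj => r; rewrite !uevS cs_starK. Qed.
Fact ustarD : {morph ustar : x y / x + y}.
Proof. by move=> x y; apply: uev_inj => r; rewrite uevS !uevD !uevS cs_starD. Qed.
Fact ustarZ (a : R[i]) (x : ucar) : ustar (a *: x) = a^* *: ustar x.
Proof. by apply: uev_inj => r; rewrite uevS !uevZ uevS cs_starZ. Qed.
Fact ustarM x y : ustar (umul x y) = umul (ustar y) (ustar x).
Proof. by apply: uev_inj => r; rewrite uevS !uevM !uevS cs_starM. Qed.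

Fact unormM (x y : ucar) : `|umul x y| <= `|x| * `|y|.
Proof.
rewrite !nrmE -rmorphM lecR !nrm_unorm; apply: unorm_le => [|r].
  by rewrite mulr_ge0 ?unorm_ge0.
by rewrite uevM (le_trans (nrmM _ _)) // ler_pM ?nrm_ge0 ?unorm_ub.
Qed.

Fact unorm_starM (x : ucar) : `|umul (ustar x) x| = `|x| ^+ 2.
Proof.
rewrite !nrmE -rmorphXn !nrm_unorm; congr (_%:C); apply/le_anti/andP; split.
  apply: unorm_le => [|r]; first by rewrite exprn_ge0 ?unorm_ge0.
  by rewrite uevM uevS nrm_starM lerXn2r ?nnegrE ?nrm_ge0 ?unorm_ge0 ?unorm_ub.
(* Conversely, the C*-identity in [rep_alg r] bounds each [nrm (uev r x)] by the square root of
   [unorm (umul (ustar x) x)]. *)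
rewrite -[leRHS]sqr_sqrtr ?unorm_ge0 // lerXn2r ?nnegrE ?unorm_ge0 ?sqrtr_ge0 //.
apply: unorm_le => [|r]; first exact: sqrtr_ge0.
rewrite -(ger0_norm (nrm_ge0 (uev r x))) -sqrtr_sqr ler_wsqrtr //.
by rewrite -nrm_starM -uevS -uevM unorm_ub.
Qed.

Definition universal_cstar : cstar_algebra R :=
  CStarAlgebra umulA umulDl umulDr umulZl umulZr ustarK ustarD ustarZ ustarM
    unormM unorm_starM.

Lemma gen_approximable i : approximable (fun r => rep_gen r i).
Proof.
by apply: unif_approximable => e e0; exists (TGen i) => r; rewrite subrr nrm0 ltW.
Qed.

Definition ugen (i : I) : universal_cstar :=
  sval (cid (approximable_realizes (gen_approximable i))).

Lemma uev_gen r i : uev r (ugen i) = rep_gen r i.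
Proof. by rewrite /ugen; case: cid. Qed.

Lemma uev_star_hom r : star_hom (uev r : universal_cstar -> rep_alg r).
Proof.
by split=> [x y|a x|x y|x]; rewrite ?uevD ?uevZ ?uevM ?uevS.
Qed.

Lemma uev_le r (b : universal_cstar) : nrm (uev r b) <= nrm b.
Proof. exact: unorm_ub. Qed.

Lemma uev_term r t : uev r (term_eval ugen t) = rep_eval r t.
Proof.
elim: t => [i||t1 h1 t2 h2|a t h|t1 h1 t2 h2|t h] /=.
- exact: uev_gen.
- exact: uev0.
- by rewrite uevD h1 h2.
- by rewrite uevZ h.
- by rewrite uevM h1 h2.
- by rewrite uevS h.
Qed.

Lemma ugen_generated : generated_by ugen.
Proof.
move=> M [M0 MD MZ MM MS] cM Mg; apply/seteqP; split=> // b _.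
have Mt t : M (term_eval ugen t).
  elim: t => [i||t1 h1 t2 h2|a t h|t1 h1 t2 h2|t h] //=.
  - exact: MD.
  - exact: MZ.
  - exact: MM.
  - exact: MS.
apply: cM => U /nbhs_ballP [e /= /posC_real [-> e0] hU].
have [t ht] := @uev_unif b (complex.Re e / 2) ltac:(lra).
exists (term_eval ugen t); split=> //; apply: hU; apply/nrm_ball.
suff : nrm (b - term_eval ugen t) <= complex.Re e / 2 by lra.
apply: unorm_le => [|r]; first lra.
by rewrite uev_is_sub uev_term nrmB.
Qed.

End UniversalCStarAlgebra.

(** * Degrees and unique factorization *)

Section Degrees.
Context {k : nat}.
Implicit Types m n p : 'N^k.

Lemma degDE m n i : (m + n) i = (m i + n i)%N.
Proof. by rewrite ffunE. Qed.

Lemma degDI m n p : m + n = m + p -> n = p.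
Proof.
move=> /ffunP h; apply/ffunP => i; have := h i; rewrite !degDE => /eqP.
by rewrite eqn_add2l => /eqP.
Qed.

Definition dle m n : Prop := forall i, (m i <= n i)%N.
Definition dsub m n : 'N^k := [ffun i => (m i - n i)%N].
Definition cdeg (N : nat) : 'N^k := [ffun=> N].
Definition dmax n : nat := \max_(i < k) n i.

Lemma dsubK m n : dle m n -> m + dsub n m = n.
Proof. by move=> h; apply/ffunP => i; rewrite degDE ffunE subnKC. Qed.

Lemma dle_add m n : dle m (m + n).
Proof. by move=> i; rewrite degDE leq_addr. Qed.

Lemma dle_refl m : dle m m. Proof. by []. Qed.

Lemma dle_trans m n p : dle m n -> dle n p -> dle m p.
Proof. by move=> h1 h2 i; exact: leq_trans (h1 i) (h2 i). Qed.

Lemma dle_dmax n N : (dmax n <= N)%N -> dle n (cdeg N).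
Proof. by move=> h i; rewrite ffunE (leq_trans _ h) // leq_bigmax. Qed.

Lemma cdegD M N : cdeg (M + N) = cdeg M + cdeg N.
Proof. by apply/ffunP => i; rewrite degDE !ffunE. Qed.

Lemma cdeg0 : cdeg 0 = 0.
Proof. by apply/ffunP => i; rewrite !ffunE. Qed.

Lemma dle_cdeg M N : (M <= N)%N -> dle (cdeg M) (cdeg N).
Proof. by move=> h i; rewrite !ffunE. Qed.

End Degrees.

Section Factorization.
Context {k : nat} {L : kgraph k}.
Implicit Types a b c l : L.

Lemma kcomp_inj a b a' b' : src a = rng b -> src a' = rng b' ->
  kcomp a b = kcomp a' b' -> deg a = deg a' -> a = a' /\ b = b'.
Proof.
move=> h h' e d; have eb : deg b = deg b'.
  by apply: (@degDI _ (deg a)); rewrite -deg_comp // e deg_comp // d.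
have [ab [_ u]] := unique_factorization (deg_comp h).
have := u (a, b) (And4 h erefl erefl erefl).
by rewrite (u (a', b') (And4 h' e (esym d) (esym eb))) => -[-> ->].
Qed.

Lemma kcompI a b b' : src a = rng b -> src a = rng b' ->
  kcomp a b = kcomp a b' -> b = b'.
Proof. by move=> h h' e; have [] := kcomp_inj h h' e erefl. Qed.

(** [kcomp (rng a) a] and [kcomp a (src a)] are two factorizations of [a] whose first factors have
    degree 0. *)
Lemma deg0_object a : deg a = 0 -> rng a = a.
Proof.
move=> d; have [] // := @kcomp_inj (rng a) a a (src a).
- by rewrite src_rng.
- by rewrite rng_src.
- by rewrite comp_rng comp_src.
- by rewrite deg_rng.
Qed.

Lemma object_src a : rng a = a -> src a = a.
Proof. by move=> h; rewrite -h src_rng. Qed.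

(** The default [(l, l)] is reached only when [m] is not below [deg l]. *)
Definition factor l (m : 'N^k) : L * L :=
  xget (l, l) [set ab : L * L |
    [/\ src ab.1 = rng ab.2, l = kcomp ab.1 ab.2 & deg ab.1 = m]].

Definition hd l m := (factor l m).1.
Definition tl l m := (factor l m).2.

Lemma factorP l m : dle m (deg l) ->
  [/\ src (hd l m) = rng (tl l m), l = kcomp (hd l m) (tl l m)
    & deg (hd l m) = m].
Proof.
move=> h; have [[a b] [/= [h1 h2 h3 h4] _]] :=
  unique_factorization (esym (dsubK h)).
by apply: (xgetPex (l, l) (P := [set ab : L * L |
    [/\ src ab.1 = rng ab.2, l = kcomp ab.1 ab.2 & deg ab.1 = m]])); exists (a, b).
Qed.

Lemma hd_tl_comp a b : src a = rng b ->
  hd (kcomp a b) (deg a) = a /\ tl (kcomp a b) (deg a) = b.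
Proof.
move=> h; have le : dle (deg a) (deg (kcomp a b)) by rewrite deg_comp //; exact: dle_add.
have [h1 h2 h3] := factorP le.
by have [e1 e2] := kcomp_inj h h1 h2 (esym h3); split.
Qed.

Lemma hd_comp a b m : src a = rng b -> deg a = m -> hd (kcomp a b) m = a.
Proof. by move=> /hd_tl_comp[h _] <-. Qed.

Lemma tl_comp a b m : src a = rng b -> deg a = m -> tl (kcomp a b) m = b.
Proof. by move=> /hd_tl_comp[_ h] <-. Qed.

Lemma deg_tl l (m n : 'N^k) : deg l = m + n -> deg (tl l m) = n.
Proof.
move=> h; have le : dle m (deg l) by rewrite h; exact: dle_add.
have [h1 h2 h3] := factorP le.
by apply: (@degDI _ m); rewrite -h [in RHS]h2 deg_comp // h3.
Qed.

Lemma hd_comp_le a b m : src a = rng b -> dle m (deg a) ->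
  hd (kcomp a b) m = hd a m.
Proof.
move=> h le; have [h1 h2 h3] := factorP le.
rewrite {1}h2 -kcompA -?h2 //; last by rewrite -h h2 src_comp //= -h2.
by apply: hd_comp => //; rewrite rng_comp // -h h2 src_comp // -h2.
Qed.

End Factorization.

(** * Points of the Markov space as infinite paths on [N^k] *)

Section InfinitePaths.
Context {k : nat} {L : kgraph k}.

Definition infinite_path : topologicalType := markov_space (@transition k L).
Notation X := infinite_path.
Implicit Types (x y : X) (a b c : L) (p q : 'N^k).

Definition letter x (n : nat) : L := val (set_val x n : alphabet L).

Lemma deg_letter x n : deg (letter x n) = cdeg 1.
Proof. exact/eqP/(valP (set_val x n : alphabet L)). Qed.

Lemma letter_compose x n : src (letter x n) = rng (letter x n.+1).
Proof.
have := set_valP x n; rewrite /transition.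
by case: eqP.
Qed.

Lemma letter_inj x y : letter x =1 letter y -> x = y.
Proof.
move=> h; apply: val_inj; apply/funext => n; exact: val_inj (h n).
Qed.

Fixpoint pre1 x n : L :=
  if n is n'.+1 then kcomp (pre1 x n') (letter x n') else rng (letter x 0).

Lemma src_pre1 x n : src (pre1 x n) = rng (letter x n).
Proof.
elim: n => [|n IH] /=; first by rewrite src_rng.
by rewrite src_comp // letter_compose.
Qed.

Lemma deg_pre1 x n : deg (pre1 x n) = cdeg n.
Proof.
elim: n => [|n IH] /=; first by rewrite deg_rng cdeg0.
by rewrite deg_comp ?src_pre1 // IH deg_letter -cdegD addn1.
Qed.

Lemma pre1D x M N : exists2 c, src (pre1 x M) = rng c & pre1 x (M + N) = kcomp (pre1 x M) c.
Proof.
elim: N => [|N [c h e]].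
  by exists (src (pre1 x M)); rewrite ?rng_src // addn0 comp_src.
have h' : src c = rng (letter x (M + N)) by rewrite -src_pre1 e src_comp.
by exists (kcomp c (letter x (M + N))); rewrite ?rng_comp // addnS /= e kcompA.
Qed.

(** The segment of the path [x] from 0 to [p]. By [pre_pre1] any number of letters whose total
    degree dominates [p] gives the same segment. *)
Definition pre x p : L := hd (pre1 x (dmax p)) p.

Lemma pre_pre1 x p N : dle p (cdeg N) -> pre x p = hd (pre1 x N) p.
Proof.
move=> h; have le : (dmax p <= N)%N.
  by apply/bigmax_leqP => i _; have := h i; rewrite ffunE.
have [c hc e] := pre1D x (dmax p) (N - dmax p).
rewrite subnKC // in e; rewrite e hd_comp_le // deg_pre1.
exact: dle_dmax.
Qed.

Lemma pre_cdeg x N : pre x (cdeg N) = pre1 x N.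
Proof.
rewrite (pre_pre1 x (dle_refl _)) -{1}[pre1 x N]comp_src hd_comp ?rng_src //.
exact: deg_pre1.
Qed.

Lemma deg_pre x p : deg (pre x p) = p.
Proof.
have le : dle p (deg (pre1 x (dmax p))) by rewrite deg_pre1; exact: dle_dmax.
by have [_ _] := factorP le.
Qed.

Lemma preD x p q :
  exists2 c, src (pre x p) = rng c & pre x (p + q) = kcomp (pre x p) c.
Proof.
pose N := dmax (p + q).
have l2 : dle (p + q) (cdeg N) by exact: dle_dmax.
have l1 : dle p (cdeg N) by apply: dle_trans l2; exact: dle_add.
rewrite (pre_pre1 x l1) (pre_pre1 x l2).
have [] : [/\ _, _ & _] := @factorP _ _ (pre1 x N) p _; first by rewrite deg_pre1.
have [] : [/\ _, _ & _] := @factorP _ _ (pre1 x N) (p + q) _; first by rewrite deg_pre1.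
set u := hd _ _; set w := tl _ _ => h1 h2 h3.
set v := hd _ _; set t := tl _ _ => h4 h5 h6.
have lp : dle p (deg u) by rewrite h3; exact: dle_add.
have [g1 g2 g3] := factorP lp.
have eu : hd u p = v by rewrite /v {1}h2 hd_comp_le.
by exists (tl u p); rewrite -eu.
Qed.

Definition root x : L := pre x 0.

Lemma rng_pre x p : rng (pre x p) = root x.
Proof.
have [c h] := preD x 0 p; rewrite add0r => ->.
by rewrite rng_comp // deg0_object // deg_pre.
Qed.

Lemma rng_root x : rng (root x) = root x.
Proof. exact: rng_pre. Qed.

Lemma src_root x : src (root x) = root x.
Proof. exact/object_src/rng_root. Qed.

Lemma letter_pre x N : letter x N = tl (pre x (cdeg N.+1)) (cdeg N).
Proof. by rewrite pre_cdeg /= tl_comp ?src_pre1 ?deg_pre1. Qed.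

Lemma path_ext x y : (forall N, pre x (cdeg N) = pre y (cdeg N)) -> x = y.
Proof. by move=> h; apply: letter_inj => N; rewrite !letter_pre h. Qed.

Lemma path_exists1 (G : nat -> L) : (forall N, deg (G N) = cdeg N) ->
  (forall N, exists2 c, src (G N) = rng c & G N.+1 = kcomp (G N) c) ->
  exists x, forall N, pre x (cdeg N) = G N.
Proof.
move=> dG cG; pose f N := tl (G N.+1) (cdeg N).
have fP N : src (G N) = rng (f N) /\ G N.+1 = kcomp (G N) (f N).
  by have [c h e] := cG N; rewrite /f e tl_comp.
have df N : deg (f N) == [ffun=> 1%N].
  by rewrite /f (@deg_tl _ _ _ _ (cdeg 1)) // dG -cdegD addn1.
pose z : nat -> alphabet L := fun N => exist _ (f N) (df N).
have zX : markov_space (@transition k L) z.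
  move=> N /=; rewrite /transition /=.
  have [h1 e1] := fP N; have [h2 _] := fP N.+1.
  by rewrite -h2 e1 src_comp // eqxx.
exists (exist _ (z : full_shift (alphabet L)) (mem_set zX)) => N.
rewrite pre_cdeg; elim: N => [|N IH] /=.
  have [h _] := fP 0; rewrite /letter /= -h; apply/object_src/deg0_object.
  by rewrite dG cdeg0.
by rewrite IH; have [_ ->] := fP N.
Qed.

(** The members of diagonal degree already determine the letters; any other [F p] is recovered by
    cutting a diagonal member at [p]. *)
Lemma path_exists (F : 'N^k -> L) : (forall p, deg (F p) = p) ->
  (forall p q, exists2 c, src (F p) = rng c & F (p + q) = kcomp (F p) c) ->
  exists x, forall p, pre x p = F p.
Proof.
move=> dF cF; have [N|N|x hx] := @path_exists1 (fun N => F (cdeg N)).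
- exact: dF.
- by have [c h e] := cF (cdeg N) (cdeg 1); exists c => //; rewrite -addn1 cdegD.
exists x => p; pose N := dmax p; have le : dle p (cdeg N) by exact: dle_dmax.
rewrite (pre_pre1 x le) -pre_cdeg hx -(dsubK le).
by have [c h ->] := cF p (dsub (cdeg N) p); rewrite hd_comp.
Qed.

Lemma shift_exists n x :
  exists y, forall p, src (pre x n) = rng (pre y p) /\
    pre x (n + p) = kcomp (pre x n) (pre y p).
Proof.
have h p : src (pre x n) = rng (tl (pre x (n + p)) n) /\
    pre x (n + p) = kcomp (pre x n) (tl (pre x (n + p)) n).
  by have [c e1 e2] := preD x n p; rewrite e2 tl_comp ?deg_pre.
have [p|p q|y hy] := @path_exists (fun p => tl (pre x (n + p)) n).
- by apply: deg_tl; rewrite deg_pre.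
- have [h1 e1] := h p; have [h2 e2] := h (p + q).
  have [c h3 e3] := preD x (n + p) q.
  have h4 : src (tl (pre x (n + p)) n) = rng c by rewrite -h3 [in RHS]e1 src_comp.
  exists c => //.
  apply: (@kcompI _ _ (pre x n)); rewrite ?rng_comp //.
  by rewrite -e2 addrA e3 {1}e1 kcompA.
by exists y => p; rewrite hy.
Qed.

Definition sh n x : X := sval (cid (shift_exists n x)).

Lemma shP n x p : src (pre x n) = rng (pre (sh n x) p) /\
  pre x (n + p) = kcomp (pre x n) (pre (sh n x) p).
Proof. exact: (svalP (cid (shift_exists n x))). Qed.

Lemma root_sh n x : root (sh n x) = src (pre x n).
Proof. by have [-> _] := shP n x 0; rewrite rng_pre. Qed.

Lemma pre_sh n x p : pre (sh n x) p = tl (pre x (n + p)) n.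
Proof. by have [h ->] := shP n x p; rewrite tl_comp // deg_pre. Qed.

(** The existential stands outside the hypothesis so that [cat] is a total function; on pairs that
    do not compose its value is a dummy. *)
Lemma cat_exists a x : exists y, src a = root x ->
  forall p, pre y (deg a + p) = kcomp a (pre x p).
Proof.
have [h|h] := pselect (src a = root x); last by exists x.
have h' p : src a = rng (pre x p) by rewrite rng_pre.
have le p : dle p (deg (kcomp a (pre x p))).
  by rewrite deg_comp // deg_pre addrC; exact: dle_add.
(* [kcomp a (pre x p)] has degree at least [p], hence is long enough to contain the segment of
   degree [p] of the concatenated path. *)
pose F p := hd (kcomp a (pre x p)) p.
have Fle p q : F p = hd (kcomp a (pre x (p + q))) p.
  have [c e1 e2] := preD x p q; rewrite e2 kcompA // hd_comp_le //.
  by rewrite src_comp.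
have dF p : deg (F p) = p by have [] := factorP (le p).
have [p //|p q|y hy] := @path_exists F.
  have := Fle p q; have := factorP (le (p + q)); rewrite -/(F (p + q)).
  set w := kcomp a _ => -[h1 h2 h3]; rewrite {1}h2 hd_comp_le //; last first.
    by rewrite h3; exact: dle_add.
  move=> ->; have le2 : dle p (deg (F (p + q))) by rewrite h3; exact: dle_add.
  by have [g1 g2 g3] := factorP le2; exists (tl (F (p + q)) p).
exists y => _ p; rewrite hy; have -> : F (deg a + p) = hd (kcomp a (pre x (p + deg a))) (deg a + p).
  by rewrite /F addrC.
have [c e1 e2] := preD x p (deg a); rewrite e2 kcompA // hd_comp ?src_comp //.
by rewrite deg_comp // deg_pre.
Qed.

Definition cat a x : X := sval (cid (cat_exists a x)).

Lemma pre_cat a x p : src a = root x -> pre (cat a x) (deg a + p) = kcomp a (pre x p).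
Proof. by move=> h; have := svalP (cid (cat_exists a x)) h p. Qed.

Lemma pre_cat_deg a x : src a = root x -> pre (cat a x) (deg a) = a.
Proof. by move=> h; have := pre_cat 0 h; rewrite addr0 -/(root x) -h comp_src. Qed.

Lemma root_cat a x : src a = root x -> root (cat a x) = rng a.
Proof. by move=> h; rewrite -(rng_pre _ (deg a)) pre_cat_deg. Qed.

Lemma pre_ext x y (n : 'N^k) : (forall p, pre x (n + p) = pre y (n + p)) -> x = y.
Proof.
move=> h; apply: path_ext => N; have := h (cdeg N); rewrite (addrC n).
have [c e1 ->] := preD x (cdeg N) n; have [c' e2 ->] := preD y (cdeg N) n.
by move=> e; have [] := kcomp_inj e1 e2 e; rewrite ?deg_pre.
Qed.

Lemma sh_cat a x : src a = root x -> sh (deg a) (cat a x) = x.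
Proof.
move=> h; apply: path_ext => N; rewrite pre_sh pre_cat // tl_comp //.
by rewrite rng_pre.
Qed.

Lemma cat_sh n x : cat (pre x n) (sh n x) = x.
Proof.
apply: (@pre_ext _ _ n) => p; rewrite -[X in X + p](deg_pre x n).
rewrite pre_cat ?root_sh // deg_pre.
by have [_ ->] := shP n x p.
Qed.

Lemma sh0 x : sh 0 x = x.
Proof.
apply: path_ext => N; have [h e] := shP 0 x (cdeg N).
rewrite add0r in e; rewrite e -/(root x).
by rewrite -/(root x) src_root in h; rewrite h comp_rng.
Qed.

Lemma shD m n x : sh (m + n) x = sh m (sh n x).
Proof.
apply: path_ext => N; have [h1 e1] := shP (m + n) x (cdeg N).
have [h2 e2] := shP n x m; have [h3 e3] := shP n x (m + cdeg N).
have [h4 e4] := shP m (sh n x) (cdeg N).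
apply: (@kcompI _ _ (pre x (m + n))) => //.
  by rewrite addrC e2 src_comp // h4.
by rewrite -e1 [in RHS]addrC e2 -kcompA // -e4 -e3 addrCA addrA.
Qed.

Definition cyl a : set X := [set x | pre x (deg a) = a].

Lemma cyl_root a x : cyl a x -> root x = rng a.
Proof. by move=> <-; rewrite rng_pre. Qed.

Lemma cyl_cat a x : src a = root x -> cyl a (cat a x).
Proof. exact: pre_cat_deg. Qed.

Lemma cyl_pre x p : cyl (pre x p) x.
Proof. by rewrite /cyl /= deg_pre. Qed.

Lemma cyl_sh a x : cyl a x -> root (sh (deg a) x) = src a.
Proof. by move=> h; rewrite root_sh h. Qed.

Lemma cyl_cat_sh a x : cyl a x -> cat a (sh (deg a) x) = x.
Proof. by move=> h; rewrite -{1}h cat_sh. Qed.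

Lemma cyl_object v x : rng v = v -> cyl v x <-> root x = v.
Proof.
move=> h; have d0 : deg v = 0 by rewrite -h deg_rng.
by rewrite /cyl /= d0.
Qed.

Lemma cyl_comp a b x : src a = rng b ->
  cyl (kcomp a b) x <-> cyl a x /\ cyl b (sh (deg a) x).
Proof.
move=> h; rewrite /cyl /= deg_comp //; have [h1 ->] := shP (deg a) x (deg b).
split=> [e|[-> ->] //].
by have [] := kcomp_inj h1 h e; rewrite ?deg_pre.
Qed.

(** If [Q] failed at [v], it would fail at some one-step extension of each failure, and the
    successive choices would form an infinite path on which [Q] never holds. Branching need not be
    finite, and at a path without extensions the first hypothesis gives [Q] outright. *)
Lemma path_bar (Q : L -> Prop) v :
  (forall a, (forall b, src a = rng b -> deg b = cdeg 1 -> Q (kcomp a b)) -> Q a) ->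
  rng v = v -> (forall x, root x = v -> exists n, Q (pre x (cdeg n))) -> Q v.
Proof.
move=> hQ hv hx; apply: contrapT => nQ.
have step a : exists b, ~ Q a -> [/\ src a = rng b, deg b = cdeg 1 & ~ Q (kcomp a b)].
  have [qa|na] := pselect (Q a); first by exists a.
  have [b hb] : exists b, ~ (src a = rng b -> deg b = cdeg 1 -> Q (kcomp a b)).
    by apply: contrapT => h; apply: na; apply: hQ => b; apply: contrapT => h'; apply: h; exists b.
  exists b => _; have [h1 h2] := (not_implyP _ _).1 hb.
  by have [h3 h4] := (not_implyP _ _).1 h2.
have [f hf] := choice step.
pose G n := iter n (fun a => kcomp a (f a)) v.
have nG n : ~ Q (G n) by elim: n => //= n /hf [].
have dG n : deg (G n) = cdeg n.
  elim: n => [|n IH]; first by rewrite -[G 0]/v -hv deg_rng cdeg0.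
  have [h1 h2 _] := hf _ (nG n).
  by rewrite [G _]/= deg_comp // IH h2 -cdegD addn1.
have [n|x hxG] := path_exists1 dG.
  by have [h1 h2 _] := hf _ (nG n); exists (f (G n)).
have [n] : exists n, Q (pre x (cdeg n)).
  by apply: hx; rewrite /root -cdeg0 hxG.
by rewrite hxG; exact: nG.
Qed.

End InfinitePaths.

(** * Projections whose sum is a projection are orthogonal *)

Section Projections.
Context {R : realType} {D : cstar_algebra R}.
Implicit Types (x y e g p : D).

(* The conjugation of [cs_starZ] is [Num.conj], that of [involution] is [conjc]. *)
Lemma cs_starZc (a : R[i]) x : (a *: x)^# = conjc a *: x^#.
Proof. exact: cs_starZ. Qed.

Lemma cs_sqr_eq0 x : x^# ** x = 0 -> x = 0.
Proof.
move=> h; apply: nrm_eq0; have := nrm_starM x.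
by rewrite h nrm0 => /esym/eqP; rewrite sqrf_eq0 => /eqP.
Qed.

Lemma nrmZR (a : R) x : 0 <= a -> nrm (a%:C *: x) = a * nrm x.
Proof. by move=> a0; rewrite nrmZ ger0_norm ?ler0c. Qed.

(** With [e] acting as the unit on [g], products of polynomials in [g] reduce to identities between
    coefficients; degree three suffices for [contraction_growth]. *)
Definition cubic e g (a b c d : R[i]) : D :=
  a *: e + b *: g + c *: (g ** g) + d *: (g ** g ** g).

Lemma cubicM e g (a b c s : R[i]) : e ** e = e -> e ** g = g -> g ** e = g ->
  cubic e g a b c 0 ** cubic e g 1 s 0 0 =
  cubic e g a (b + s * a) (c + s * b) (s * c).
Proof.
move=> ee eg ge; rewrite /cubic !scale0r !addr0 scale1r.
rewrite !cs_mulDl !cs_mulDr !cs_mulZl !cs_mulZr ee eg ge -(cs_mulA g g e) ge.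
rewrite !scalerA ![_ * s]mulrC !scalerDl -!addrA; congr (_ + _).
by rewrite [LHS]addrCA; congr (_ + (_ + _)); exact: addrCA.
Qed.

Lemma cubicD e g (a b c d a' b' c' d' : R[i]) :
  cubic e g a b c d + cubic e g a' b' c' d' =
  cubic e g (a + a') (b + b') (c + c') (d + d').
Proof. by rewrite /cubic !scalerDl addrACA [X in X + _]addrACA [X in X + _ + _]addrACA. Qed.

Lemma cubicZ e g (s a b c d : R[i]) :
  s *: cubic e g a b c d = cubic e g (s * a) (s * b) (s * c) (s * d).
Proof. by rewrite /cubic !scalerDr !scalerA. Qed.

(* 1 + 3z/2 is the average, with weights 3/4, 1/8 and 1/8, of the contractions
   (1 + z)^2, (1 + iz)^3 and (1 - iz)^3. *)
Lemma contraction_growth e g : e^# = e -> e ** e = e -> g^# = g ->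
  e ** g = g -> g ** e = g -> nrm (e + g) <= 1 -> nrm (e - g) <= 1 ->
  nrm (e + (3 / 2 : R)%:C *: g) <= 1.
Proof.
move=> es ee gs eg ge.
have E (s : R[i]) : e + s *: g = cubic e g 1 s 0 0.
  by rewrite /cubic scale1r !scale0r !addr0.
have -> : e - g = cubic e g 1 (-1) 0 0 by rewrite -E scaleN1r.
rewrite -[X in e + X]scale1r !E.
have n1 x y : nrm x <= 1 -> nrm y <= 1 -> nrm (x ** y) <= 1.
  by move=> hx hy; rewrite (le_trans (nrmM _ _)) // mulr_ile1 ?nrm_ge0.
move=> h1 h2; have := n1 _ _ h1 h1; have := n1 _ _ h2 h2.
rewrite !cubicM // !mulr1 => q2 q1.
(* [1 + z^2] is the average of [(1 + z)^2] and [(1 - z)^2]. It is also the product of [1 + iz] and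
   its adjoint, so [1 + iz] and [1 - iz] are contractions as well. *)
have hgg : nrm (cubic e g 1 0 1 0) <= 1.
  have : nrm ((2 : R)%:C *: cubic e g 1 0 1 0) <= 2.
    rewrite [X in nrm X](_ : _ = cubic e g 1 (1 + 1) (0 + 1) (1 * 0) +
      cubic e g 1 (-1 + -1) (0 + -1 * -1) (-1 * 0)).
      by rewrite (le_trans (nrmD _ _)) //; lra.
    by rewrite cubicZ cubicD; congr cubic; rewrite -?(rmorph_nat (real_complex R)) /=; ring.
  by rewrite nrmZR //; lra.
have cube (s : R[i]) : s * s = -1 -> s^*%C = - s ->
    nrm (cubic e g 1 (3 * s) (-3) (-s)) <= 1.
  move=> ss sc; have st : (cubic e g 1 s 0 0)^# = cubic e g 1 (- s) 0 0.
    by rewrite -!E cs_starD cs_starZc es gs sc.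
  have hs : nrm (cubic e g 1 s 0 0) <= 1.
    have : nrm ((cubic e g 1 s 0 0)^# ** cubic e g 1 s 0 0) <= 1.
      rewrite st cubicM // (_ : cubic _ _ _ _ _ _ = cubic e g 1 0 1 0) //.
      by congr cubic; rewrite ?mulrN ?ss; ring.
    by rewrite nrm_starM; have := nrm_ge0 (cubic e g 1 s 0 0); nra.
  have := n1 _ _ (n1 _ _ hs hs) hs; rewrite cubicM //.
  rewrite mulr0 cubicM // (_ : cubic _ _ _ _ _ _ = cubic e g 1 (3 * s) (-3) (-s)) //.
  congr cubic; rewrite ?mulr1; first ring.
  - rewrite mulrDr ss; ring.
  - rewrite add0r mulrA ss; ring.
have c1 : nrm (cubic e g 1 (3 * 'i%C) (-3) (- 'i%C)) <= 1.
  by apply: cube; [rewrite -expr2 sqr_i|rewrite /=; simpc].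
have c2 : nrm (cubic e g 1 (3 * - 'i%C) (-3) (- - 'i%C)) <= 1.
  apply: cube; first by rewrite mulrNN -expr2 sqr_i.
  by rewrite /=; simpc.
have : nrm ((8 : R)%:C *: cubic e g 1 (3 / 2 : R)%:C 0 0) <= 8.
  rewrite [X in nrm X](_ : _ = (6 : R)%:C *: cubic e g 1 (1 + 1) (0 + 1) (1 * 0)
    + cubic e g 1 (3 * 'i%C) (-3) (- 'i%C) + cubic e g 1 (3 * - 'i%C) (-3) (- - 'i%C)).
    rewrite (le_trans (nrmD _ _)) //; have := nrmD ((6 : R)%:C *: cubic e g 1 (1 + 1) (0 + 1) (1 * 0)) (cubic e g 1 (3 * 'i%C) (-3) (- 'i%C)).
    by rewrite nrmZR //; lra.
  rewrite !cubicZ !cubicD.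
  have e2 : (3 / 2 : R)%:C = 3 / 2 :> R[i].
    by rewrite rmorphM fmorphV !rmorph_nat.
  rewrite e2 !(rmorph_nat (real_complex R)).
  by congr cubic; field.
by rewrite nrmZR //; lra.
Qed.

(** A weak form of the fact that the unit of a C*-algebra is an extreme point of the unit ball.
    Iterating the growth by 3/2 keeps [e + (3/2)^n g] and [e - (3/2)^n g] contractions; their
    difference bounds [(3/2)^n |g|] by 1 for every [n]. *)
Lemma no_contraction_line e g : e^# = e -> e ** e = e -> g^# = g ->
  e ** g = g -> g ** e = g -> nrm (e + g) <= 1 -> nrm (e - g) <= 1 -> g = 0.
Proof.
move=> es ee gs eg ge h1 h2; pose c : R := 3 / 2.
have grow n : nrm (e + (c ^+ n)%:C *: g) <= 1 /\ nrm (e - (c ^+ n)%:C *: g) <= 1.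
  elim: n => [|n [i1 i2]]; first by rewrite expr0 scale1r.
  set h := (c ^+ n)%:C *: g in i1 i2.
  have eh : e ** h = h by rewrite /h cs_mulZr eg.
  have he : h ** e = h by rewrite /h cs_mulZl ge.
  have hs : h^# = h by rewrite /h cs_starZc gs conjc_real.
  have -> : (c ^+ n.+1)%:C *: g = c%:C *: h by rewrite /h scalerA -rmorphM -exprS.
  split; first exact: contraction_growth.
  rewrite -scalerN; apply: contraction_growth; rewrite ?opprK //.
  - by rewrite cs_starN hs.
  - by rewrite cs_mulNr eh.
  - by rewrite cs_mulNl he.
apply: nrm_le0; rewrite leNgt; apply/negP => g0.
have bern n : 1 + n%:R / 2 <= c ^+ n.
  elim: n => [|n IH]; first by rewrite expr0; lra.
  rewrite exprS -natr1 /c; have n0 : 0 <= n%:R :> R by exact: ler0n.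
  rewrite -/c; have : c * (1 + n%:R / 2) <= c * c ^+ n by rewrite ler_wpM2l // /c; lra.
  by rewrite {1}/c; lra.
have bound n : c ^+ n * nrm g <= 1.
  have [i1 i2] := grow n.
  have c0 : 0 <= c ^+ n by rewrite exprn_ge0 // /c; lra.
  rewrite -nrmZR //; set h := _ *: g in i1 i2 *.
  have : nrm ((2 : R)%:C *: h) <= 2.
    have -> : (2 : R)%:C *: h = (e + h) - (e - h).
      by rewrite opprB addrC subrKA (rmorph_nat (real_complex R)) scaler_nat mulr2n.
    by rewrite (le_trans (nrmD _ _)) // nrmN; lra.
  by rewrite nrmZR //; lra.
have [n hn] : exists n : nat, 2 / nrm g < n%:R.
  exists (Num.bound (2 / nrm g)); apply: le_lt_trans (archi_boundP _) => //.
  by rewrite divr_ge0 // ltW.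
have := bound n; have := bern n; rewrite ltr_pdivrMr // in hn.
have : (1 + n%:R / 2) * nrm g <= c ^+ n * nrm g by rewrite ler_wpM2r ?bern // ltW.
lra.
Qed.

(* The compressions [q_l = p_j p_l p_j] satisfy [|p_j - q_l| <= 1] and
   [\sum_(l != j) q_l = 0]; so both directions of the line through [p_j]
   spanned by [q_i] are contractions near [p_j], which forces [q_i = 0]. *)
Lemma sum_projections_orthogonal (I : eqType) (r : seq I) (p : I -> D) e i j :
  uniq r -> e^# = e -> e ** e = e -> e = \sum_(l <- r) p l ->
  (forall l, l \in r -> [/\ (p l)^# = p l, p l ** p l = p l,
     e ** p l = p l & p l ** e = p l]) ->
  i \in r -> j \in r -> i != j -> p i ** p j = 0.
Proof.
move=> ur es ee er hp ir jr ij; pose q l := p j ** p l ** p j.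
have [js jj ej je] := hp _ jr; have [is_ ii ei ie] := hp _ ir.
have near l : l \in r -> nrm (p j - q l) <= 1.
  move=> lr; have [ls ll el le] := hp _ lr.
  have -> : p j - q l = p j ** (e - p l) ** p j.
    by rewrite cs_mulBr cs_mulBl je jj.
  have h1 : nrm (p j) <= 1 by exact: nrm_projection_le1.
  have h2 : nrm (e - p l) <= 1.
    apply: nrm_projection_le1; first by rewrite cs_starB es ls.
    by rewrite cs_mulBl !cs_mulBr ee el le ll subrr subr0.
  rewrite (le_trans (nrmM _ _)) // mulr_ile1 ?nrm_ge0 //.
  by rewrite (le_trans (nrmM _ _)) // mulr_ile1 ?nrm_ge0.
pose r' := rem i (rem j r).
have ir' : i \in rem j r by rewrite mem_rem_uniq // inE /= ij.
have sum0 : q i + \sum_(l <- r') q l = 0.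
  have : \sum_(l <- r) q l = p j by rewrite -cs_mul_suml -cs_mul_sumr -er je jj.
  rewrite (perm_big _ (perm_to_rem jr)) big_cons {1}/q !jj => /eqP.
  by rewrite -subr_eq0 addrAC subrr add0r (perm_big _ (perm_to_rem ir')) big_cons => /eqP.
pose m := size r'.
have hm : nrm (p j *+ m + q i) <= m%:R.
  have -> : p j *+ m + q i = \sum_(l <- r') (p j - q l).
    move/eqP: sum0; rewrite addr_eq0 => /eqP ->.
    by rewrite sumrB big_const_seq count_predT iter_addr_0.
  apply: (le_trans (nrm_sum _ _)); rewrite /m.
  have sub : {subset r' <= r} by move=> l /mem_rem /mem_rem.
  clearbody r'; elim: r' sub {ir' sum0 m} => [|l s IH] sub; first by rewrite big_nil.
  rewrite big_cons /= -natr1 addrC lerD ?near ?IH //.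
  - by move=> a h; apply: sub; rewrite inE h orbT.
  - by apply: sub; rewrite inE eqxx.
suff q0 : q i = 0.
  by apply: cs_sqr_eq0; rewrite cs_starM js is_ cs_mulA -(cs_mulA (p j)) ii.
(* With this weight, [p j + d q_i] is [d] times the sum of [p j] and [p j *+ m + q i], while
   [p j - d q_i] is [d] times the sum of [p j *+ m] and [p j - q i]. Both sums have norm at most
   [m + 1]. *)
pose d : R := (m%:R + 1)^-1; have m0 : 0 <= m%:R :> R by exact: ler0n.
have d0 : 0 < d by rewrite invr_gt0; lra.
have dm : d * (m%:R + 1) = 1 by rewrite mulVf //; lra.
have qs : (q i)^# = q i by rewrite /q !cs_starM js is_ cs_mulA.
have jq : p j ** q i = q i by rewrite /q !cs_mulA jj.
have qj : q i ** p j = q i by rewrite /q -!cs_mulA jj.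
have pj1 : nrm (p j) <= 1 by exact: nrm_projection_le1.
have split x : p j + d%:C *: x = d%:C *: (p j *+ m + (p j + x)).
  by rewrite addrA -mulrSr scalerDr -scaler_nat scalerA -(rmorph_nat (real_complex R)) -rmorphM /= -natr1 dm scale1r.
have : d%:C *: q i = 0.
  apply: (@no_contraction_line (p j)) => //.
  - by rewrite cs_starZc qs conjc_real.
  - by rewrite cs_mulZr jq.
  - by rewrite cs_mulZl qj.
  - rewrite split nrmZR ?(ltW d0) // addrCA -[leRHS]dm ler_pM2l // addrC.
    by rewrite (le_trans (nrmD _ _)) // lerD.
  - rewrite -scalerN split nrmZR ?(ltW d0) // -[leRHS]dm ler_pM2l //.
    rewrite (le_trans (nrmD _ _)) // lerD ?near //.
    rewrite -scaler_nat nrmZ ger0_norm ?ler0n // -(rmorph_nat (real_complex R)) /=.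
    by rewrite -[leRHS]mulr1 ler_wpM2l.
move/eqP; rewrite scaler_eq0 => /orP[/eqP/complexI d00|/eqP //].
by rewrite d00 ltxx in d0.
Qed.

End Projections.

(** * Finite sums over paths of a given degree *)

Section PathSums.
Context {k : nat} {L : kgraph k}.
Hypothesis rfL : row_finite L.

Definition pathseq (n : 'N^k) (v : L) : seq L :=
  finmap.enum_fset (fset_set (paths n v)).

Lemma pathseq_uniq n v : uniq (pathseq n v).
Proof. exact: finmap.fset_uniq. Qed.

Lemma mem_pathseq n v l : rng v = v ->
  (l \in pathseq n v) = ((deg l == n) && (rng l == v)).
Proof.
move=> hv; rewrite in_fset_set; last exact: rfL.
apply/idP/andP => [/set_mem [-> ->] //|[/eqP h1 /eqP h2]].
exact/mem_set.
Qed.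

Lemma pathseqP n v l : rng v = v -> l \in pathseq n v -> deg l = n /\ rng l = v.
Proof. by move=> hv; rewrite mem_pathseq // => /andP[/eqP ? /eqP ?]. Qed.

Lemma sum_paths (V : zmodType) n v (F : L -> V) : rng v = v ->
  \sum_(l \in paths n v) F l = \sum_(l <- pathseq n v) F l.
Proof. by move=> hv; rewrite fsbig_finite //; exact: rfL. Qed.

(** Unique factorization is the bijection behind this reindexing. *)
Lemma sum_paths_add (V : zmodType) m n v (F : L -> V) : rng v = v ->
  \sum_(l <- pathseq (m + n) v) F l =
  \sum_(a <- pathseq m v) \sum_(b <- pathseq n (src a)) F (kcomp a b).
Proof.
move=> hv.
transitivity (\sum_(l <- [seq kcomp a b | a <- pathseq m v, b <- pathseq n (src a)]) F l);
  last by rewrite big_allpairs_dep.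
apply: perm_big; apply: uniq_perm; first exact: pathseq_uniq.
  apply: allpairs_uniq_dep => [|a _|[a b] [a' b'] /=]; try exact: pathseq_uniq.
  move=> /allpairsPdep [a1 [b1 [m1 m2 [-> ->]]]] /allpairsPdep [a2 [b2 [m3 m4 [-> ->]]]].
  have [[d1 r1] [d2 r2]] := (pathseqP hv m1, pathseqP hv m3).
  have [[d3 r3] [d4 r4]] := (pathseqP (rng_src a1) m2, pathseqP (rng_src a2) m4).
  by move=> e; have [|||-> ->] := kcomp_inj _ _ e; rewrite ?d1 ?d2.
move=> l; rewrite mem_pathseq //; apply/andP/allpairsPdep => [[/eqP d /eqP r]|].
  have le : dle m (deg l) by rewrite d; exact: dle_add.
  have [h1 h2 h3] := factorP le; exists (hd l m), (tl l m); split=> //.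
    have rh : rng (hd l m) = v by rewrite -r [in RHS]h2 rng_comp.
    by rewrite mem_pathseq // h3 rh !eqxx.
  by rewrite mem_pathseq ?rng_src // (deg_tl d) h1 !eqxx.
move=> [a [b [/(pathseqP hv) [d1 r1] /(pathseqP (rng_src a)) [d2 r2] ->]]].
by rewrite deg_comp ?rng_comp // d1 d2 r1 !eqxx.
Qed.

End PathSums.

(** * Moduli of complex numbers and automatic boundedness on function algebras *)

Section ComplexNorm.
Context {R : realType}.
Implicit Types z w : R[i].

Definition cabs z : R := complex.Re `|z|.

Lemma cabsE z : `|z| = (cabs z)%:C.
Proof. by rewrite /cabs RRe_real ?normr_real. Qed.

Lemma cabs_ge0 z : 0 <= cabs z. Proof. exact: Re_norm_ge0. Qed.

Lemma cabs0 : cabs 0 = 0. Proof. by rewrite /cabs normr0. Qed.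

Lemma cabsD z w : cabs (z + w) <= cabs z + cabs w.
Proof. by rewrite -lecR rmorphD /= -!cabsE ler_normD. Qed.

Lemma cabsN z : cabs (- z) = cabs z.
Proof. by rewrite /cabs normrN. Qed.

Lemma cabsBC z w : cabs (z - w) = cabs (w - z).
Proof. by rewrite -opprB cabsN. Qed.

Lemma cabsM z w : cabs (z * w) = cabs z * cabs w.
Proof. by apply: complexI; rewrite rmorphM -!cabsE normrM. Qed.

Lemma cabsJ z : cabs (conjc z) = cabs z.
Proof. by rewrite /cabs normcJ. Qed.

Lemma cabsR (a : R) : cabs a%:C = `|a|.
Proof. by rewrite /cabs normc_def /= expr0n /= addr0 sqrtr_sqr. Qed.

Lemma cabs_Re z : `|complex.Re z| <= cabs z.
Proof. by rewrite -lecR -cabsE normc_ge_Re. Qed.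

Lemma conjcM_self z : conjc z * z = ((cabs z) ^+ 2)%:C.
Proof. by rewrite mulrC -sqr_normc cabsE rmorphXn. Qed.

End ComplexNorm.

Section SupremumBound.
Context {R : realType} {D : cstar_algebra R} {T : Type}.
Variables (C : set (T -> R[i])) (Phi : (T -> R[i]) -> D) (S : set T).
Hypothesis C_cst : forall z, C (fun=> z).
Hypothesis C_add : forall f g, C f -> C g -> C (fun x => f x + g x).
Hypothesis C_mul : forall f g, C f -> C g -> C (fun x => f x * g x).
Hypothesis C_conj : forall f, C f -> C (fun x => conjc (f x)).
Hypothesis C_sqrt : forall f, C f ->
  C (fun x => (Num.sqrt (1 - complex.Re (f x) ^+ 2))%:C).
Hypothesis Phi_add : forall f g, C f -> C g ->
  Phi (fun x => f x + g x) = Phi f + Phi g.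
Hypothesis Phi_scale : forall (z : R[i]) f, C f -> Phi (fun x => z * f x) = z *: Phi f.
Hypothesis Phi_mul : forall f g, C f -> C g ->
  Phi (fun x => f x * g x) = Phi f ** Phi g.
Hypothesis Phi_conj : forall f, C f -> Phi (fun x => conjc (f x)) = (Phi f)^#.
Hypothesis Phi_one : nrm (Phi (fun=> 1)) <= 1.
Hypothesis Phi_ext : forall f g, C f -> C g ->
  (forall x, S x -> f x = g x) -> Phi f = Phi g.

Let Phi_star f : C f -> nrm (Phi f) ^+ 2 = nrm (Phi (fun x => conjc (f x) * f x)).
Proof.
by move=> cf; rewrite -nrm_starM -Phi_conj // -Phi_mul //; exact: C_conj.
Qed.

(* A real [f] with [|f| <= 1] is the real part of the unitary [f + i sqrt (1 - f^2)]. *)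
Let real_bound f : C f -> (forall x, S x -> f x = (complex.Re (f x))%:C) ->
  (forall x, S x -> `|complex.Re (f x)| <= 1) -> nrm (Phi f) <= 1.
Proof.
move=> cf fr f1; pose g x : R[i] := (Num.sqrt (1 - complex.Re (f x) ^+ 2))%:C.
have cg : C g by exact: C_sqrt.
pose u x := f x + 'i%C * g x.
have cu : C u by apply: C_add => //; apply: C_mul.
have hu : nrm (Phi u) <= 1.
  suff : nrm (Phi u) ^+ 2 <= 1 by have := nrm_ge0 (Phi u); nra.
  rewrite Phi_star // (@Phi_ext _ (fun=> 1)) //; first exact/C_mul/cu/C_conj.
  move=> x Sx; rewrite /u /g (fr _ Sx); set a := complex.Re (f x) => /=.
  have a2 : 0 <= 1 - a ^+ 2.
    by have := f1 _ Sx; rewrite -/a ler_norml => /andP[]; nra.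
  apply/eqP; rewrite eq_complex /=; simpc.
  have := sqr_sqrtr a2; set s := Num.sqrt _; rewrite !expr2 => hs.
  by apply/andP; split; apply/eqP; [rewrite hs|]; ring.
have : nrm ((2 : R)%:C *: Phi f) <= 2.
  rewrite -Phi_scale // (@Phi_ext _ (fun x => u x + conjc (u x))) //; last first.
  - move=> x Sx; rewrite /u /g (fr _ Sx) /=; simpc.
    by apply/eqP; rewrite eq_complex /=; apply/andP; split; apply/eqP; ring.
  - by apply: C_add => //; exact: C_conj.
  - by apply: (@C_mul (fun=> _)).
  rewrite Phi_add //; last exact: C_conj.
  rewrite Phi_conj // (le_trans (nrmD _ _)) // nrm_star; lra.
by rewrite nrmZR //; lra.
Qed.

(** Multiplicativity alone forces the bound, without continuity of [Phi]: the C*-identity passes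
    from [f] to the real function [conjc f * f], to which [real_bound] applies. It serves twice, for
    coefficient functions on finite paths in [step_le] and for representations of [Cc] in
    [pi_unit_bound]. *)
Lemma sup_bound f (M : R) : 0 <= M -> C f ->
  (forall x, S x -> cabs (f x) <= M) -> nrm (Phi f) <= M.
Proof.
(* As [M] may be 0, the normalization divides by [M + e]. *)
move=> M0 cf fM; apply/ler_addgt0Pr => e e0; set M' := M + e.
have M'0 : 0 < M' by rewrite /M'; lra.
pose g x := M'^-1%:C * f x.
have cg : C g by apply: (@C_mul (fun=> _)).
have g1 x : S x -> cabs (g x) <= 1.
  move=> Sx; rewrite cabsM cabsR ger0_norm ?invr_ge0 ?(ltW M'0) //.
  by rewrite ler_pdivrMl // mulr1 (le_trans (fM _ Sx)) // /M'; lra.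
suff h : nrm (Phi g) <= 1.
  have -> : Phi f = M'%:C *: Phi g.
    rewrite -Phi_scale //; congr Phi; apply/funext => x.
    by rewrite /g mulrA -rmorphM mulfV ?gt_eqF // mul1r.
  by rewrite nrmZR ?(ltW M'0) // -[leRHS]mulr1 ler_pM2l.
suff : nrm (Phi g) ^+ 2 <= 1 by have := nrm_ge0 (Phi g); nra.
rewrite Phi_star //; apply: real_bound.
- by apply: C_mul => //; exact: C_conj.
- by move=> x Sx; rewrite conjcM_self.
- move=> x Sx; rewrite conjcM_self /= ger0_norm ?sqr_ge0 //.
  by have := g1 _ Sx; have := cabs_ge0 (g x); nra.
Qed.

End SupremumBound.

(** * Consequences of the Cuntz-Krieger relations *)

Section CuntzKrieger.
Context {R : realType} {k : nat} {L : kgraph k} {D : cstar_algebra R}.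
Hypothesis rfL : row_finite L.
Variable t : L -> D.
Hypothesis ck : cuntz_krieger_family t.
Implicit Types (a b l v : L).

Lemma ck_object v : rng v = v -> (t v)^# = t v /\ t v ** t v = t v.
Proof. by case: ck => _ [h _] _ _ _; exact: h. Qed.

Lemma ck_disjoint v w : rng v = v -> rng w = w -> v <> w -> t v ** t w = 0.
Proof. by case: ck => _ [_ h] _ _ _; exact: h. Qed.

Lemma ck_comp a b : src a = rng b -> t (kcomp a b) = t a ** t b.
Proof. by case: ck => _ _ h _ _; exact: h. Qed.

Lemma ck_star l : (t l)^# ** t l = t (src l).
Proof. by case: ck. Qed.

Lemma ck_src l : t l ** t (src l) = t l.
Proof. by rewrite -ck_comp ?comp_src ?rng_src. Qed.

Lemma ck_rng l : t (rng l) ** t l = t l.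
Proof. by rewrite -ck_comp ?comp_rng ?src_rng. Qed.

Lemma ck_src_star l : t (src l) ** (t l)^# = (t l)^#.
Proof.
by have [h _] := ck_object (rng_src l); rewrite -{1}h -cs_starM ck_src.
Qed.

Lemma ck_rng_star l : (t l)^# ** t (rng l) = (t l)^#.
Proof.
by have [h _] := ck_object (rng_rng l); rewrite -h -cs_starM ck_rng.
Qed.

Lemma ck_sum n v : rng v = v ->
  t v = \sum_(l <- pathseq n v) t l ** (t l)^#.
Proof. by move=> hv; rewrite -sum_paths //; case: ck => _ _ _ _; exact. Qed.

Lemma ck_le1 l : nrm (t l) <= 1.
Proof.
suff : nrm (t l) ^+ 2 <= 1 by have := nrm_ge0 (t l); nra.
rewrite -nrm_starM ck_star; have [h1 h2] := ck_object (rng_src l).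
exact: nrm_projection_le1.
Qed.

(** For different ranges this is the orthogonality of vertices. For a common range [v] the
    projections [t l ** (t l)^#] of degree [deg b] add up to the projection [t v], hence are
    mutually orthogonal. *)
Lemma ck_orthogonal a b : deg a = deg b -> a != b -> (t a)^# ** t b = 0.
Proof.
move=> d ab; rewrite -ck_rng_star -(ck_rng b) cs_mulA -(cs_mulA (t a)^#).
have [e|ne] := eqVneq (rng a) (rng b); last first.
  rewrite ck_disjoint ?rng_rng ?cs_mul0r ?cs_mul0l //; exact/eqP.
have proj l : (t l ** (t l)^#)^# = t l ** (t l)^# by rewrite cs_starM cs_starK.
rewrite e; have [h1 h2] := ck_object (rng_rng b); rewrite h2 -e ck_rng_star.
have : (t a ** (t a)^#) ** (t b ** (t b)^#) = 0.
  apply: (@sum_projections_orthogonal _ _ _ (pathseq (deg b) (rng b))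
    (fun l => t l ** (t l)^#) (t (rng b))) => //.
  - exact: pathseq_uniq.
  - by apply: ck_sum; rewrite rng_rng.
  - move=> l /(pathseqP rfL (rng_rng b)) [dl rl]; split=> //.
    + by rewrite cs_mulA -(cs_mulA _ _ (t l)) ck_star ck_src.
    + by rewrite cs_mulA -rl ck_rng.
    + by rewrite -cs_mulA -rl ck_rng_star.
  - by rewrite mem_pathseq ?rng_rng // d e !eqxx.
  - by rewrite mem_pathseq ?rng_rng // !eqxx.
move=> h; have : (t a)^# ** ((t a ** (t a)^#) ** (t b ** (t b)^#)) ** t b = 0.
  by rewrite h cs_mul0r cs_mul0l.
rewrite -!cs_mulA ck_star ck_src cs_mulA ck_star => <-.
by rewrite cs_mulA ck_src_star.
Qed.

Lemma ck_orthonormal a b : deg a = deg b ->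
  (t a)^# ** t b = if a == b then t (src a) else 0.
Proof.
by move=> d; case: eqVneq => [->|ab]; [exact: ck_star|exact: ck_orthogonal].
Qed.

(** The last relation expresses [t] of a path through its one-step extensions, so vanishing is
    inherited from these; the condition of [path_bar] on infinite paths holds vacuously. *)
Lemma ck_empty l : (forall x, ~ cyl l x) -> t l = 0.
Proof.
move=> h; suff : src l = rng (src l) -> t (kcomp l (src l)) = 0.
  by rewrite rng_src comp_src; exact.
apply: (path_bar (Q := fun a => src l = rng a -> t (kcomp l a) = 0)).
- move=> a IH la; rewrite -ck_src src_comp // (ck_sum (cdeg 1) (rng_src a)).
  rewrite cs_mul_sumr big_seq big1 // => b /(pathseqP rfL (rng_src a)) [db rb].
  rewrite cs_mulA -ck_comp ?src_comp // -kcompA // IH ?cs_mul0l ?rng_comp //.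
- exact: rng_src.
- by move=> x rx; case: (h (cat l x)); apply: cyl_cat.
Qed.

(** The image of the locally constant function with value [c l] on [cyl l]. Since all [l] have the
    same degree, the terms are mutually orthogonal. *)
Definition step v (p : 'N^k) (c : L -> R[i]) : D :=
  \sum_(l <- pathseq p v) c l *: (t l ** (t l)^#).

Lemma step_ext v p c c' : rng v = v ->
  (forall l, deg l = p -> rng l = v -> (exists x, cyl l x) -> c l = c' l) ->
  step v p c = step v p c'.
Proof.
move=> hv h; apply: eq_big_seq => l /(pathseqP rfL hv) [dl rl].
have [hx|hx] := pselect (exists x, cyl l x); first by rewrite h.
by rewrite ck_empty ?cs_mul0l ?scaler0 // => x hx'; apply: hx; exists x.
Qed.

Lemma stepD v p c c' : step v p (fun l => c l + c' l) = step v p c + step v p c'.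
Proof. by rewrite /step -big_split; apply: eq_bigr => l _; rewrite scalerDl. Qed.

Lemma stepZ v p (z : R[i]) c : step v p (fun l => z * c l) = z *: step v p c.
Proof. by rewrite /step scaler_sumr; apply: eq_bigr => l _; rewrite scalerA. Qed.

Lemma step_conj v p c : step v p (fun l => conjc (c l)) = (step v p c)^#.
Proof.
rewrite /step cs_star_sum; apply: eq_bigr => l _.
by rewrite cs_starZc cs_starM cs_starK.
Qed.

Lemma step1 v p : rng v = v -> step v p (fun=> 1) = t v.
Proof.
by move=> hv; rewrite (ck_sum p hv); apply: eq_bigr => l _; rewrite scale1r.
Qed.

Lemma stepM v p c c' : rng v = v ->
  step v p (fun l => c l * c' l) = step v p c ** step v p c'.
Proof.
move=> hv; rewrite /step cs_mul_suml; apply: eq_big_seq => l hl.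
rewrite cs_mul_sumr (bigD1_seq l) ?pathseq_uniq //= big1_seq ?addr0.
  rewrite cs_mulZl cs_mulZr scalerA; congr (_ *: _).
  by rewrite cs_mulA -(cs_mulA (t l)) ck_star ck_src.
move=> m /andP[ml hm]; have [[d1 _] [d2 _]] := (pathseqP rfL hv hl, pathseqP rfL hv hm).
rewrite cs_mulZl cs_mulZr cs_mulA -(cs_mulA (t l)) ck_orthogonal ?d1 //.
  by rewrite cs_mul0r cs_mul0l !scaler0.
by rewrite eq_sym.
Qed.

(** The algebra in [sup_bound] consists of all functions of finite paths. Coefficients on paths with
    empty cylinder are irrelevant by [ck_empty], so only the others have to be bounded. *)
Lemma step_le v p c (M : R) : rng v = v -> 0 <= M ->
  (forall l, deg l = p -> rng l = v -> (exists x, cyl l x) -> cabs (c l) <= M) ->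
  nrm (step v p c) <= M.
Proof.
move=> hv M0 h; apply: (@sup_bound _ _ _ setT (step v p)
  [set l | [/\ deg l = p, rng l = v & exists x, cyl l x]]) => //.
- by move=> f g _ _; exact: stepD.
- by move=> z f _; exact: stepZ.
- by move=> f g _ _; exact: stepM.
- by move=> f _; exact: step_conj.
- by rewrite step1 // ck_le1.
- by move=> f g _ _ fg; apply: step_ext => // l d r x; apply: fg; split.
- by move=> l [d r x]; exact: h.
Qed.

Lemma step_split v p q c : rng v = v ->
  step v (p + q) c = \sum_(a <- pathseq p v)
    t a ** step (src a) q (fun b => c (kcomp a b)) ** (t a)^#.
Proof.
move=> hv; rewrite /step sum_paths_add //; apply: eq_big_seq => a _.
rewrite cs_mul_sumr cs_mul_suml; apply: eq_big_seq => b /(pathseqP rfL (rng_src a)) [_ r].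
by rewrite ck_comp // cs_starM cs_mulZr cs_mulZl !cs_mulA.
Qed.

Lemma step_refine v p q c : rng v = v ->
  step v p c = step v (p + q) (fun l => c (hd l p)).
Proof.
move=> hv; rewrite step_split //; apply: eq_big_seq => a /(pathseqP rfL hv) [d r].
rewrite (_ : step _ _ _ = c a *: t (src a)).
  by rewrite cs_mulZr cs_mulZl ck_src.
rewrite -(step1 q (rng_src a)) -stepZ; apply: step_ext; first exact: rng_src.
by move=> l dl rl _; rewrite mulr1 hd_comp.
Qed.

End CuntzKrieger.

(** * Uniform limits of locally constant functions *)

Section LocallyUniform.
Context {R : realType} {k : nat} {L : kgraph k}.
Hypothesis rfL : row_finite L.
Notation X := (@infinite_path k L).
Implicit Types (h : X -> R[i]) (v : L).

Definition appr v (p : 'N^k) h (c : L -> R[i]) (e : R) : Prop :=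
  forall l x, deg l = p -> rng l = v -> cyl l x -> cabs (h x - c l) <= e.

Definition sappr v h (p : nat -> 'N^k) (c : nat -> L -> R[i]) : Prop :=
  forall e : R, 0 < e -> exists N, forall n, (N <= n)%N -> appr v (p n) h (c n) e.

(* Uniform limits of locally constant functions on [cyl v]; by [path_bar] these
   are the functions continuous on [cyl v]. *)
Definition locunif v h : Prop := exists p c, sappr v h p c.

Lemma appr_refine v p q h c e :
  appr v p h c e -> appr v (p + q) h (fun l => c (hd l p)) e.
Proof.
move=> H l x d r lx; have le : dle p (deg l) by rewrite d; exact: dle_add.
have [h1 h2 h3] := factorP le; apply: H => //.
  by rewrite -r [in RHS]h2 rng_comp.
by rewrite h2 in lx; have [] := (cyl_comp _ h1).1 lx.
Qed.

Lemma sappr_refine v h p q c : sappr v h p c ->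
  sappr v h (fun n => p n + q n) (fun n l => c n (hd l (p n))).
Proof. by move=> H e /H [N hN]; exists N => n /hN; exact: appr_refine. Qed.

Lemma appr_le v p h c (e e' : R) : e <= e' -> appr v p h c e -> appr v p h c e'.
Proof. by move=> le H l x d r lx; exact: le_trans (H _ _ d r lx) le. Qed.

Lemma locunif_of v h :
  (forall e : R, 0 < e -> exists p c, appr v p h c e) -> locunif v h.
Proof.
move=> H; have /choice [f hf] : forall n : nat, exists pc : 'N^k * (L -> R[i]),
    appr v pc.1 h pc.2 n.+1%:R^-1.
  by move=> n; have [|p [c hc]] := H n.+1%:R^-1; [rewrite invr_gt0 ltr0n|exists (p, c)].
exists (fun n => (f n).1), (fun n => (f n).2) => e /inv_small [N hN].
by exists N => n /hN le; exact: appr_le (hf n).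
Qed.

Lemma locunif_common v h h' : locunif v h -> locunif v h' ->
  exists p c c', sappr v h p c /\ sappr v h' p c'.
Proof.
move=> [p [c H]] [p' [c' H']].
exists (fun n => p n + p' n), (fun n l => c n (hd l (p n))), (fun n l => c' n (hd l (p' n))).
split; first exact: sappr_refine.
have -> : (fun n => p n + p' n) = (fun n => p' n + p n).
  by apply/funext => n; rewrite addrC.
exact: sappr_refine.
Qed.

Lemma locunif_above v h q : locunif v h -> exists p c, sappr v h (fun n => q + p n) c.
Proof.
move=> [p [c H]]; exists p, (fun n l => c n (hd l (p n))).
have -> : (fun n => q + p n) = (fun n => p n + q).
  by apply/funext => n; rewrite addrC.
exact: sappr_refine.
Qed.

(** A single approximation within 1 suffices, because row-finiteness leaves it finitely many values
    on [cyl v]. *)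
Lemma locunif_bounded v h : rng v = v -> locunif v h ->
  exists M : R, forall x, root x = v -> cabs (h x) <= M.
Proof.
move=> hv [p [c H]]; have [N /(_ N (leqnn N)) hN] := H 1 ltr01.
exists (1 + \sum_(l <- pathseq (p N) v) cabs (c N l)) => x rx.
have := hN (pre x (p N)) x (deg_pre _ _); rewrite rng_pre => /(_ rx (cyl_pre _ _)) hl.
rewrite -[h x](subrK (c N (pre x (p N)))) (le_trans (cabsD _ _)) // lerD //.
have m : pre x (p N) \in pathseq (p N) v by rewrite mem_pathseq // deg_pre rng_pre rx !eqxx.
rewrite (bigD1_seq (pre x (p N))) ?pathseq_uniq //= lerDl.
by apply: sumr_ge0 => l _; exact: cabs_ge0.
Qed.

(** Uniform continuity on bounded sets only, so that multiplication qualifies; [locunif_bounded]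
    makes this enough. Unary operations ignore the second argument. *)
Definition bounded_unif (phi : R[i] -> R[i] -> R[i]) : Prop :=
  forall M e : R, 0 <= M -> 0 < e -> exists2 d : R, 0 < d &
    forall z z' w w', cabs z <= M -> cabs z' <= M -> cabs w <= M -> cabs w' <= M ->
      cabs (z - z') <= d -> cabs (w - w') <= d -> cabs (phi z w - phi z' w') <= e.

Lemma sappr_op2 phi v h h' p c c' : bounded_unif phi -> rng v = v ->
  sappr v h p c -> sappr v h' p c' ->
  sappr v (fun x => phi (h x) (h' x)) p (fun n l => phi (c n l) (c' n l)).
Proof.
move=> hphi hv H H' e e0.
have [M hM] := locunif_bounded hv (ex_intro _ p (ex_intro _ c H)).
have [M' hM'] := locunif_bounded hv (ex_intro _ p (ex_intro _ c' H')).
(* The summand 1 leaves room for the approximating values, which lie within [Num.min d 1] of those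
   of [h] and [h']. *)
have M0 : 0 <= `|M| + `|M'| + 1 by rewrite !addr_ge0.
have [d d0 hd] := hphi (`|M| + `|M'| + 1) e M0 e0.
have d1 : 0 < Num.min d 1 by rewrite lt_min d0 ltr01.
have [N hN] := H _ d1; have [N' hN'] := H' _ d1.
exists (maxn N N') => n; rewrite geq_max => /andP[/hN a /hN' b] l x dl rl lx.
have := a l x dl rl lx; have := b l x dl rl lx; rewrite !le_min => /andP[b1 b2] /andP[a1 a2].
have rx : root x = v by rewrite (cyl_root lx).
have := hM _ rx; have := hM' _ rx; have := ler_norm M; have := ler_norm M'.
have := normr_ge0 M; have := normr_ge0 M' => n1 n2 n3 n4 n5 n6.
apply: hd => //; try lra.
- rewrite cabsBC in a2; have := cabsD (c n l - h x) (h x); rewrite subrK; lra.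
- rewrite cabsBC in b2; have := cabsD (c' n l - h' x) (h' x); rewrite subrK; lra.
Qed.

Lemma locunif_op2 phi v h h' : bounded_unif phi -> rng v = v ->
  locunif v h -> locunif v h' -> locunif v (fun x => phi (h x) (h' x)).
Proof.
move=> hphi hv l1 l2; have [p [c [c' [H H']]]] := locunif_common l1 l2.
by exists p, (fun n l => phi (c n l) (c' n l)); exact: sappr_op2.
Qed.

Lemma bounded_unif_add : bounded_unif (fun z w => z + w).
Proof.
move=> M e M0 e0; exists (e / 2) => [|z z' w w' _ _ _ _ a b]; first lra.
by rewrite opprD addrACA (le_trans (cabsD _ _)) //; lra.
Qed.

Lemma bounded_unif_mul : bounded_unif (fun z w => z * w).
Proof.
move=> M e M0 e0; have M1 : 0 < 2 * M + 1 by lra.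
exists (e / (2 * M + 1)) => [|z z' w w' a b a' b' c c']; first exact: divr_gt0.
rewrite ler_pdivlMr // in c; rewrite ler_pdivlMr // in c'.
have -> : z * w - z' * w' = (z - z') * w + z' * (w - w') by ring.
rewrite (le_trans (cabsD _ _)) // !cabsM.
have := cabs_ge0 (z - z'); have := cabs_ge0 (w - w').
have := cabs_ge0 w; have := cabs_ge0 z'; nra.
Qed.

Lemma bounded_unif_conj : bounded_unif (fun z _ => conjc z).
Proof.
by move=> M e M0 e0; exists e => // z z' w w' _ _ _ _ a _; rewrite -rmorphB cabsJ.
Qed.

Lemma sqrt_dist (a b : R) : `|Num.sqrt a - Num.sqrt b| ^+ 2 <= `|a - b|.
Proof.
wlog ab : a b / b <= a.
  move=> H; have [/H //|/ltW/H] := leP b a.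
  by rewrite (distrC (Num.sqrt b)) (distrC b).
have s0 := sqrtr_ge0 a; have t0 := sqrtr_ge0 b.
have st : Num.sqrt b <= Num.sqrt a by rewrite ler_wsqrtr.
rewrite !ger0_norm ?subr_ge0 //.
have [a0|a0] := leP 0 a; last first.
  have b0 := le_lt_trans ab a0.
  by rewrite !ler0_sqrtr ?(ltW a0) ?(ltW b0) // subrr expr0n /= subr_ge0.
have [b0|b0] := leP 0 b; last first.
  by rewrite (ler0_sqrtr (ltW b0)) subr0 sqr_sqrtr //; lra.
have := sqr_sqrtr a0; have := sqr_sqrtr b0; nra.
Qed.

(** [Num.sqrt] is 0 on negative numbers and Hölder of exponent 1/2 on the whole line by [sqrt_dist],
    whence [e ^+ 2]; the factor [2 * M] bounds the change of the square of the real part. *)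
Lemma bounded_unif_sqrt :
  bounded_unif (fun z _ => (Num.sqrt (1 - complex.Re z ^+ 2))%:C).
Proof.
move=> M e M0 e0; have M1 : 0 < 2 * M + 1 by lra.
exists (e ^+ 2 / (2 * M + 1)) => [|z z' w w' a b _ _ c _].
  by rewrite divr_gt0 // exprn_gt0.
rewrite ler_pdivlMr // in c; rewrite -rmorphB cabsR.
rewrite -(ler_pXn2r (n := 2)) ?nnegrE ?normr_ge0 ?(ltW e0) //.
apply: le_trans (sqrt_dist _ _) _.
have -> : 1 - complex.Re z ^+ 2 - (1 - complex.Re z' ^+ 2) =
  - ((complex.Re (z - z')) * (complex.Re z + complex.Re z')).
  by case: z {a c} => x y; case: z' {b} => x' y' /=; ring.
rewrite normrN normrM.
have h1 := cabs_Re (z - z').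
have h2 : `|complex.Re z + complex.Re z'| <= 2 * M.
  have := cabs_Re z; have := cabs_Re z'; have := ler_normD (complex.Re z) (complex.Re z'); lra.
have := normr_ge0 (complex.Re (z - z')); have := normr_ge0 (complex.Re z + complex.Re z').
have := cabs_ge0 (z - z'); nra.
Qed.

Lemma sappr_cst v (z : R[i]) p : sappr v (fun=> z) p (fun _ _ => z).
Proof.
by move=> e e0; exists 0%N => n _ l x _ _ _; rewrite subrr cabs0 ltW.
Qed.

Lemma locunif_cst v (z : R[i]) : locunif v (fun=> z).
Proof. by exists (fun=> 0), (fun _ _ => z); exact: sappr_cst. Qed.

Lemma locunif_add v h h' : rng v = v -> locunif v h -> locunif v h' ->
  locunif v (fun x => h x + h' x).
Proof. exact: (locunif_op2 bounded_unif_add). Qed.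

Lemma locunif_mul v h h' : rng v = v -> locunif v h -> locunif v h' ->
  locunif v (fun x => h x * h' x).
Proof. exact: (locunif_op2 bounded_unif_mul). Qed.

Lemma locunif_conj v h : rng v = v -> locunif v h ->
  locunif v (fun x => conjc (h x)).
Proof. by move=> hv H; exact: (locunif_op2 bounded_unif_conj hv H H). Qed.

Lemma locunif_sqrt v h : rng v = v -> locunif v h ->
  locunif v (fun x => (Num.sqrt (1 - complex.Re (h x) ^+ 2))%:C).
Proof. by move=> hv H; exact: (locunif_op2 bounded_unif_sqrt hv H H). Qed.

Lemma sappr_cat v h a p c : rng a = v -> sappr v h (fun n => deg a + p n) c ->
  sappr (src a) (fun x => h (cat a x)) p (fun n b => c n (kcomp a b)).
Proof.
move=> ra H e /H [N hN]; exists N => n /hN ap b x db rb bx.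
have rx : src a = root x by rewrite (cyl_root bx).
apply: ap; rewrite ?deg_comp ?rng_comp ?db //.
by apply/cyl_comp => //; split; [exact: cyl_cat|rewrite sh_cat].
Qed.

Lemma locunif_cat v h a : rng a = v -> locunif v h ->
  locunif (src a) (fun x => h (cat a x)).
Proof.
move=> ra /(locunif_above (deg a)) [p [c H]].
by exists p, (fun n b => c n (kcomp a b)); exact: (sappr_cat ra H).
Qed.

Lemma locunif_step v p c : locunif v (fun x => c (pre x p)).
Proof.
apply: locunif_of => e e0; exists p, c => l x <- _ lx.
by rewrite lx subrr cabs0 ltW.
Qed.

End LocallyUniform.

(** * From functions on infinite paths to elements of the algebra *)

Section Diagonal.
Context {R : realType} {k : nat} {L : kgraph k} {D : cstar_algebra R}.
Hypothesis rfL : row_finite L.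
Variable t : L -> D.
Hypothesis ck : cuntz_krieger_family t.
Notation X := (@infinite_path k L).
Implicit Types (a b l v : L) (h : X -> R[i]).

Lemma stepB v p c c' : step t v p c - step t v p c' = step t v p (fun l => c l - c' l).
Proof.
rewrite -scaleN1r -stepZ -stepD; congr step; apply/funext => l.
by rewrite mulN1r.
Qed.

Lemma step_close v h p q c c' (e e' : R) : rng v = v -> 0 <= e -> 0 <= e' ->
  appr v p h c e -> appr v q h c' e' ->
  nrm (step t v p c - step t v q c') <= e + e'.
Proof.
move=> hv e0 e0' /(appr_refine (q := q)) H /(appr_refine (q := p)) H'.
rewrite (step_refine rfL ck p q c hv) (step_refine rfL ck q p c' hv) (addrC q p) stepB.
rewrite (addrC q p) in H'.
apply: step_le => //; first exact: addr_ge0.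
move=> l dl rl [x lx]; have := H l x dl rl lx; have := H' l x dl rl lx.
set u := c _; set w := c' _ => h1 h2; rewrite -(subrKA (h x)) (le_trans (cabsD _ _)) //.
by rewrite lerD // cabsBC.
Qed.

(** The element is characterized by its distance to every approximating step, not as the limit of a
    chosen sequence; so it depends only on the values of [h] on [cyl v], as [iota0_ext] records. *)
Definition iota0 v h : D := xget 0 [set b | forall p c (e : R),
  0 <= e -> appr v p h c e -> nrm (b - step t v p c) <= e].

Lemma iota0P v h : rng v = v -> locunif v h -> forall p c (e : R),
  0 <= e -> appr v p h c e -> nrm (iota0 v h - step t v p c) <= e.
Proof.
move=> hv [p [c H]]; rewrite /iota0; set P := [set b | _].
suff : exists d : D, P d by exact: xgetPex.
have [b hb] : exists b : D, tends (fun n => step t v (p n) (c n)) b.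
  apply: tends_complete => e e0; have [N hN] := H (e / 2) ltac:(lra).
  exists N => n m hn hm; rewrite [e]splitr.
  by apply: (step_close hv _ _ (hN n hn) (hN m hm)); lra.
exists b => p' c' e e0 H'; apply/ler_addgt0Pr => d d0.
have [N hN] := hb (d / 2) ltac:(lra); have [M hM] := H (d / 2) ltac:(lra).
have h1 := hN _ (leq_maxl N M); have h2 := hM _ (leq_maxr N M).
rewrite nrmB in h1; have d20 : 0 <= d / 2 by lra.
apply: (nrm_tri h1 (step_close hv d20 e0 h2 H')); lra.
Qed.

Lemma tends_iota0 v h p c : rng v = v -> sappr v h p c ->
  tends (fun n => step t v (p n) (c n)) (iota0 v h).
Proof.
move=> hv H e e0; have [N hN] := H e e0; exists N => n /hN ap.
rewrite nrmB; apply: iota0P => //; last exact: ltW.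
by exists p, c.
Qed.

Lemma iota0_ext v h h' : (forall x, root x = v -> h x = h' x) ->
  iota0 v h = iota0 v h'.
Proof.
move=> e; congr (xget _ _); apply/seteqP; split=> b /= H p c d d0 ap;
  apply: H => // l x dl rl lx; have rx : root x = v by rewrite (cyl_root lx).
- by rewrite e //; exact: ap.
- by rewrite -e //; exact: ap.
Qed.

Lemma iota0D v h h' : rng v = v -> locunif v h -> locunif v h' ->
  iota0 v (fun x => h x + h' x) = iota0 v h + iota0 v h'.
Proof.
move=> hv l1 l2; have [p [c [c' [H H']]]] := locunif_common l1 l2.
apply: tends_unique (tends_iota0 hv (sappr_op2 rfL bounded_unif_add hv H H')) _.
by apply: tends_ext (tendsD (tends_iota0 hv H) (tends_iota0 hv H')) => n; rewrite stepD.
Qed.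

Lemma iota0M v h h' : rng v = v -> locunif v h -> locunif v h' ->
  iota0 v (fun x => h x * h' x) = iota0 v h ** iota0 v h'.
Proof.
move=> hv l1 l2; have [p [c [c' [H H']]]] := locunif_common l1 l2.
apply: tends_unique (tends_iota0 hv (sappr_op2 rfL bounded_unif_mul hv H H')) _.
apply: tends_ext (tendsM (tends_iota0 hv H) (tends_iota0 hv H')) => n.
by rewrite -stepM.
Qed.

Lemma iota0Z v (z : R[i]) h : rng v = v -> locunif v h ->
  iota0 v (fun x => z * h x) = z *: iota0 v h.
Proof.
move=> hv [p [c H]].
apply: tends_unique (tends_iota0 hv (sappr_op2 rfL bounded_unif_mul hv (sappr_cst v z p) H)) _.
by apply: tends_ext (tendsZ z (tends_iota0 hv H)) => n; rewrite stepZ.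
Qed.

Lemma iota0_conj v h : rng v = v -> locunif v h ->
  iota0 v (fun x => conjc (h x)) = (iota0 v h)^#.
Proof.
move=> hv [p [c H]].
apply: tends_unique (tends_iota0 hv (sappr_op2 rfL bounded_unif_conj hv H H)) _.
by apply: tends_ext (tends_star (tends_iota0 hv H)) => n; rewrite step_conj.
Qed.

Lemma iota01 v : rng v = v -> iota0 v (fun=> 1) = t v.
Proof.
move=> hv; apply: tends_unique (tends_iota0 hv (sappr_cst v 1 (fun=> 0))) _.
by apply: tends_ext (tends_cst _) => n; rewrite step1.
Qed.

Lemma ck_iota0 v h : rng v = v -> locunif v h -> t v ** iota0 v h = iota0 v h.
Proof.
move=> hv H; rewrite -(iota01 hv) -iota0M //; last exact: locunif_cst.
by apply: iota0_ext => x _; rewrite mul1r.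
Qed.

Lemma tends_sum (I : Type) (r : seq I) (u : I -> nat -> D) (l : I -> D) :
  (forall i, tends (u i) (l i)) ->
  tends (fun n => \sum_(i <- r) u i n) (\sum_(i <- r) l i).
Proof.
move=> H; elim: r => [|i r IH].
  by rewrite big_nil; apply: tends_ext (tends_cst _) => n; rewrite big_nil.
rewrite big_cons; apply: tends_ext (tendsD (H i) IH) => n; rewrite big_cons //.
Qed.

Lemma iota0_split v p h : rng v = v -> locunif v h ->
  iota0 v h = \sum_(a <- pathseq p v)
    t a ** iota0 (src a) (fun x => h (cat a x)) ** (t a)^#.
Proof.
move=> hv /(locunif_above p) [q [c H]].
(* Setting the terms to 0 off [pathseq p v] makes the convergence true for every [a], as [tends_sum]
   requires. *)
pose g a n := if a \in pathseq p v
  then t a ** step t (src a) (q n) (fun b => c n (kcomp a b)) ** (t a)^# else 0.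
pose g' a := if a \in pathseq p v
  then t a ** iota0 (src a) (fun x => h (cat a x)) ** (t a)^# else 0.
have hg a : tends (g a) (g' a).
  rewrite /g /g'; case: ifP => [/(pathseqP rfL hv) [da ra]|_]; last exact: tends_cst.
  apply: tendsM (tends_cst _); apply: tendsM (tends_cst _) _.
  by apply: tends_iota0; [exact: rng_src|apply: (sappr_cat (v := v)) => //; rewrite da].
apply: tends_unique (tends_iota0 hv H) _.
rewrite (eq_big_seq g'); last by move=> a ha; rewrite /g' ha.
apply: tends_ext (tends_sum (pathseq p v) hg) => n.
rewrite step_split //; apply: eq_big_seq => a ha; rewrite /g ha //.
Qed.

(** The element intended as the image of [blockF a b h]; both obey the same rules for products,
    adjoints and refinement. *)
Definition blockW a b h : D := t a ** iota0 (src a) h ** (t b)^#.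

Lemma blockW_mul a b b' c h h' : src a = src b -> deg b = deg b' ->
  locunif (src a) h -> locunif (src b') h' ->
  blockW a b h ** blockW b' c h' =
  if b == b' then blockW a c (fun x => h x * h' x) else 0.
Proof.
move=> ab d H H'; rewrite /blockW !cs_mulA -(cs_mulA _ _ (t b')).
rewrite (ck_orthonormal rfL ck d); case: eqP => [e|_]; last first.
  by rewrite cs_mul0r !cs_mul0l.
rewrite -{}e -ab in H' *; rewrite iota0M ?rng_src // -(cs_mulA _ (t (src a))) ck_iota0 ?rng_src //.
by rewrite cs_mulA.
Qed.

Lemma blockW_star a b h : src a = src b -> locunif (src a) h ->
  (blockW a b h)^# = blockW b a (fun x => conjc (h x)).
Proof.
move=> ab H; rewrite /blockW !cs_starM cs_starK -ab iota0_conj ?rng_src //.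
by rewrite cs_mulA.
Qed.

Lemma blockW_refine p a b h : src a = src b -> locunif (src a) h ->
  blockW a b h = \sum_(c <- pathseq p (src a))
    blockW (kcomp a c) (kcomp b c) (fun x => h (cat c x)).
Proof.
move=> ab H; rewrite {1}/blockW (iota0_split p (rng_src a) H) cs_mul_sumr cs_mul_suml.
apply: eq_big_seq => c /(pathseqP rfL (rng_src a)) [_ rc].
by rewrite /blockW src_comp // !(ck_comp ck) -?ab // cs_starM !cs_mulA.
Qed.

Lemma blockWD a b h h' : locunif (src a) h -> locunif (src a) h' ->
  blockW a b (fun x => h x + h' x) = blockW a b h + blockW a b h'.
Proof. by move=> H H'; rewrite /blockW iota0D ?rng_src // cs_mulDr cs_mulDl. Qed.

Lemma blockWZ a b (z : R[i]) h : locunif (src a) h ->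
  blockW a b (fun x => z * h x) = z *: blockW a b h.
Proof. by move=> H; rewrite /blockW iota0Z ?rng_src // cs_mulZr cs_mulZl. Qed.

Lemma blockW_ext a b h h' : (forall x, root x = src a -> h x = h' x) ->
  blockW a b h = blockW a b h'.
Proof. by move=> e; rewrite /blockW (iota0_ext e). Qed.

Lemma blockW1 a : blockW a (src a) (fun=> 1) = t a.
Proof.
rewrite /blockW iota01 ?rng_src // (ck_src ck).
by have [-> _] := ck_object ck (rng_src a); rewrite (ck_src ck).
Qed.

End Diagonal.

(** * Existence of the higher rank graph C*-algebra *)

Section GraphAlgebraExists.
Context {R : realType} {k : nat} (L : kgraph k).
Hypothesis rfL : row_finite L.

Definition ck_family (D : cstar_algebra R) (t : L -> D) : Prop :=
  cuntz_krieger_family t.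

Lemma ck_family_le1 (r : representation ck_family) l : nrm (rep_gen r l) <= 1.
Proof. exact: ck_le1 (rep_genP r) l. Qed.

Definition graph_algebra : cstar_algebra R := universal_cstar ck_family_le1.

Definition graph_gen : L -> graph_algebra := ugen ck_family_le1.

Lemma graph_gen_ck : cuntz_krieger_family graph_gen.
Proof.
have ev (r : representation ck_family) l : uev r (graph_gen l) = rep_gen r l by exact: uev_gen.
have evM (r : representation ck_family) (x y : graph_algebra) : uev r (x ** y) = uev r x ** uev r y.
  by exact: uevM.
have evS (r : representation ck_family) (x : graph_algebra) : uev r x^# = (uev r x)^#.
  by exact: uevS.
split.
- by move=> l; apply: uev_inj => r; rewrite !evM evS ev; case: (rep_genP r).
- split=> [v hv|v w hv hw vw].
    by split; apply: uev_inj => r; rewrite ?evM ?evS ev;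
      have [] := ck_object (rep_genP r) hv.
  apply: uev_inj => r; rewrite evM !ev uev0.
  exact: (ck_disjoint (rep_genP r)).
- by move=> l m lm; apply: uev_inj => r; rewrite evM !ev (ck_comp (rep_genP r)).
- by move=> l; apply: uev_inj => r; rewrite evM evS !ev (ck_star (rep_genP r)).
- move=> v n hv; apply: uev_inj => r; rewrite ev (ck_sum rfL (rep_genP r) n hv).
  rewrite sum_paths //; elim: (pathseq n v) => [|l s IH]; first by rewrite !big_nil uev0.
  by rewrite !big_cons uevD evM evS ev IH.
Qed.

(** Contractivity of [phi], used in [phi_iota0], is immediate here because the norm is a supremum
    over representations and [phi] is one of them. *)
Lemma graph_universal (D : cstar_algebra R) (t : L -> D) :
  cuntz_krieger_family t ->
  exists phi : graph_algebra -> D, [/\ star_hom phi, forall l, phi (graph_gen l) = t l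
    & forall b, nrm (phi b) <= nrm b].
Proof.
move=> ckt; pose r := @Representation _ _ ck_family D t ckt.
exists (uev r); split; first exact: (uev_star_hom ck_family_le1 r).
- by move=> l; exact: (uev_gen ck_family_le1 r l).
- by move=> b; exact: uev_le.
Qed.

Lemma graph_algebraP : is_graph_algebra L graph_algebra.
Proof.
exists graph_gen; split; first exact: graph_gen_ck.
- exact: ugen_generated.
- by move=> D t /graph_universal [phi [h1 h2 _]]; exists phi.
Qed.

End GraphAlgebraExists.

(** * The commuting cellular automata and the topology of the path space *)

Section ShiftAction.
Context {k : nat} {L : kgraph k}.
Notation X := (@infinite_path k L).
Implicit Types (x y z : X) (a b l : L) (p q n : 'N^k).

Lemma pre_le x p q : dle p q -> pre x p = hd (pre x q) p.
Proof.
move=> le; have [c h e] := preD x p (dsub q p); rewrite dsubK // in e.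
by rewrite e hd_comp // deg_pre.
Qed.

Lemma letter_sh x (N : nat) : letter x N = pre (sh (cdeg N) x) (cdeg 1).
Proof. by rewrite pre_sh letter_pre -cdegD addn1. Qed.

Lemma shC p q x : sh p (sh q x) = sh q (sh p x).
Proof. by rewrite -!shD addrC. Qed.

Lemma letter_shS x N : letter (sh (cdeg 1) x) N = letter x N.+1.
Proof. by rewrite !letter_sh -shD -cdegD addn1. Qed.

Lemma pre_cdeg2 x : pre x (cdeg 2) = kcomp (letter x 0) (letter x 1).
Proof. by rewrite pre_cdeg /= comp_rng. Qed.

(** The [N]-th letter of [sh n x] is the segment of [x] of degree [(1, .., 1)] starting at
    [N (1, .., 1) + n]. As [n] is at most [(1, .., 1)], it lies inside two consecutive letters, so a
    window of length two suffices. *)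
Lemma letter_sh_local x n N : dle n (cdeg 1) ->
  letter (sh n x) N =
  tl (hd (kcomp (letter x N) (letter x N.+1)) (n + cdeg 1)) n.
Proof.
move=> le; rewrite letter_sh shC pre_sh; congr tl.
rewrite (@pre_le _ _ (cdeg 2)); last first.
  by move=> i; have := le i; rewrite degDE !ffunE; lia.
by rewrite pre_cdeg2 !letter_sh cdeg0 sh0 -shD -cdegD add1n.
Qed.

Definition unit_deg (i : 'I_k) : 'N^k := [ffun j => (j == i : nat)].

Definition unit_shift (i : 'I_k) : X -> X := sh (unit_deg i).

Lemma unit_shift_comm : pairwise_commuting unit_shift.
Proof. by move=> i j; apply/funext => x; exact: shC. Qed.

Lemma big_comp_sh (I : Type) (r : seq I) (f : I -> 'N^k) :
  \big[@comp X X X/id]_(i <- r) sh (f i) = sh (\sum_(i <- r) f i).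
Proof.
elim: r => [|i r IH]; first by rewrite !big_nil; apply/funext => x; rewrite sh0.
by rewrite !big_cons IH; apply/funext => x; rewrite shD.
Qed.

Lemma sum_unit_deg (f : 'I_k -> nat) :
  \sum_(i < k) [ffun j => (f i * (j == i))%N] = [ffun i => f i] :> 'N^k.
Proof.
apply/ffunP => j; rewrite sum_ffunE ffunE (bigD1 j) //= ffunE eqxx muln1.
rewrite big1 => [|i ij]; first exact: addn0.
by rewrite ffunE eq_sym (negbTE ij) muln0.
Qed.

Lemma iter_unit_shift (i : 'I_k) (m : nat) :
  iter m (unit_shift i) = sh [ffun j => (m * (j == i))%N].
Proof.
apply/funext => x; elim: m => [|m IH] /=.
  by rewrite -[LHS]sh0; congr (sh _ x); apply/ffunP => j; rewrite !ffunE.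
rewrite IH /unit_shift -shD; congr (sh _ x).
by apply/ffunP => j; rewrite degDE !ffunE mulSn.
Qed.

Lemma iter_actE n : iter_act unit_shift n = sh n.
Proof.
rewrite /iter_act; under eq_bigr => i _ do rewrite iter_unit_shift.
by rewrite big_comp_sh (sum_unit_deg n); congr sh; apply/ffunP => i; rewrite ffunE.
Qed.

Lemma prod_unit_shift x :
  set_val ((\big[@comp X X X/id]_(i < k) unit_shift i) x) = left_shift (set_val x).
Proof.
rewrite big_comp_sh (_ : \sum_(i < k) _ = cdeg 1).
  by apply/funext => N; apply: val_inj; exact: letter_shS.
rewrite -[RHS](sum_unit_deg (fun=> 1%N)); apply: eq_bigr => i _.
by apply/ffunP => j; rewrite !ffunE mul1n.
Qed.

Lemma unit_shift_cellular i : cellular_automaton (unit_shift i).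
Proof.
(* The default [a] of [insubd] only makes [psi] well typed; on blocks of [x] the cut is a letter of
   [sh (unit_deg i) x], of the right degree. *)
pose psi (w : @language (alphabet L) 1 (markov_space (@transition k L))) : alphabet L :=
  let a := tnth (set_val w) ord0 in
  insubd a (tl (hd (kcomp (val a) (val (tnth (set_val w) ord_max)))
    (unit_deg i + cdeg 1)) (unit_deg i)).
exists 1%N, psi => x N; apply: val_inj.
rewrite -[LHS]/(letter (sh (unit_deg i) x) N).
have e : letter (sh (unit_deg i) x) N =
  tl (hd (kcomp (letter x N) (letter x N.+1)) (unit_deg i + cdeg 1)) (unit_deg i).
  by apply: letter_sh_local => j; rewrite !ffunE; case: eqP.
rewrite /psi /= !tnth_mktuple /= addn0 addn1 val_insubd -/(letter x N) -/(letter x N.+1) -e.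
by rewrite deg_letter eqxx.
Qed.

Lemma nbhs_letter x N : nbhs x [set y | letter y N = letter x N].
Proof.
have c1 : continuous (fun y : X => (set_val y : full_shift (alphabet L))).
  exact: initial_continuous.
have c2 := @proj_continuous nat (fun _ => discrete_topology (alphabet L)) N.
have h : nbhs (set_val x : full_shift (alphabet L)) [set z | z N = set_val x N].
  exact: (c2 _ _ (discrete_set1 (set_val x N : discrete_topology (alphabet L)))).
have := c1 x _ h; rewrite nbhs_simpl => h2.
by apply: (@filterS _ (nbhs x) _ _ _ _ h2) => y /= e; congr val.
Qed.

Lemma nbhs_cyl x p : nbhs x [set y | pre y p = pre x p].
Proof.
have : nbhs x [set y | forall i, (i < (dmax p).+1)%N -> letter y i = letter x i].
  elim: (dmax p).+1 => [|N IH]; first by apply: filterS filterT => y _ i.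
  apply: filterS2 IH (nbhs_letter x N) => y h e i.
  by rewrite ltnS leq_eqVlt => /orP[/eqP ->|/h].
apply: filterS => y h; rewrite /= /pre; congr hd.
elim: (dmax p) h => [|N IH] h /=; first by rewrite h.
by rewrite IH ?h // => i hi; apply: h; rewrite ltnS ltnW.
Qed.

Lemma open_cyl a : open (cyl a).
Proof.
rewrite openE => x ax; apply: filterS (nbhs_cyl x (deg a)) => y /= e.
by rewrite /cyl /= e.
Qed.

Lemma nbhs_pathP x (U : set X) :
  nbhs x U -> exists N, forall y, pre y (cdeg N) = pre x (cdeg N) -> U y.
Proof.
(* This filter of sets containing a cylinder around [x] converges in every coordinate, hence in the
   product topology; so every neighbourhood contains a cylinder. *)
pose F : set_system (full_shift (alphabet L)) := [set V | exists N,
  forall y : X, pre y (cdeg N) = pre x (cdeg N) -> V (set_val y)].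
have FF : Filter F.
  split; first by exists 0%N.
    move=> V W [N hN] [M hM]; exists (maxn N M) => y e; split.
      apply: hN; rewrite (pre_le _ (dle_cdeg (leq_maxl N M))) e -pre_le //.
      exact/dle_cdeg/leq_maxl.
    apply: hM; rewrite (pre_le _ (dle_cdeg (leq_maxr N M))) e -pre_le //.
    exact/dle_cdeg/leq_maxr.
  by move=> V W VW [N hN]; exists N => y /hN /VW.
have Fx : F --> (set_val x : full_shift (alphabet L)).
  apply/cvg_sup => N V.
  move=> [_ [[W oW <-] Wx WV]]; exists N.+1 => y e; apply: WV.
  rewrite /= /proj /=; have -> : set_val y N = set_val x N; last exact: Wx.
  by apply: val_inj; rewrite -[LHS]/(letter y N) -[RHS]/(letter x N) !letter_pre e.
move=> [_ [[V oV <-] Vx VU]].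
have /Fx [N hN] : nbhs (set_val x : full_shift (alphabet L)) V.
  by apply: open_nbhs_nbhs.
by exists N => y /hN /VU.
Qed.

Lemma cvg_path (f : X -> X) x : (forall N, exists M, forall y,
    pre y (cdeg M) = pre x (cdeg M) -> pre (f y) (cdeg N) = pre (f x) (cdeg N)) ->
  {for x, continuous f}.
Proof.
move=> h U /nbhs_pathP [N hN]; have [M hM] := h N.
by apply: filterS (nbhs_cyl x (cdeg M)) => y /hM /hN.
Qed.

Lemma continuous_sh n : continuous (sh n : X -> X).
Proof.
move=> x; apply: cvg_path => N; exists (dmax (n + cdeg N)) => y e.
have le := dle_dmax (leqnn (dmax (n + cdeg N))).
by rewrite !pre_sh (pre_le y le) (pre_le x le) e.
Qed.

Lemma continuous_cat a x : src a = root x -> {for x, continuous (cat a)}.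
Proof.
move=> h; apply: cvg_path => N; exists N => y e.
have h' : src a = root y by rewrite -(rng_pre y (cdeg N)) e rng_pre.
have le : dle (cdeg N) (deg a + cdeg N) by rewrite addrC; exact: dle_add.
by rewrite !(pre_le _ le) !pre_cat // e.
Qed.

Lemma sh_local_homeomorphism n : local_homeomorphism (sh n : X -> X).
Proof.
move=> x; pose a := pre x n.
have da : deg a = n by exact: deg_pre.
have img : sh n @` cyl a = cyl (src a).
  apply/seteqP; split=> [_ [y ya <-]|z /(cyl_object _ (rng_src a)) rz].
    by apply/(cyl_object _ (rng_src a)); rewrite -da cyl_sh.
  by exists (cat a z); [exact: cyl_cat|rewrite -da sh_cat].
exists (cyl a), (cat a); split; split.
- exact: open_cyl.
- exact: cyl_pre.
- by rewrite img; exact: open_cyl.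
- by move=> y /set_mem ya; rewrite -da cyl_cat_sh.
- exact/continuous_subspaceT/continuous_sh.
- apply: continuous_in_subspaceT => z /set_mem; rewrite img.
  by move=> /(cyl_object _ (rng_src a)) rz; exact: continuous_cat.
Qed.

End ShiftAction.

(** * The groupoid of infinite paths and its compact open bisections *)

Section Differences.
Context {k : nat}.
Implicit Types m n p : 'N^k.

Lemma zsub_add m n p : zsub (m + p) (n + p) = zsub m n.
Proof. by apply/ffunP => i; rewrite [LHS]ffunE [RHS]ffunE !degDE; lia. Qed.

Lemma zsub_eq m n m' n' : zsub m n = zsub m' n' -> m + n' = m' + n.
Proof.
move=> /ffunP h; apply/ffunP => i; have e := h i; rewrite !ffunE in e.
by rewrite !degDE; lia.
Qed.

Lemma zsubrI m n n' : zsub m n = zsub m n' -> n = n'.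
Proof. by move=> /zsub_eq /degDI. Qed.

Lemma zsub_addr m n p : zsub m n + zsub n p = zsub m p.
Proof. by apply/ffunP => i; rewrite !ffunE; lia. Qed.

Lemma zsubN m n : - zsub m n = zsub n m.
Proof. by apply/ffunP => i; rewrite !ffunE; lia. Qed.

End Differences.

Section PathGroupoid.
Context {k : nat} {L : kgraph k}.
Notation X := (@infinite_path k L).

Definition path_action : nat_action k X := iterated_action (@unit_shift_comm k L).
Definition path_groupoid : groupoid := semidirect_product path_action.
Notation G := (sdp path_action).

Implicit Types (x y z : X) (a b c l : L) (g : G) (p : 'N^k).

Lemma path_actionE n x : path_action n x = sh n x.
Proof. by rewrite /path_action /= iter_actE. Qed.

Lemma arrow_ext g g' : sdp_left g = sdp_left g' -> sdp_deg g = sdp_deg g' ->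
  sdp_right g = sdp_right g' -> g = g'.
Proof.
move=> h1 h2 h3; apply: (@val_inj _ _ (set_type _)).
move: h1 h2 h3; rewrite /sdp_left /sdp_deg /sdp_right.
by case: (val g) => [[? ?] ?]; case: (val g') => [[? ?] ?] /= -> -> ->.
Qed.

Lemma arrow_exists x y n m : sh n x = sh m y ->
  exists g, [/\ sdp_left g = x, sdp_deg g = zsub n m & sdp_right g = y].
Proof.
move=> e; have h : (x, zsub n m, y) \in sdp_set path_action.
  by apply/mem_set; exists n, m; rewrite !path_actionE.
by exists (mk_sdp h).
Qed.

Lemma arrowP g : exists n m, sh n (sdp_left g) = sh m (sdp_right g) /\
  sdp_deg g = zsub n m.
Proof. by have [n [m [h1 h2]]] := set_valP g; exists n, m; rewrite -!path_actionE. Qed.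

(* The compact open bisection usually written Z(a, b). *)
Definition bis a b : set G := sdp_open (deg a) (deg b) (cyl a) (cyl b).

Lemma bisP a b g : bis a b g <-> [/\ cyl a (sdp_left g), cyl b (sdp_right g),
  sh (deg a) (sdp_left g) = sh (deg b) (sdp_right g) & sdp_deg g = zsub (deg a) (deg b)].
Proof.
by split=> -[h1 h2 h3 h4]; split=> //; move: h3; rewrite !path_actionE.
Qed.

Lemma bis_src a b g : bis a b g -> src a = src b.
Proof. by move=> /bisP [h1 h2 h3 _]; rewrite -(cyl_sh h1) h3 cyl_sh. Qed.

Lemma bis_root a b g : bis a b g -> root (sh (deg a) (sdp_left g)) = src a.
Proof. by move=> /bisP [h1 _ _ _]; exact: cyl_sh. Qed.

Lemma bis_inj a b g g' : bis a b g -> bis a b g' -> sdp_left g = sdp_left g' -> g = g'.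
Proof.
move=> /bisP [h1 h2 h3 h4] /bisP [h1' h2' h3' h4'] e.
apply: arrow_ext => //; first by rewrite h4 h4'.
by rewrite -(cyl_cat_sh h2) -(cyl_cat_sh h2') -h3 -h3' e.
Qed.

Lemma bis_exists a b z : src a = src b -> src a = root z ->
  exists2 g, bis a b g & sdp_left g = cat a z.
Proof.
move=> ab az; have bz : src b = root z by rewrite -ab.
have [|g [h1 h2 h3]] := @arrow_exists (cat a z) (cat b z) (deg a) (deg b).
  by rewrite !sh_cat.
by exists g => //; apply/bisP; rewrite h1 h2 h3 !sh_cat //; split=> //; exact: cyl_cat.
Qed.

(** Bisections with the same left degree are equal or disjoint: the degree of the arrow then fixes
    the right degree too. *)
Lemma bis_level a b a' b' g : bis a b g -> bis a' b' g -> deg a = deg a' ->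
  a = a' /\ b = b'.
Proof.
move=> /bisP [h1 h2 _ h4] /bisP [h1' h2' _ h4'] d.
have db : deg b = deg b' by apply: (@zsubrI _ (deg a)); rewrite -h4 h4' d.
by rewrite -[a]h1 -[b]h2 -[a']h1' -[b']h2' d db.
Qed.

Lemma bis_comp a b c g : src a = src b -> src a = rng c ->
  bis (kcomp a c) (kcomp b c) g <-> bis a b g /\ cyl c (sh (deg a) (sdp_left g)).
Proof.
move=> ab ac; have bc : src b = rng c by rewrite -ab.
have da : deg (kcomp a c) = deg c + deg a by rewrite deg_comp // addrC.
have db : deg (kcomp b c) = deg c + deg b by rewrite deg_comp // addrC.
have dd : zsub (deg c + deg a) (deg c + deg b) = zsub (deg a) (deg b).
  by rewrite ![deg c + _]addrC zsub_add.
split=> [/bisP|[/bisP [h1 h2 h3 h4] h5]]; last first.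
  apply/bisP; rewrite da db dd !shD -h3; split=> //; first exact/(cyl_comp _ ac).
  by apply/(cyl_comp _ bc); rewrite -h3.
rewrite da db dd !shD => -[/(cyl_comp _ ac) [h1 h2] /(cyl_comp _ bc) [h3 h4] h5 h6].
split=> //; apply/bisP; split=> //.
by rewrite -(cyl_cat_sh h2) -(cyl_cat_sh h4) h5.
Qed.

Lemma bis_refine a b g p : bis a b g ->
  let c := pre (sh (deg a) (sdp_left g)) p in
  src a = rng c /\ bis (kcomp a c) (kcomp b c) g.
Proof.
move=> abg c; have ac : src a = rng c by rewrite rng_pre (bis_root abg).
by split=> //; apply/bis_comp => //; [exact: bis_src abg|split=> //; exact: cyl_pre].
Qed.

(** Extending the first pair by degree [deg a'] and the second by [deg a] gives the same left
    degree, so the two extensions through [g] coincide by [bis_level]. *)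
Lemma bis_common a b a' b' g : bis a b g -> bis a' b' g ->
  let c := pre (sh (deg a) (sdp_left g)) (deg a') in
  [/\ src a = rng c, bis (kcomp a c) (kcomp b c) g
    & bis (kcomp a c) (kcomp b c) `<=` bis a' b'].
Proof.
move=> h h' c; have [ac hc] := bis_refine (deg a') h; split=> //.
have [ac' hc'] := bis_refine (deg a) h'.
have [|-> ->] := bis_level hc hc'; last first.
  by move=> g'; move/(bis_comp _ (bis_src h') ac') => [].
by rewrite !deg_comp // !deg_pre addrC.
Qed.

Lemma open_bis a b : open (bis a b).
Proof.
exists [set bis a b]; last by rewrite bigcup_set1.
move=> _ ->; exists [fset bis a b]%fset; last by rewrite set_fset1 bigcap_set1.
move=> W; rewrite inE => /eqP ->; apply/mem_set.
by exists (deg a), (deg b), (cyl a), (cyl b); split=> //; exact: open_cyl.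
Qed.

(** The topology is given by a subbase only. Intersections are handled by [bis_common]; inside a
    subbasic set, both paths are lengthened by the same [q] until their cylinders fit into [A] and
    [B]. *)
Lemma nbhs_bisP g (U : set G) :
  nbhs g U <-> exists a b, bis a b g /\ bis a b `<=` U.
Proof.
split=> [|[a [b [h hU]]]]; last first.
  by apply: filterS hU _; apply: open_nbhs_nbhs; split=> //; exact: open_bis.
have base : exists a b, bis a b g.
  have [n [m [h1 h2]]] := arrowP g.
  exists (pre (sdp_left g) n), (pre (sdp_right g) m); apply/bisP; rewrite !deg_pre.
  by split=> //; exact: cyl_pre.
have meet (V W : set G) : (exists a b, bis a b g /\ bis a b `<=` V) ->
    (exists a b, bis a b g /\ bis a b `<=` W) ->
    exists a b, bis a b g /\ bis a b `<=` V `&` W.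
  move=> [a [b [h hV]]] [a' [b' [h' hW]]]; have [ac hc sub] := bis_common h h'.
  exists (kcomp a (pre (sh (deg a) (sdp_left g)) (deg a'))),
         (kcomp b (pre (sh (deg a) (sdp_left g)) (deg a'))).
  split=> // g' hg'; split; last exact/hW/sub.
  by apply: hV; have [] := (bis_comp g' (bis_src h) ac).1 hg'.
have subbase n m A B : open A -> open B -> sdp_open n m A B g ->
    exists a b, bis a b g /\ bis a b `<=` sdp_open n m A B.
  move=> oA oB [gA gB]; rewrite !path_actionE => e d.
  have /nbhs_pathP [N hN] : nbhs (sdp_left g) A by exact: open_nbhs_nbhs.
  have /nbhs_pathP [M hM] : nbhs (sdp_right g) B by exact: open_nbhs_nbhs.
  pose a := pre (sdp_left g) n; pose b := pre (sdp_right g) m.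
  have abg : bis a b g by apply/bisP; rewrite !deg_pre; split=> //; exact: cyl_pre.
  pose q := cdeg (maxn N M) : 'N^k.
  have [ac hc] := bis_refine q abg; set c := pre _ _ in ac hc.
  exists (kcomp a c), (kcomp b c); split=> // g' hg'.
  have [/bisP [h1 h2 h3 h4] _] := (bis_comp g' (bis_src abg) ac).1 hg'.
  rewrite !deg_pre in h3 h4.
  have same l (x y : X) (N' : nat) : dle (cdeg N') (deg l) -> cyl l x -> cyl l y ->
      pre x (cdeg N') = pre y (cdeg N').
    by move=> le lx ly; rewrite (pre_le x le) (pre_le y le) lx ly.
  have [/bisP [k1 k2 _ _] /bisP [k1' k2' _ _]] := (hc, hg').
  have dc : deg c = q by exact: deg_pre.
  split; rewrite ?path_actionE //.
  - apply: hN; apply: (same (kcomp a c)) => //.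
    rewrite deg_comp // dc addrC; apply: dle_trans (dle_add _ _).
    exact/dle_cdeg/leq_maxl.
  - apply: hM; apply: (same (kcomp b c)) => //.
    rewrite deg_comp -?(bis_src abg) // dc addrC; apply: dle_trans (dle_add _ _).
    exact/dle_cdeg/leq_maxr.
(* [C] is a finite intersection of subbasic sets that contains [g]; the induction runs over the list
   [E] of its factors. *)
move=> [_ [[B sB <-] [C BC Cg] sU]].
have /sB [E sE IE] := BC.
suff [a [b [h hC]]] : exists a b, bis a b g /\ bis a b `<=` C.
  by exists a, b; split=> // g' /hC Cg'; apply: sU; exists C.
have {BC}Cg' : forall W, W \in E -> W g by move=> W WE; move: Cg; rewrite -IE; exact.
rewrite -IE {IE Cg sU sB}.
have {}sE : forall W, W \in E -> sdp_subbase W by move=> W /sE /set_mem.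
suff H : forall s : seq (set G), {subset s <= E} ->
    exists a b, bis a b g /\ bis a b `<=` [set g' | forall W, W \in s -> W g'].
  have [a [b [h hs]]] := H (finmap.enum_fset E) (fun _ => id).
  by exists a, b; split=> // g' /hs h' W /= WE; exact: h'.
elim=> [|W s IH] sub.
  by have [a [b h]] := base; exists a, b; split=> // g' _ W.
have [|a [b [h hs]]] := IH; first by move=> W' WW'; apply: sub; rewrite inE WW' orbT.
have WE : W \in E by apply: sub; rewrite inE eqxx.
have [n [m [A [A' [oA oA' eW]]]]] := sE _ WE.
have [|a' [b' [h' hs']]] := @meet W [set g' | forall W, W \in s -> W g'] _ (ex_intro _ a (ex_intro _ b (conj h hs))).
  by rewrite eW; apply: subbase => //; rewrite -eW; exact: Cg'.
exists a', b'; split=> // g' /hs' [h1 h2] W'; rewrite inE => /orP[/eqP -> //|].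
exact: h2.
Qed.

Lemma nbhs_bis_refine a b g (U : set G) : bis a b g -> nbhs g U ->
  exists N, forall c, c = pre (sh (deg a) (sdp_left g)) (cdeg N) ->
    bis (kcomp a c) (kcomp b c) `<=` U.
Proof.
move=> abg /nbhs_bisP [a' [b' [abg' hU]]].
have [ac hc sub] := bis_common abg abg'.
set z := sh _ _ in ac hc sub; exists (dmax (deg a')) => c ->.
have le : dle (deg a') (cdeg (dmax (deg a'))) by exact: dle_dmax.
have ac' p : src a = rng (pre z p) by rewrite rng_pre (bis_root abg).
move=> g' /(bis_comp _ (bis_src abg) (ac' _)) [h1 h2]; apply/hU/sub.
apply/bis_comp => //; first exact: bis_src abg.
split=> //; move: h2; rewrite /cyl /= !deg_pre => h2.
by rewrite (pre_le _ le) h2 -pre_le.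
Qed.

(** A bisection around [g], refined by [deg a], cannot meet [bis a b]: at an arrow of both,
    [bis_level] would identify it with a refinement of [bis a b], which would then contain [g]. *)
Lemma bis_closed a b g : ~ bis a b g -> nbhs g (~` bis a b).
Proof.
move=> ng; have /nbhs_bisP [a' [b' [h _]]] : nbhs g setT by exact: filterT.
have [ac hc] := bis_refine (deg a) h; set c := pre _ _ in ac hc.
apply/nbhs_bisP; exists (kcomp a' c), (kcomp b' c); split=> // g' hg' abg'.
have [e he] := bis_refine (deg a') abg'; set c' := pre _ _ in e he.
have [|e1 e2] := bis_level hg' he; first by rewrite !deg_comp // !deg_pre addrC.
apply: ng; rewrite e1 e2 in hc.
by have [] := (bis_comp g (bis_src abg') e).1 hc.
Qed.

Lemma closed_bis a b : closed (bis a b).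
Proof.
by rewrite -openC openE => g ng; exact: bis_closed.
Qed.

Section RowFinite.
Hypothesis rfL : row_finite L.

(** If a filter [F] on [bis a b] had no cluster point there, [path_bar] would put the complement of
    [bis a b] in [F]. Row-finiteness makes the intersection over one-step extensions finite; along
    an infinite path, the arrow it defines is not a cluster point, so some refinement around it is
    avoided. *)
Lemma compact_bis a b : src a = src b -> compact (bis a b).
Proof.
move=> ab F FF Fab; apply: contrapT => nc.
suff : F (~` bis (kcomp a (src a)) (kcomp b (src a))).
  rewrite {2}ab !comp_src => Fn.
  by have [g []] := filter_ex (filterI Fab Fn).
pose Q c := src a = rng c -> F (~` bis (kcomp a c) (kcomp b c)).
apply: (path_bar (Q := Q)) (rng_src a) _ _; last by rewrite rng_src.
- move=> c IH ac.
  have : F [set g | forall e, e \in pathseq (cdeg 1) (src c) ->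
      (~` bis (kcomp a (kcomp c e)) (kcomp b (kcomp c e))) g].
    elim: (pathseq _ _) (fun e => pathseqP rfL (rng_src c) (l := e) (n := cdeg 1)) => [|e s IHs] hs.
      by apply: filterS filterT => g _ e.
    have [|de re] := hs e; first by rewrite inE eqxx.
    have Fe : F (~` bis (kcomp a (kcomp c e)) (kcomp b (kcomp c e))).
      by apply: IH; rewrite ?rng_comp.
    have := IHs (fun e' h => hs e' (mem_behead (s := e :: s) h)).
    apply: filterS2 Fe => g h1 h2 e'; rewrite inE => /orP[/eqP -> //|].
    exact: h2.
  apply: filterS => g h hc; have [e he] := bis_refine (cdeg 1) hc.
  apply: (h (pre (sh (deg (kcomp a c)) (sdp_left g)) (cdeg 1))).
    by rewrite mem_pathseq ?rng_src // deg_pre -e src_comp ?eqxx.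
  rewrite src_comp // in e.
  by rewrite !kcompA // -ab.
- move=> z rz; have [g hg lg] := bis_exists ab (esym rz).
  have : ~ cluster F g by move=> cg; apply: nc; exists g.
  move=> /existsNP [A /existsNP [U /not_implyP [FA /not_implyP [Ug nAU]]]].
  have [N hN] := nbhs_bis_refine hg Ug; exists N => _.
  have -> : z = sh (deg a) (sdp_left g) by rewrite lg sh_cat.
  apply: filterS FA => g' Ag' hg'; apply: nAU; exists g'; split=> //.
  exact: (hN _ erefl).
Qed.

(** Otherwise the complements in [K] of finite unions of bisections generate a proper filter, whose
    cluster point would lie in an open bisection avoided by a member of the filter. *)
Lemma finite_bis_cover (K : set G) : compact K ->
  exists s : seq (L * L), K `<=` [set g | exists2 ab, ab \in s & bis ab.1 ab.2 g].
Proof.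
move=> cK; apply: contrapT => ns.
pose V (s : seq (L * L)) := [set g | exists2 ab, ab \in s & bis ab.1 ab.2 g].
pose F : set_system G := [set A | exists s, K `\` V s `<=` A].
have FF : ProperFilter F.
  split; last first.
    split; first by exists [::].
      move=> A B [s hs] [t ht]; exists (s ++ t) => g [Kg ng]; split.
        by apply: hs; split=> // -[ab abs h]; apply: ng; exists ab => //; rewrite mem_cat abs.
      by apply: ht; split=> // -[ab abs h]; apply: ng; exists ab => //; rewrite mem_cat abs orbT.
    by move=> A B AB [s hs]; exists s => g /hs /AB.
  move=> [s hs]; apply: ns; exists s => g Kg; apply: contrapT => ng.
  by apply: (hs g).
have [|g [Kg cg]] := cK F FF; first by exists [::] => g [].
have /nbhs_bisP [a [b [h _]]] : nbhs g setT by exact: filterT.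
have [g' [[Kg' ng'] hg']] : (K `\` V [:: (a, b)]) `&` bis a b !=set0.
  apply: cg; first by exists [:: (a, b)].
  by apply: open_nbhs_nbhs; split=> //; exact: open_bis.
by apply: ng'; exists (a, b); rewrite ?inE.
Qed.

End RowFinite.

End PathGroupoid.

(** * Block functions in the convolution algebra *)

Section BlockFunctions.
Context {R : realType} {k : nat} {L : kgraph k}.
Hypothesis rfL : row_finite L.
Notation X := (@infinite_path k L).
Notation G := (sdp (@path_action k L)).
Notation GA := (@path_groupoid k L).
Implicit Types (a b c l : L) (h : X -> R[i]) (g : G) (f : GA -> R[i]).

Definition blockF a b h : GA -> R[i] :=
  fun g : G => if `[< bis a b g >] then h (sh (deg a) (sdp_left g)) else 0.

Lemma blockF_in a b h g : bis a b g -> blockF a b h g = h (sh (deg a) (sdp_left g)).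
Proof. by rewrite /blockF; case: asboolP. Qed.

Lemma blockF_out a b h g : ~ bis a b g -> blockF a b h g = 0.
Proof. by rewrite /blockF; case: asboolP. Qed.

Lemma blockF_supp a b h g : blockF a b h g <> 0 -> bis a b g.
Proof. by rewrite /blockF; case: asboolP. Qed.

Lemma blockF_ext a b h h' : (forall x, root x = src a -> h x = h' x) ->
  blockF a b h = blockF a b h'.
Proof.
move=> e; apply/funext => g; rewrite /blockF; case: asboolP => // abg.
by rewrite e // (bis_root abg).
Qed.

Lemma blockFD a b h h' :
  blockF a b (fun x => h x + h' x) = fun g => blockF a b h g + blockF a b h' g.
Proof. by apply/funext => g; rewrite /blockF; case: ifP => // _; rewrite addr0. Qed.

Lemma blockFZ a b (z : R[i]) h :
  blockF a b (fun x => z * h x) = fun g => z * blockF a b h g.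
Proof. by apply/funext => g; rewrite /blockF; case: ifP => // _; rewrite mulr0. Qed.

Lemma bis_inv a b g : bis a b (sdp_inv g) <-> bis b a g.
Proof.
rewrite !bisP /sdp_left /sdp_right /sdp_deg /= -/(sdp_left g) -/(sdp_right g) -/(sdp_deg g).
split=> -[h1 h2 h3 h4]; split=> //.
  by rewrite -[sdp_deg g]opprK h4 zsubN.
by rewrite h4 zsubN.
Qed.

Lemma blockF_star a b h :
  involution (blockF a b h) = blockF b a (fun x => conjc (h x)).
Proof.
apply/funext => g; rewrite /involution /=.
have [abg|nabg] := pselect (bis b a g).
  rewrite (blockF_in _ abg) blockF_in; last exact/bis_inv.
  by have [_ _ -> _] := (bisP _ _ _).1 abg.
rewrite (blockF_out _ nabg) blockF_out ?conjc0 //.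
by move=> /bis_inv.
Qed.

Lemma blockF_refine p a b h : src a = src b ->
  blockF a b h = fun g => \sum_(c <- pathseq p (src a))
    blockF (kcomp a c) (kcomp b c) (fun x => h (cat c x)) g.
Proof.
move=> ab; apply/funext => g.
have [abg|nabg] := pselect (bis a b g); last first.
  rewrite blockF_out // big_seq big1 // => c /(pathseqP rfL (rng_src a)) [_ rc].
  by apply: blockF_out => /(bis_comp _ ab (esym rc)) [].
have [ac hc] := bis_refine p abg; set z := sh _ _ in ac hc.
set c := pre z p in ac hc.
have dc : deg c = p by exact: deg_pre.
rewrite (blockF_in _ abg) (bigD1_seq c) ?pathseq_uniq //=; last first.
  by rewrite mem_pathseq ?rng_src // dc ac !eqxx.
rewrite big1_seq ?addr0 => [|e /andP[ec /(pathseqP rfL (rng_src a)) [de re]]].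
  by rewrite (blockF_in _ hc) deg_comp // addrC shD dc cat_sh.
apply: blockF_out => /(bis_comp _ ab (esym re)) [_].
by rewrite /cyl /= de -/z -/c => e'; rewrite e' eqxx in ec.
Qed.

Lemma gprod_left (x y w : GA) : gprod x y w -> sdp_left x = sdp_left (w : G).
Proof. by move=> [_ e]; rewrite [RHS]/sdp_left e. Qed.

Lemma gprod_unique (x y y' w : GA) : gprod x y w -> gprod x y' w -> y = y'.
Proof. by move=> /gprodVK h /gprodVK h'; exact: gprod_fun h h'. Qed.

Lemma gprod_exists (x w : G) : sdp_left x = sdp_left w ->
  exists y : G, @gprod GA x y w.
Proof.
move=> e; have h : sdp_right (sdp_inv x) = sdp_left w by [].
exists (mk_sdp (sdp_mulP h)).
have hp : @gprod GA (@ginv GA x) w (mk_sdp (sdp_mulP h)) by [].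
by have := gprodVK hp; rewrite ginvK.
Qed.

(** An arrow of a bisection is determined by its left end, so only one factorization of [w]
    contributes. *)
Lemma convolution_bis a b f f' (x y w : GA) : (forall g, f g <> 0 -> bis a b g) ->
  bis a b x -> gprod x y w -> convolution f f' w = f x * f' y.
Proof.
move=> sf abx hw; rewrite /convolution.
rewrite -(@fsbig_widen _ _ _ _ [set (x, y)]) ?fsbig_set1 //.
  by move=> _ ->.
move=> [x' y'] /= [hw' ne].
have [-> |/eqP nz] := eqVneq (f x') 0; first by rewrite mul0r.
case: ne; have exx : x' = x.
  by apply: (bis_inj (sf _ nz) abx); rewrite (gprod_left hw') (gprod_left hw).
by rewrite exx in hw' *; rewrite (gprod_unique hw' hw).
Qed.

Lemma convolution_bis0 a b f f' (w : GA) : (forall g, f g <> 0 -> bis a b g) ->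
  (forall g, bis a b g -> sdp_left g <> sdp_left (w : G)) -> convolution f f' w = 0.
Proof.
move=> sf nw; rewrite /convolution fsbig1 // => -[x y] /= hw.
have [->|/eqP nz] := eqVneq (f x) 0; first by rewrite mul0r.
by case: (nw x (sf _ nz)); exact: gprod_left hw.
Qed.

Lemma blockF_mul a b b' c h h' : src a = src b -> deg b = deg b' ->
  convolution (blockF a b h) (blockF b' c h') =
  if b == b' then blockF a c (fun x => h x * h' x) else fun=> 0.
Proof.
move=> ab d; apply/funext => w.
have supp g : blockF a b h g <> 0 -> bis a b g by exact: blockF_supp.
have [aw|naw] := pselect (cyl a (sdp_left (w : G))); last first.
  rewrite (convolution_bis0 _ supp).
    by case: ifP => // _; rewrite blockF_out // => /bisP [].
  by move=> g /bisP [ag _ _ _] e; apply: naw; rewrite -e.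
have rz : src a = root (sh (deg a) (sdp_left (w : G))) by rewrite cyl_sh.
have [x hx lx] := bis_exists ab rz; rewrite cyl_cat_sh // in lx.
have [y hy] := gprod_exists lx; rewrite (convolution_bis _ supp hx hy).
have [xy ew] : sdp_right x = sdp_left y /\ _ := hy.
have ry : sdp_right y = sdp_right (w : G) by rewrite [RHS]/sdp_right ew.
have dw : sdp_deg (w : G) = sdp_deg x + sdp_deg y by rewrite [LHS]/sdp_deg ew.
have [x1 x2 x3 x4] := (bisP _ _ _).1 hx.
rewrite (blockF_in _ hx); case: eqP => [e|ne]; last first.
  rewrite blockF_out ?mulr0 // => /bisP [y1 _ _ _]; apply: ne.
  by rewrite -x2 -y1 d xy.
have zy : sh (deg b) (sdp_left y) = sh (deg a) (sdp_left x) by rewrite x3 xy.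
have eq_bis : bis b' c y <-> bis a c (w : G).
  rewrite -e !bisP dw x4 -lx -ry zy -xy; split=> -[h1 h2 h3 h4]; split=> //.
    by rewrite h4 zsub_addr.
  by apply: (@addrI _ (zsub (deg a) (deg b))); rewrite h4 zsub_addr.
have [yb|nyb] := pselect (bis b' c y).
  rewrite (blockF_in _ yb) (blockF_in _ (eq_bis.1 yb)) -e zy lx //.
by rewrite (blockF_out _ nyb) blockF_out ?mulr0 // => /eq_bis.
Qed.

(** A sum over a set is 0 by convention when its support is infinite; the finite set [Q] carrying
    both supports excludes this. *)
Lemma fsum_add (T : choiceType) (P Q : set T) (u v : T -> R[i]) :
  finite_set Q -> Q `<=` P ->
  (forall p, P p -> ~ Q p -> u p = 0 /\ v p = 0) ->
  \sum_(p \in P) (u p + v p) = \sum_(p \in P) u p + \sum_(p \in P) v p.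
Proof.
move=> fQ QP h.
rewrite -(@fsbig_widen _ _ _ _ Q P (fun p => u p + v p)) //; last first.
  by move=> p [Pp nQ] /=; have [-> ->] := h p Pp nQ; rewrite addr0.
rewrite -(@fsbig_widen _ _ _ _ Q P u) //; last first.
  by move=> p [Pp nQ] /=; have [] := h p Pp nQ.
rewrite -(@fsbig_widen _ _ _ _ Q P v) //; last first.
  by move=> p [Pp nQ] /=; have [] := h p Pp nQ.
exact: fsbig_split.
Qed.

(** The condition that makes the convolution sums finite. It holds for block functions and passes to
    sums, so bilinearity can be used for sums of blocks. *)
Definition fibre_finite f : Prop :=
  forall x, finite_set [set g : G | sdp_left g = x /\ f g <> 0].

Lemma fibre_finite_product f (w : GA) : fibre_finite f ->
  finite_set [set p : GA * GA | gprod p.1 p.2 w /\ f p.1 <> 0].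
Proof.
move=> ff; pose mate (x : GA) := xget x [set y : GA | gprod x y w].
apply: sub_finite_set (finite_image (fun x : G => (x, mate x)) (ff (sdp_left (w : G)))).
move=> [x y] /= [hw fx]; exists x; first by split=> //; exact: gprod_left hw.
by congr (_, _); apply: xget_unique => // y' hy'; exact: gprod_unique hy' hw.
Qed.

Lemma fibre_finite0 : fibre_finite (fun=> 0).
Proof. by move=> x; apply: sub_finite_set (finite_set0 G) => g []. Qed.

Lemma fibre_finiteD f f' : fibre_finite f -> fibre_finite f' ->
  fibre_finite (fun g => f g + f' g).
Proof.
move=> h h' x; have fU : finite_set ([set g : G | sdp_left g = x /\ f g <> 0] `|`
    [set g : G | sdp_left g = x /\ f' g <> 0]) by rewrite finite_setU.
apply: sub_finite_set fU => g [lg ne].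
have [e|/eqP] := eqVneq (f g) 0; last by left.
by right; split=> // e'; apply: ne; rewrite e e' addr0.
Qed.

Lemma fibre_finite_block a b h : fibre_finite (blockF a b h).
Proof.
move=> x; have [[g0 [l0 /blockF_supp h0]]|none] :=
  pselect (exists g : G, sdp_left g = x /\ blockF a b h g <> 0).
  apply: sub_finite_set (finite_set1 g0) => g [lg /blockF_supp hg].
  by apply: (bis_inj hg h0); rewrite lg l0.
by apply: sub_finite_set (finite_set0 G) => g hg; apply: none; exists g.
Qed.

Lemma convolutionDl f1 f2 f : fibre_finite f1 -> fibre_finite f2 ->
  convolution (fun g : GA => f1 g + f2 g) f =
  fun w => convolution f1 f w + convolution f2 f w.
Proof.
move=> h1 h2; apply/funext => w; rewrite /convolution.
under eq_fsbigr do rewrite mulrDl.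
apply: (@fsum_add _ _ ([set p : GA * GA | gprod p.1 p.2 w /\ f1 p.1 <> 0] `|`
  [set p : GA * GA | gprod p.1 p.2 w /\ f2 p.1 <> 0])).
- by rewrite finite_setU; split; exact: fibre_finite_product.
- by move=> p [[]|[]].
- move=> p hp np; have [e1|/eqP n1] := eqVneq (f1 p.1) 0; last by case: np; left.
  have [e2|/eqP n2] := eqVneq (f2 p.1) 0; last by case: np; right.
  by rewrite e1 e2 !mul0r.
Qed.

Lemma convolutionDr f f1 f2 : fibre_finite f ->
  convolution f (fun g : GA => f1 g + f2 g) =
  fun w => convolution f f1 w + convolution f f2 w.
Proof.
move=> h; apply/funext => w; rewrite /convolution.
under eq_fsbigr do rewrite mulrDr.
apply: (@fsum_add _ _ [set p : GA * GA | gprod p.1 p.2 w /\ f p.1 <> 0]).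
- exact: fibre_finite_product.
- by move=> p [].
- move=> p hp np; have [e|/eqP n] := eqVneq (f p.1) 0; last by case: np.
  by rewrite e !mul0r.
Qed.

Lemma convolution0l f : convolution (fun=> 0) f = fun=> 0.
Proof. by apply/funext => w; rewrite /convolution fsbig1 // => p _; rewrite mul0r. Qed.

Lemma convolution0r f : convolution f (fun=> 0) = fun=> 0.
Proof. by apply/funext => w; rewrite /convolution fsbig1 // => p _; rewrite mulr0. Qed.

Lemma fibre_finite_sum (I : Type) (s : seq I) (F : I -> GA -> R[i]) :
  (forall i, fibre_finite (F i)) -> fibre_finite (fun g => \sum_(i <- s) F i g).
Proof.
move=> h; elim: s => [|i s IH].
  have -> : (fun g : GA => \sum_(i <- [::]) F i g) = fun=> 0.
    by apply/funext => g; rewrite big_nil.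
  exact: fibre_finite0.
have -> : (fun g : GA => \sum_(j <- i :: s) F j g) =
    fun g => F i g + \sum_(j <- s) F j g.
  by apply/funext => g; rewrite big_cons.
exact: fibre_finiteD.
Qed.

Lemma convolution_suml (I : Type) (s : seq I) (F : I -> GA -> R[i]) f :
  (forall i, fibre_finite (F i)) ->
  convolution (fun g : GA => \sum_(i <- s) F i g) f =
  fun w => \sum_(i <- s) convolution (F i) f w.
Proof.
move=> h; elim: s => [|i s IH].
  rewrite (_ : (fun g : GA => _) = fun=> 0) ?convolution0l.
    by apply/funext => w; rewrite big_nil.
  by apply/funext => g; rewrite big_nil.
rewrite (_ : (fun g : GA => _) = fun g => F i g + \sum_(j <- s) F j g); last first.
  by apply/funext => g; rewrite big_cons.
rewrite convolutionDl ?IH //; last exact: fibre_finite_sum.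
by apply/funext => w; rewrite big_cons.
Qed.

(** The first block is refined by degree [deg m] to match the middle degrees; only its term at [m]
    then has a nonzero product with the second block. *)
Lemma blockF_comp l m : src l = rng m ->
  convolution (blockF l (src l) (fun=> 1)) (blockF m (src m) (fun=> 1)) =
  blockF (kcomp l m) (src m) (fun=> 1).
Proof.
move=> lm; have ls : src l = src (src l) by rewrite src_src.
rewrite (blockF_refine (deg m) _ ls) convolution_suml; last first.
  by move=> c; exact: fibre_finite_block.
apply/funext => w; rewrite (bigD1_seq m) ?pathseq_uniq //=; last first.
  by rewrite mem_pathseq ?rng_src // lm !eqxx.
rewrite big1_seq ?addr0 => [|c /andP[cm /(pathseqP rfL (rng_src l)) [dc rc]]].
  rewrite blockF_mul ?src_comp ?src_src //; last by rewrite lm comp_rng.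
  rewrite lm comp_rng eqxx; congr (blockF _ _ _ w).
  by apply/funext => x; rewrite mul1r.
have -> : kcomp (src l) c = c by rewrite -rc comp_rng.
by rewrite blockF_mul ?src_comp ?rc // (negbTE cm).
Qed.

Lemma nbhs_GA g (U : set G) : @nbhs _ (gr_car GA) g U = @nbhs _ G g U.
Proof. by []. Qed.

Lemma cvg_complex f g : (forall e : R, 0 < e ->
    nbhs g [set g' : G | cabs (f g' - f g) <= e]) ->
  (f : GA -> R[i]^o) @ (g : GA) --> (f g : R[i]^o).
Proof.
move=> H U /nbhs_ballP [e /= /posC_real [-> e0] hU].
have e20 : 0 < complex.Re e / 2 by move: e0 => /= e0; lra.
rewrite nbhs_filterE; change (@nbhs _ (gr_car GA) g [set g' | U (f g')]).
rewrite nbhs_GA; apply: filterS (H _ e20) => g' /= hg'; apply: hU.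
apply/(@nrm_ball R R[i]^o); rewrite nrmB.
by apply: le_lt_trans hg' _; move: e0 => /= e0; lra.
Qed.

Lemma continuous_near f g : continuous (f : GA -> R[i]^o) -> forall e : R, 0 < e ->
  nbhs g [set g' : G | cabs (f g' - f g) <= e].
Proof.
move=> cf e e0; have e0C : 0 < e%:C by rewrite ltcR.
have hn : nbhs (f g : R[i]^o) (ball (f g : R[i]^o) e%:C) by exact: nbhsx_ballx.
have h2 := cf g _ hn; rewrite nbhs_filterE in h2.
change (@nbhs _ (gr_car GA) g [set g' | ball (f g : R[i]^o) e%:C (f g')]) in h2.
rewrite nbhs_GA in h2.
apply: filterS h2 => g' /(@nrm_ball R R[i]^o) /ltW.
by rewrite nrmB.
Qed.

Lemma locunif_oscillation v h (e : R) x : locunif v h -> root x = v -> 0 < e ->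
  exists p, forall y, cyl (pre x p) y -> cabs (h y - h x) <= e.
Proof.
move=> [p [c H]] rx e0; have [N /(_ N (leqnn N)) hN] := H (e / 2) ltac:(lra).
exists (p N) => y py; have hx := hN _ x (deg_pre x (p N)).
have hy := hN _ y (deg_pre x (p N)); rewrite rng_pre in hx hy.
have := hx rx (cyl_pre x (p N)); have := hy rx py.
set w := c _ _; rewrite (cabsBC (h x)) => h1 h2.
by rewrite -(subrKA w) (le_trans (cabsD _ _)) //; lra.
Qed.

Lemma blockF_continuous a b h : locunif (src a) h ->
  continuous (blockF a b h : GA -> R[i]^o).
Proof.
move=> lh g; apply: cvg_complex => e e0.
have [abg|nabg] := pselect (bis a b g); last first.
  apply: filterS (bis_closed nabg) => g' ng' /=.
  by rewrite !blockF_out // subrr cabs0 ltW.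
have [p hp] := locunif_oscillation lh (bis_root abg) e0.
have [ac hc] := bis_refine p abg.
apply/nbhs_bisP; exists (kcomp a (pre (sh (deg a) (sdp_left g)) p)),
  (kcomp b (pre (sh (deg a) (sdp_left g)) p)); split=> // g'.
move=> /(bis_comp _ (bis_src abg) ac) [abg' cg'] /=.
by rewrite (blockF_in _ abg) (blockF_in _ abg'); exact: hp.
Qed.

(** Asking that [K] be closed as well as compact places the closed support inside [K] without appeal
    to the Hausdorff property. *)
Definition supported f : Prop :=
  exists2 K : set G, compact K /\ closed K & forall g, f g <> 0 -> K g.

Lemma Cc_of f : continuous (f : GA -> R[i]^o) -> supported f -> Cc f.
Proof.
move=> cf [K [cK clK] hK]; split=> //.
apply: subclosed_compact cK _; first exact: closed_closure.
rewrite [X in _ `<=` X]((closure_id K).1 clK); apply: closure_subset => g /= /eqP.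
exact: hK.
Qed.

Lemma supportedD f f' : supported f -> supported f' -> supported (fun g : GA => f g + f' g).
Proof.
move=> [K [c1 c2] h] [K' [c1' c2'] h']; exists (K `|` K').
  by split; [exact: compactU|exact: closedU].
move=> g ne; have [e|/eqP n] := eqVneq (f g) 0; last by left; exact: h.
by right; apply: h' => e'; apply: ne; rewrite e e' addr0.
Qed.

Lemma supported_block a b h : src a = src b -> supported (blockF a b h).
Proof.
move=> ab; exists (bis a b); last by move=> g /blockF_supp.
by split; [exact: compact_bis|exact: closed_bis].
Qed.

Lemma Cc_block a b h : src a = src b -> locunif (src a) h -> Cc (blockF a b h).
Proof.
by move=> ab lh; apply: Cc_of; [exact: blockF_continuous|exact: supported_block].
Qed.

Lemma continuous_complexD f f' : continuous (f : GA -> R[i]^o) ->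
  continuous (f' : GA -> R[i]^o) -> continuous ((fun g : GA => f g + f' g) : GA -> R[i]^o).
Proof.
move=> h h' g; apply: cvg_complex => e e0; have e20 : 0 < e / 2 by lra.
apply: filterS2 (continuous_near g h e20) (continuous_near g h' e20) => g' /= h1 h2.
by rewrite opprD addrACA (le_trans (cabsD _ _)) //; lra.
Qed.

Lemma continuous_complexN f : continuous (f : GA -> R[i]^o) ->
  continuous ((fun g : GA => - f g) : GA -> R[i]^o).
Proof.
move=> h g; apply: cvg_complex => e e0.
apply: filterS (continuous_near g h e0) => g' /=.
by rewrite -opprD cabsN.
Qed.

Lemma supported_Cc f : Cc f -> supported f.
Proof.
move=> [_ cf]; exists (closure [set a : GA | f a != 0]).
  by split=> //; exact: closed_closure.
by move=> g ne; apply: subset_closure; exact/eqP.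
Qed.

Lemma CcD f f' : Cc f -> Cc f' -> Cc (fun g : GA => f g + f' g).
Proof.
move=> h h'; apply: Cc_of; last by apply: supportedD; exact: supported_Cc.
by apply: continuous_complexD; [case: h|case: h'].
Qed.

Lemma Cc0 : Cc ((fun=> 0) : GA -> R[i]).
Proof.
apply: Cc_of; last first.
  by exists set0 => //; split; [exact: compact0|exact: closed0].
move=> g; apply: cvg_complex => e e0.
by apply: filterS filterT => g' _ /=; rewrite subrr cabs0 ltW.
Qed.

(* The function on [cyl (src a)] corresponding to the restriction of [f] to the
   bisection [bis a b]. *)
Definition slice f a b : X -> R[i] := fun z => xget 0 [set u |
  exists g : G, [/\ bis a b g, sh (deg a) (sdp_left g) = z & u = f g]].

Lemma sliceE f a b g : bis a b g -> slice f a b (sh (deg a) (sdp_left g)) = f g.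
Proof.
move=> abg; apply: xget_unique; first by exists g.
move=> _ [g' [abg' e ->]]; congr f; apply: (bis_inj abg' abg).
have [[h1 _ _ _] [h1' _ _ _]] := ((bisP _ _ _).1 abg, (bisP _ _ _).1 abg').
by rewrite -(cyl_cat_sh h1) -(cyl_cat_sh h1') e.
Qed.

Lemma blockF_slice f a b g : blockF a b (slice f a b) g = if `[< bis a b g >] then f g else 0.
Proof. by rewrite /blockF; case: asboolP => // /sliceE. Qed.

(** Continuity gives a good approximation only near each infinite path; [path_bar] makes it uniform.
    [Q d] says that the slice, restricted to paths beginning with [d], is within [e] of a function
    of a segment of fixed degree. *)
Lemma slice_locunif f a b : src a = src b -> continuous (f : GA -> R[i]^o) ->
  locunif (src a) (slice f a b).
Proof.
move=> ab cf; set v := src a; apply: locunif_of => e e0.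
pose Q d := rng d = v -> exists p w,
  appr (src d) p (fun x => slice f a b (cat d x)) w e.
have rv : rng v = v by exact: rng_src.
have sv : src v = v by exact: object_src.
have [|p [c hc]] : Q v; last first.
- exists p, c => l x dl rl lx; have rx : root x = v by rewrite (cyl_root lx).
  have := hc l x dl; rewrite sv => /(_ rl lx); congr (cabs (_ - _) <= _).
  congr (slice f a b _); apply: path_ext => N.
  have d0 : deg v = 0 by rewrite -rv deg_rng.
  have := @pre_cat _ _ v x (cdeg N); rewrite sv rx d0 add0r => -> //.
  by rewrite -rx -(rng_pre x (cdeg N)) comp_rng.
- exact: rv.
apply: (path_bar (Q := Q)) => //.
- move=> d IH rd.
  have /choice [pc hpc] : forall b' : L, exists pc : 'N^k * (L -> R[i]),
      b' \in pathseq (cdeg 1) (src d) ->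
      appr (src b') pc.1 (fun x => slice f a b (cat (kcomp d b') x)) pc.2 e.
    move=> b'; have [hb|nb] := pselect (b' \in pathseq (cdeg 1) (src d)); last first.
      by exists (0, fun=> 0).
    have [db rb] := pathseqP rfL (rng_src d) hb.
    have [||p [c hc]] := IH b' _ db; rewrite ?rng_comp //.
    by exists (p, c) => _; rewrite src_comp in hc.
  (* The sum of the degrees needed after each one-step extension is a common degree for all of
     them. *)
  pose q := \sum_(b' <- pathseq (cdeg 1) (src d)) (pc b').1.
  exists (cdeg 1 + q), (fun l => (pc (hd l (cdeg 1))).2 (hd (tl l (cdeg 1)) (pc (hd l (cdeg 1))).1)).
  move=> l x dl rl lx; have le : dle (cdeg 1) (deg l) by rewrite dl; exact: dle_add.
  have [f1 f2 f3] := factorP le; have dt := deg_tl dl.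
  set b' := hd l _ in f1 f2 f3 *; set t := tl l _ in f1 f2 dt *.
  have hb : b' \in pathseq (cdeg 1) (src d).
    by rewrite mem_pathseq ?rng_src // f3 eqxx -rl [in X in _ == rng X]f2 rng_comp ?eqxx.
  have [db rb] := pathseqP rfL (rng_src d) hb.
  have lq : q = (pc b').1 + \sum_(b'' <- rem b' (pathseq (cdeg 1) (src d))) (pc b'').1.
    by rewrite /q (perm_big _ (perm_to_rem hb)) big_cons.
  have := appr_refine (q := \sum_(b'' <- rem b' (pathseq (cdeg 1) (src d))) (pc b'').1) (hpc _ hb).
  rewrite -lq => /(_ t (sh (cdeg 1) x) dt (esym f1)).
  rewrite f2 in lx; have [lx1 lx2] := (cyl_comp _ f1).1 lx.
  rewrite -{1}f3 => /(_ lx2); rewrite -f3.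
  congr (cabs (_ - _) <= _); congr (slice f a b _).
  have rx := cyl_root lx1; have rs := cyl_sh lx1.
  rewrite -{2}(cyl_cat_sh lx1); apply: (@pre_ext _ _ _ _ (deg d + deg b')) => p.
  have db' : deg d + deg b' = deg (kcomp d b') by rewrite deg_comp.
  rewrite {1}db' pre_cat ?src_comp // -addrA pre_cat; last by rewrite root_cat.
  by rewrite pre_cat // kcompA // rng_pre.
- move=> x rx; have [g abg lg] := bis_exists ab (esym rx).
  have zg : sh (deg a) (sdp_left g) = x by rewrite lg sh_cat.
  (* Below a sufficiently long segment of [x] the constant [f g] is a good enough approximation, so
     degree 0 suffices there. *)
  have [N hN] := nbhs_bis_refine abg (continuous_near g cf e0).
  exists N => _; exists 0, (fun=> f g) => l y _ rl ly.
  rewrite zg in hN; set d := pre x (cdeg N) in rl *.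
  have ry : src d = root y by rewrite (cyl_root ly).
  have rd : rng d = src a by rewrite rng_pre.
  have adr : src (kcomp a d) = root y by rewrite src_comp.
  have [|g' hg' lg'] := @bis_exists _ _ (kcomp a d) (kcomp b d) y _ adr.
    by rewrite !src_comp // -ab.
  have [abg' _] := (bis_comp _ ab (esym rd)).1 hg'.
  have := hN d erefl g' hg'; rewrite /= -(sliceE f abg').
  congr (cabs (slice f a b _ - _) <= _); rewrite lg'.
  have -> : cat (kcomp a d) y = cat a (cat d y).
    apply: (@pre_ext _ _ _ _ (deg a + deg d)) => p.
    rewrite -{1}deg_comp // pre_cat // -addrA pre_cat ?root_cat ?rd // pre_cat //.
    by rewrite kcompA // rng_pre.
  by rewrite sh_cat // root_cat.
Qed.

End BlockFunctions.

(** * The *-homomorphism from [Cc] defined by a Cuntz-Krieger family *)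

Section Integration.
Context {R : realType} {k : nat} {L : kgraph k} {D : cstar_algebra R}.
Hypothesis rfL : row_finite L.
Variable t : L -> D.
Hypothesis ck : cuntz_krieger_family t.
Notation X := (@infinite_path k L).
Notation G := (sdp (@path_action k L)).
Notation GA := (@path_groupoid k L).
Implicit Types (a b c l : L) (h : X -> R[i]) (f : GA -> R[i]) (w : D).
Implicit Types K : L -> L -> Prop.

(* [block_sum K f w]: [f] is a finite sum of block functions on bisections
   [bis a b] with [K a b], and [w] is the corresponding sum in [D]. *)
Inductive block_sum K : (GA -> R[i]) -> D -> Prop :=
| block_nil : block_sum K (fun=> 0) 0
| block_cons a b h f w : K a b -> src a = src b -> locunif (src a) h ->
    block_sum K f w ->
    block_sum K (fun g : GA => blockF a b h g + f g) (blockW t a b h + w).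

Lemma block_sum_sub K K' f w :
  (forall a b, src a = src b -> K a b -> K' a b) -> block_sum K f w -> block_sum K' f w.
Proof.
move=> sub; elim=> [|a b h f' w' Kab ab lh _ IH]; first exact: block_nil.
by apply: block_cons => //; exact: sub.
Qed.

Lemma block_sum1 K a b h : K a b -> src a = src b -> locunif (src a) h ->
  block_sum K (blockF a b h) (blockW t a b h).
Proof.
move=> Kab ab lh; have := block_cons Kab ab lh (block_nil K).
by rewrite addr0 (_ : (fun g => _) = blockF a b h) //; apply/funext => g; rewrite addr0.
Qed.

Lemma block_sumD K f w f' w' : block_sum K f w -> block_sum K f' w' ->
  block_sum K (fun g : GA => f g + f' g) (w + w').
Proof.
move=> + H'; elim=> [|a b h f1 w1 Kab ab lh _ IH].
  by rewrite add0r (_ : (fun g => _) = f') //; apply/funext => g; rewrite add0r.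
rewrite -addrA (_ : (fun g : GA => _) = fun g => blockF a b h g + (f1 g + f' g)).
  exact: block_cons.
by apply/funext => g; rewrite addrA.
Qed.

Lemma block_sumZ K f w (z : R[i]) : block_sum K f w ->
  block_sum K (fun g : GA => z * f g) (z *: w).
Proof.
elim=> [|a b h f1 w1 Kab ab lh _ IH].
  rewrite scaler0 (_ : (fun g => _) = fun=> 0); first exact: block_nil.
  by apply/funext => g; rewrite mulr0.
have lz : locunif (src a) (fun x => z * h x).
  by apply: locunif_mul => //; [exact: rng_src|exact: locunif_cst].
have := block_cons Kab ab lz IH; rewrite blockWZ // -scalerDr.
by congr block_sum; apply/funext => g; rewrite blockFZ mulrDr.
Qed.

Lemma block_sum_seq K (I : eqType) (s : seq I) (F : I -> GA -> R[i]) (W : I -> D) :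
  (forall i, i \in s -> block_sum K (F i) (W i)) ->
  block_sum K (fun g => \sum_(i <- s) F i g) (\sum_(i <- s) W i).
Proof.
elim: s => [|i s IH] H.
  rewrite big_nil (_ : (fun g => _) = fun=> 0); first exact: block_nil.
  by apply/funext => g; rewrite big_nil.
rewrite big_cons (_ : (fun g => _) = fun g => F i g + \sum_(j <- s) F j g).
  apply: block_sumD; first by apply: H; rewrite inE eqxx.
  by apply: IH => j js; apply: H; rewrite inE js orbT.
by apply/funext => g; rewrite big_cons.
Qed.

Lemma block_sum_refine K K' (p : L -> L -> 'N^k) f w :
  (forall a b c, K a b -> src a = src b -> src a = rng c -> deg c = p a b ->
     K' (kcomp a c) (kcomp b c)) ->
  block_sum K f w -> block_sum K' f w.
Proof.
move=> sub; elim=> [|a b h f1 w1 Kab ab lh _ IH]; first exact: block_nil.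
apply: block_sumD IH; rewrite (blockF_refine rfL (p a b) _ ab) (blockW_refine rfL ck (p a b) ab lh).
apply: block_sum_seq => c /(pathseqP rfL (rng_src a)) [dc rc].
have bc : src b = rng c by rewrite -ab.
apply: block_sum1; first by apply: sub.
- by rewrite !src_comp.
- by rewrite src_comp //; apply: (locunif_cat (v := src a)).
Qed.

Lemma block_sum_vanish K f w (g : G) : block_sum K f w ->
  (forall a b, K a b -> ~ bis a b g) -> f g = 0.
Proof.
move=> + H; elim=> [//|a b h f1 w1 Kab ab lh _ ->].
by rewrite blockF_out ?addr0 //; exact: H.
Qed.

Lemma block_sum_Cc K f w : block_sum K f w -> Cc f.
Proof.
elim=> [|a b h f1 w1 Kab ab lh _ IH]; last by apply: CcD => //; exact: Cc_block.
exact: Cc0.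
Qed.

Lemma block_sum_fibre_finite K f w : block_sum K f w -> fibre_finite f.
Proof.
elim=> [|a b h f1 w1 Kab ab lh _ IH]; first exact: fibre_finite0.
by apply: fibre_finiteD => //; exact: fibre_finite_block.
Qed.

Lemma block_sum_finite K f w : block_sum K f w ->
  exists s : seq (L * L), block_sum (fun a b => K a b /\ (a, b) \in s) f w.
Proof.
elim=> [|a b h f1 w1 Kab ab lh _ [s IH]]; first by exists [::]; exact: block_nil.
exists ((a, b) :: s); apply: block_cons => //; first by rewrite inE eqxx.
by apply: block_sum_sub IH => a' b' _ [h1 h2]; split=> //; rewrite inE h2 orbT.
Qed.

(** The two legs of a bisection may differ in degree, so the left and right degrees are normalized
    in separate decompositions. A product uses the right one of its first factor and the left one of
    its second. *)
Lemma block_sum_level K f w : block_sum K f w ->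
  exists N0, forall N, (N0 <= N)%N ->
    block_sum (fun a _ => deg a = cdeg N) f w /\
    block_sum (fun _ b => deg b = cdeg N) f w.
Proof.
move=> /block_sum_finite [s H].
exists (\sum_(ab <- s) (dmax (deg ab.1) + dmax (deg ab.2)))%N => N hN.
have le a b : (a, b) \in s -> dle (deg a) (cdeg N) /\ dle (deg b) (cdeg N).
  move=> abs; have hle : (dmax (deg a) + dmax (deg b) <= N)%N.
    apply: leq_trans hN; rewrite (perm_big _ (perm_to_rem abs)) big_cons /=.
    exact: leq_addr.
  split; apply: dle_dmax; apply: leq_trans hle; [exact: leq_addr|exact: leq_addl].
split.
- apply: (block_sum_refine (p := fun a _ => dsub (cdeg N) (deg a))) H => a b c [_ abs] _ ac dc.
  by rewrite deg_comp // dc dsubK //; case: (le _ _ abs).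
- apply: (block_sum_refine (p := fun _ b => dsub (cdeg N) (deg b))) H => a b c [_ abs] ab ac dc.
  by rewrite deg_comp -?ab // dc dsubK //; case: (le _ _ abs).
Qed.

(** All blocks on [bis a b] are merged into one, so that the remainder has no block on this pair. *)
Lemma block_sum_extract K f w a b : src a = src b -> block_sum K f w ->
  exists h f' w', [/\ locunif (src a) h,
    block_sum (fun a' b' => K a' b' /\ (a', b') <> (a, b)) f' w',
    f = (fun g : GA => blockF a b h g + f' g) & w = blockW t a b h + w'].
Proof.
move=> ab; elim=> [|a1 b1 h1 f1 w1 Kab ab1 lh1 H [h [f' [w' [lh H' ef ew]]]]].
  exists (fun=> 0), (fun=> 0), 0; split; [exact: locunif_cst|exact: block_nil| |].
    by apply/funext => g; rewrite /blockF; case: ifP; rewrite addr0.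
  (* Writing the zero function as a multiple by the scalar 0 lets [blockWZ] conclude. *)
  rewrite addr0 (@blockW_ext _ _ _ _ _ _ _ _ (fun x => 0 * 0)).
    rewrite blockWZ ?scale0r //; exact: locunif_cst.
  by move=> x _; rewrite mul0r.
have [[ea eb]|ne] := pselect ((a1, b1) = (a, b)).
  rewrite {}ea {}eb in lh1 *; exists (fun x => h1 x + h x), f', w'; split=> //.
  - by apply: locunif_add => //; exact: rng_src.
  - by rewrite ef blockFD; apply/funext => g; rewrite addrA.
  - by rewrite ew blockWD // addrA.
exists h, (fun g : GA => blockF a1 b1 h1 g + f' g), (blockW t a1 b1 h1 + w'); split=> //.
- exact: block_cons.
- by rewrite ef; apply/funext => g; rewrite addrCA.
- by rewrite ew addrCA.
Qed.

(** At a fixed left degree distinct bisections are disjoint, so a vanishing sum vanishes block by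
    block, after the blocks on each pair have been merged. *)
Lemma block_sum_zero_level (s : seq (L * L)) (N : nat) f w :
  block_sum (fun a b => deg a = cdeg N /\ (a, b) \in s) f w ->
  (forall g, f g = 0) -> w = 0.
Proof.
elim: s f w => [|[a b] s IH] f w H f0.
  have none a b : ~ (deg a = cdeg N /\ (a, b) \in [::]) by case.
  by case: H => // a b h f1 w1 /none.
have [[ab da]|nab] := pselect (src a = src b /\ deg a = cdeg N); last first.
  apply: (IH f) f0; apply: block_sum_sub H => a' b' ab' [da'].
  rewrite inE => /orP[/eqP [ea eb]|//].
  by case: nab; rewrite -ea -eb.
have [h [f' [w' [lh H' ef ew]]]] := block_sum_extract ab H.
have f'0 g : bis a b g -> f' g = 0.
  move=> abg; apply: (block_sum_vanish H') => a' b' [[da' _] ne] abg'.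
  by apply: ne; have [-> ->] := bis_level abg' abg (etrans da' (esym da)).
have h0 x : root x = src a -> h x = 0 * 0.
  move=> rx; have [g abg lg] := bis_exists ab (esym rx).
  have := f0 g; rewrite ef f'0 // addr0 (blockF_in _ abg) lg sh_cat // => ->.
  by rewrite mul0r.
have W0 : blockW t a b h = 0.
  by rewrite (blockW_ext _ _ h0) blockWZ ?scale0r //; exact: locunif_cst.
rewrite ew W0 add0r; apply: (IH f').
  apply: block_sum_sub H' => a' b' _ [[da' +] ne]; rewrite inE => /orP[/eqP //|].
  by split.
move=> g; have := f0 g; rewrite ef (blockF_ext b h0) /blockF.
by case: ifP; rewrite ?mul0r add0r.
Qed.

Lemma block_sum_zero K f w : block_sum K f w -> (forall g, f g = 0) -> w = 0.
Proof.
move=> /block_sum_level [N /(_ N (leqnn N)) [/block_sum_finite [s H] _]].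
exact: block_sum_zero_level H.
Qed.

Lemma block_sum_unique K K' f w w' :
  block_sum K f w -> block_sum K' f w' -> w = w'.
Proof.
move=> H H'; pose T (_ _ : L) := True.
have H1 : block_sum T f w by apply: block_sum_sub H.
have H2 : block_sum T f w' by apply: block_sum_sub H'.
have := block_sum_zero (block_sumD H1 (block_sumZ (-1) H2)).
rewrite scaleN1r => h; apply/eqP; rewrite -subr_eq0; apply/eqP/h => g.
by rewrite mulN1r subrr.
Qed.

Lemma block_sum_star K f w : block_sum K f w ->
  block_sum (fun b a => K a b) (involution f) w^#.
Proof.
elim=> [|a b h f1 w1 Kab ab lh _ IH].
  rewrite cs_star0 (_ : involution _ = fun=> 0); first exact: block_nil.
  by apply/funext => g; rewrite /involution conjc0.
have lh' : locunif (src b) (fun x => conjc (h x)).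
  by rewrite -ab; apply: locunif_conj => //; exact: rng_src.
have := block_cons (K := fun b a => K a b) Kab (esym ab) lh' IH.
rewrite -blockF_star -(blockW_star rfL ck ab lh) -cs_starD.
by congr block_sum; apply/funext => g; rewrite /involution /= rmorphD.
Qed.

Lemma block_sum_convolution_level (m : 'N^k) f w f' w' :
  block_sum (fun _ b => deg b = m) f w -> block_sum (fun a _ => deg a = m) f' w' ->
  block_sum (fun _ _ => True) (convolution f f') (w ** w').
Proof.
move=> H H'; elim: H => [|a b h f1 w1 db ab lh H1 IH1].
  by rewrite convolution0l cs_mul0l; exact: block_nil.
have fb : fibre_finite (blockF a b h) by exact: fibre_finite_block.
rewrite convolutionDl //; last exact: block_sum_fibre_finite H1.
rewrite cs_mulDl; apply: block_sumD IH1.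
elim: H' => [|b' c h' f2 w2 db' bc lh' _ IH2].
  by rewrite convolution0r cs_mul0r; exact: block_nil.
rewrite convolutionDr // cs_mulDr; apply: block_sumD IH2.
rewrite blockF_mul ?db // (blockW_mul rfL ck) ?db //.
case: eqP => [e|_]; last exact: block_nil.
rewrite -{}e in bc lh'; apply: block_sum1 => //; first by rewrite ab.
by apply: locunif_mul => //; [exact: rng_src|rewrite ab].
Qed.

Lemma block_sum_convolution K K' f w f' w' :
  block_sum K f w -> block_sum K' f' w' ->
  block_sum (fun _ _ => True) (convolution f f') (w ** w').
Proof.
move=> /block_sum_level [N hN] /block_sum_level [N' hN'].
have [_ H] := hN _ (leq_maxl N N'); have [H' _] := hN' _ (leq_maxr N N').
exact: block_sum_convolution_level H H'.
Qed.

(** The slices on a finite cover of the support are subtracted one at a time. Bisections are open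
    and closed, so the remainder stays continuous, and it is supported on the rest of the cover. *)
Lemma block_sum_exists f : Cc f -> exists w, block_sum (fun _ _ => True) f w.
Proof.
move=> [cf kf]; have [s hs] := finite_bis_cover kf.
have {kf hs} : forall g, f g <> 0 -> exists2 ab, ab \in s & bis ab.1 ab.2 g.
  by move=> g ne; apply: hs; apply: subset_closure; exact/eqP.
elim: s f cf => [|[a b] s IH] f cf hs.
  exists 0; rewrite (_ : f = fun=> 0); first exact: block_nil.
  by apply/funext => g; apply: contrapT => /hs [].
have [ab|nab] := pselect (src a = src b); last first.
  apply: IH => // g /hs [ab' + hg]; rewrite inE => /orP[/eqP e|hab']; last by exists ab'.
  by case: nab; apply: (@bis_src _ _ _ _ g); move: hg; rewrite e.
have lh := slice_locunif rfL ab cf.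
pose f1 := fun g : GA => f g - blockF a b (slice f a b) g.
have f1E g : f1 g = if `[< bis a b g >] then 0 else f g.
  by rewrite /f1 blockF_slice; case: ifP => _; rewrite ?subrr ?subr0.
have [||w H] := IH f1.
- by apply: continuous_complexD => //; apply: continuous_complexN; exact: blockF_continuous.
- move=> g; rewrite f1E; case: asboolP => // nb /hs [ab' + hg].
  rewrite inE => /orP[/eqP e|hab']; last by exists ab'.
  by case: nb; move: hg; rewrite e.
exists (blockW t a b (slice f a b) + w).
rewrite [X in block_sum _ X](_ : f = fun g => blockF a b (slice f a b) g + f1 g).
  exact: block_cons.
by apply/funext => g; rewrite /f1 addrC subrK.
Qed.

Definition integrated f : D := xget 0 [set w | block_sum (fun _ _ => True) f w].

Lemma integratedE K f w : block_sum K f w -> integrated f = w.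
Proof.
move=> H; apply: xget_unique => [|w' H']; last exact: block_sum_unique H' H.
by apply: block_sum_sub H.
Qed.

Lemma integrated_star_hom : Cc_star_hom integrated.
Proof.
split.
- move=> f f' /block_sum_exists [w H] /block_sum_exists [w' H'].
  by rewrite (integratedE H) (integratedE H') (integratedE (block_sumD H H')).
- move=> z f /block_sum_exists [w H].
  by rewrite (integratedE H) (integratedE (block_sumZ z H)).
- move=> f f' /block_sum_exists [w H] /block_sum_exists [w' H'].
  by rewrite (integratedE H) (integratedE H') (integratedE (block_sum_convolution H H')).
- move=> f /block_sum_exists [w H].
  by rewrite (integratedE H) (integratedE (block_sum_star H)).
Qed.

End Integration.

(** * Closures of *-subalgebras *)

Section Closure.
Context {R : realType}.

Lemma closure_tends (V : normedModType R[i]) (A : set V) (x : V) :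
  closure A x -> exists u, (forall n, A (u n)) /\ tends u x.
Proof.
move=> clx; have /choice [u hu] : forall n : nat, exists y, A y /\ nrm (x - y) < n.+1%:R^-1.
  move=> n; have e0 : 0 < (n.+1%:R^-1 : R)%:C by rewrite ltcR invr_gt0 ltr0n.
  by have [y [Ay /nrm_ball hy]] := clx _ (nbhsx_ballx x _ e0); exists y.
exists u; split=> [n|e /inv_small [N hN]]; first by have [] := hu n.
by exists N => n /hN le; have [_ /ltW h] := hu n; rewrite nrmB (le_trans h).
Qed.

Lemma closure_star_subalgebra (B : cstar_algebra R) (M : set B) :
  star_subalgebra M -> star_subalgebra (closure M).
Proof.
move=> [M0 MD MZ MM MS].
have sub x : M x -> closure M x by exact: subset_closure.
have cl u x : (forall n, M (u n)) -> tends u x -> closure M x.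
  move=> hu ux; apply: (tends_closed (@closed_closure _ M) ux) => n.
  exact: sub.
split=> [|x y /closure_tends [u [hu ux]] /closure_tends [w [hw wy]]
        |a x /closure_tends [u [hu ux]]|x y /closure_tends [u [hu ux]] /closure_tends [w [hw wy]]
        |x /closure_tends [u [hu ux]]].
- exact: sub.
- by apply: cl (tendsD ux wy) => n; exact: MD.
- by apply: cl (tendsZ a ux) => n; exact: MZ.
- by apply: cl (tendsM ux wy) => n; exact: MM.
- by apply: cl (tends_star ux) => n; exact: MS.
Qed.

End Closure.

(** * Representations of [Cc] restricted to a Cuntz-Krieger family *)

Section GroupoidRepresentation.
Context {R : realType} {k : nat} {L : kgraph k} {E : cstar_algebra R}.
Hypothesis rfL : row_finite L.
Notation X := (@infinite_path k L).
Notation GA := (@path_groupoid k L).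
Variable pi : (GA -> R[i]) -> E.
Hypothesis pi_hom : Cc_star_hom pi.
Implicit Types (a b c l v : L) (h : X -> R[i]) (f : GA -> R[i]).

Let piD f f' : Cc f -> Cc f' -> pi (fun g : GA => f g + f' g) = pi f + pi f'.
Proof. by case: pi_hom => H _ _ _; exact: H. Qed.

Let piZ (z : R[i]) f : Cc f -> pi (fun g : GA => z * f g) = z *: pi f.
Proof. by case: pi_hom => _ H _ _; exact: H. Qed.

Let piM f f' : Cc f -> Cc f' -> pi (convolution f f') = pi f ** pi f'.
Proof. by case: pi_hom => _ _ H _; exact: H. Qed.

Let piS f : Cc f -> pi (involution f) = (pi f)^#.
Proof. by case: pi_hom => _ _ _ H; exact: H. Qed.

Let pi0 : pi (fun=> 0) = 0.
Proof.
rewrite -[RHS](scale0r (pi (fun=> 0))) -piZ; last exact: Cc0.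
by congr pi; apply/funext => g; rewrite mul0r.
Qed.

Let Cc_sum (I : eqType) (s : seq I) (F : I -> GA -> R[i]) :
  (forall i, i \in s -> Cc (F i)) ->
  Cc (fun g : GA => \sum_(i <- s) F i g) /\
  pi (fun g : GA => \sum_(i <- s) F i g) = \sum_(i <- s) pi (F i).
Proof.
elim: s => [|i s IH] H.
  rewrite big_nil (_ : (fun g : GA => _) = fun=> 0).
    by split; [exact: Cc0|exact: pi0].
  by apply/funext => g; rewrite big_nil.
have [|h1 h2] := IH; first by move=> j js; apply: H; rewrite inE js orbT.
have hi : Cc (F i) by apply: H; rewrite inE eqxx.
rewrite (_ : (fun g : GA => _) = fun g => F i g + \sum_(j <- s) F j g); last first.
  by apply/funext => g; rewrite big_cons.
by split; [exact: CcD|rewrite piD // h2 big_cons].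
Qed.

Let pi_sum (I : eqType) (s : seq I) (F : I -> GA -> R[i]) :
  (forall i, i \in s -> Cc (F i)) ->
  pi (fun g : GA => \sum_(i <- s) F i g) = \sum_(i <- s) pi (F i).
Proof. by move=> /Cc_sum []. Qed.

Definition rep_of l : E := pi (blockF l (src l) (fun=> 1)).

Let unitF a b := blockF (R := R) (L := L) a b (fun=> 1).

Let Cc_unit a b : src a = src b -> Cc (unitF a b).
Proof. by move=> ab; apply: Cc_block => //; exact: locunif_cst. Qed.

Let pi_block_mul a b b' c h h' : src a = src b -> src b' = src c -> deg b = deg b' ->
  locunif (src a) h -> locunif (src b') h' ->
  pi (blockF a b h) ** pi (blockF b' c h') =
  if b == b' then pi (blockF a c (fun x => h x * h' x)) else 0.
Proof.
move=> ab bc d lh lh'; rewrite -piM; try exact: Cc_block.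
by rewrite blockF_mul //; case: eqP => // _; exact: pi0.
Qed.

Let pi_unit_mul a b b' c : src a = src b -> src b' = src c -> deg b = deg b' ->
  pi (unitF a b) ** pi (unitF b' c) = if b == b' then pi (unitF a c) else 0.
Proof.
move=> ab bc d; rewrite pi_block_mul //; try exact: locunif_cst.
case: eqP => // _; congr pi; rewrite /unitF; congr blockF.
by apply/funext => x; rewrite mulr1.
Qed.

Let pi_unit_star a b : src a = src b -> (pi (unitF a b))^# = pi (unitF b a).
Proof.
move=> ab; rewrite -piS; last exact: Cc_unit.
by rewrite /unitF blockF_star; congr pi; congr blockF; apply/funext => x; rewrite conjc1.
Qed.

Let rep_object v : rng v = v -> rep_of v = pi (unitF v v).
Proof. by move=> hv; rewrite /rep_of object_src. Qed.

Let rep_proj l : rep_of l ** (rep_of l)^# = pi (unitF l l).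
Proof. by rewrite pi_unit_star ?src_src // pi_unit_mul ?src_src // eqxx. Qed.

(** The summation relation is the refinement of the block of a vertex to degree [n]; the others are
    product and adjoint rules for blocks with constant function 1. *)
Lemma rep_of_ck : cuntz_krieger_family rep_of.
Proof.
split.
- by move=> l; rewrite rep_proj pi_unit_mul ?src_src // eqxx.
- split=> [v hv|v w hv hw vw]; rewrite !rep_object //.
    by rewrite pi_unit_star // pi_unit_mul // eqxx.
  by rewrite pi_unit_mul ?(introF eqP vw) // -hv -hw !deg_rng.
- move=> l m lm; rewrite /rep_of -piM; try exact: (Cc_unit (esym (src_src _))).
  by rewrite blockF_comp // src_comp.
- move=> l; rewrite pi_unit_star ?src_src // pi_unit_mul ?src_src // eqxx.
  by rewrite rep_object // rng_src.
- move=> v n hv; rewrite sum_paths // rep_object // /unitF.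
  rewrite (blockF_refine rfL n _ (erefl (src v))).
  have sv := object_src hv.
  rewrite pi_sum; last by move=> c _; exact: Cc_unit.
  rewrite sv; apply: eq_big_seq => c /(pathseqP rfL hv) [_ rc].
  by rewrite rep_proj -rc comp_rng.
Qed.

(** The normalization required by [sup_bound] holds because the block of the constant 1 goes to the
    projection [rep_of v]. *)
Lemma pi_unit_bound v h (M : R) : rng v = v -> 0 <= M -> locunif v h ->
  (forall x, root x = v -> cabs (h x) <= M) -> nrm (pi (blockF v v h)) <= M.
Proof.
move=> hv M0 lh hM; have sv := object_src hv.
have Cv h' : locunif v h' -> Cc (blockF v v h') by move=> l'; apply: Cc_block; rewrite ?sv.
apply: (@sup_bound _ _ _ (locunif v) (fun h => pi (blockF v v h))
  [set x | root x = v]) => //.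
- by move=> z; exact: locunif_cst.
- by move=> f g; exact: locunif_add.
- by move=> f g; exact: locunif_mul.
- by move=> f; exact: locunif_conj.
- by move=> f; exact: locunif_sqrt.
- by move=> f g lf lg; rewrite blockFD piD; try exact: Cv.
- by move=> z f lf; rewrite blockFZ piZ; try exact: Cv.
- by move=> f g lf lg; rewrite pi_block_mul ?sv // eqxx.
- by move=> f lf; rewrite -piS ?blockF_star; try exact: Cv.
- rewrite -/(unitF v v) -rep_object //.
  exact: ck_le1 rep_of_ck _.
- by move=> f g _ _ fg; congr pi; apply: blockF_ext => x; rewrite sv; exact: fg.
Qed.

Lemma pi_step v p (c : L -> R[i]) : rng v = v ->
  step rep_of v p c = pi (blockF v v (fun x => c (pre x p))).
Proof.
move=> hv; have sv := object_src hv.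
rewrite (blockF_refine rfL p _ (erefl (src v))).
rewrite pi_sum; last first.
  move=> l /(pathseqP rfL (rng_src v)) [dl rl]; apply: Cc_block => //.
  rewrite src_comp //; apply: (locunif_cat (v := src v) (h := fun x => c (pre x p))) => //.
  exact: locunif_step.
rewrite sv; apply: eq_big_seq => l /(pathseqP rfL hv) [dl rl].
have -> : kcomp v l = l by rewrite -rl comp_rng.
rewrite rep_proj -piZ; last exact: Cc_unit.
rewrite -blockFZ; congr pi; apply: blockF_ext => x rx.
by rewrite mulr1 -dl pre_cat_deg.
Qed.

Section Comparison.
Context {D : cstar_algebra R}.
Variables (s : L -> D) (phi : D -> E).
Hypothesis ck : cuntz_krieger_family s.
Hypothesis phi_hom : star_hom phi.
Hypothesis phi_gen : forall l, phi (s l) = rep_of l.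
Hypothesis phi_le : forall d, nrm (phi d) <= nrm d.

Let phiD x y : phi (x + y) = phi x + phi y. Proof. by case: phi_hom. Qed.
Let phiZ (z : R[i]) x : phi (z *: x) = z *: phi x. Proof. by case: phi_hom. Qed.
Let phiM x y : phi (x ** y) = phi x ** phi y. Proof. by case: phi_hom. Qed.
Let phiS x : phi x^# = (phi x)^#. Proof. by case: phi_hom. Qed.

Let phi0 : phi 0 = 0.
Proof. by rewrite -(scale0r 0) phiZ scale0r. Qed.

Let phi_step v p (c : L -> R[i]) : phi (step s v p c) = step rep_of v p c.
Proof.
rewrite /step; elim: (pathseq p v) => [|l q IH]; first by rewrite !big_nil phi0.
by rewrite !big_cons phiD phiZ phiM phiS phi_gen IH.
Qed.

(** Both sides agree on steps by [phi_step] and [pi_step], and each moves by at most [e / 2] when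
    [h] is replaced by an approximating step: the left because [phi] is contractive, the right by
    [pi_unit_bound]. *)
Lemma phi_iota0 v h : rng v = v -> locunif v h ->
  phi (iota0 s v h) = pi (blockF v v h).
Proof.
move=> hv lh; have sv := object_src hv; have [p [c H]] := lh.
apply: nrm_eps_eq => e e0; have [N /(_ N (leqnn N)) hN] := H (e / 2) ltac:(lra).
have e20 : 0 <= e / 2 by lra.
pose q := p N; pose d := c N; pose h' x := d (pre x q).
have lh' : locunif v h' by exact: locunif_step.
have h1 : nrm (phi (iota0 s v h) - step rep_of v q d) <= e / 2.
  rewrite -phi_step -scaleN1r -phiZ -phiD scaleN1r (le_trans (phi_le _)) //.
  exact: iota0P.
have h2 : nrm (pi (blockF v v h) - step rep_of v q d) <= e / 2.
  rewrite pi_step // -/h' -scaleN1r -piZ; last by apply: Cc_block; rewrite ?sv.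
  have lN : locunif v (fun x => -1 * h' x).
    by apply: locunif_mul => //; exact: locunif_cst.
  rewrite -blockFZ -piD; try by apply: Cc_block; rewrite ?sv.
  rewrite -blockFD; apply: pi_unit_bound => //; first exact: locunif_add.
  move=> x rx; rewrite mulN1r; apply: hN; [exact: deg_pre|by rewrite rng_pre|exact: cyl_pre].
exact: (nrm_triC h1 h2 (le_halves (lexx _) (lexx _))).
Qed.

(** [blockF a b h] is the convolution of the blocks on [(a, src a)], [(src a, src a)] and
    [(src a, b)] with functions 1, [h] and 1, which mirrors the definition of [blockW]. *)
Lemma phi_block a b h : src a = src b -> locunif (src a) h ->
  phi (blockW s a b h) = pi (blockF a b h).
Proof.
move=> ab lh; have ra := rng_src a; have sa : src (src a) = src a by exact: src_src.
rewrite /blockW !phiM phiS !phi_gen phi_iota0 // /rep_of pi_unit_star ?src_src //.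
rewrite pi_block_mul ?sa ?eqxx //; last exact: locunif_cst.
rewrite pi_block_mul ?sa -?ab ?eqxx //; last exact: locunif_cst.
  by congr pi; apply: blockF_ext => x _; rewrite mul1r mulr1.
by apply: locunif_mul => //; exact: locunif_cst.
Qed.

Lemma phi_integrated f : Cc f -> phi (integrated s f) = pi f.
Proof.
move=> /(block_sum_exists rfL s) [w H]; rewrite (integratedE rfL ck H).
elim: H => [|a b h f1 w1 _ ab lh H1 IH]; first by rewrite phi0 pi0.
rewrite phiD phi_block // IH piD //; first exact: Cc_block.
exact: block_sum_Cc H1.
Qed.

End Comparison.

End GroupoidRepresentation.

(** * The universal property of the groupoid algebra and the conclusion *)

Lemma graph_algebra_groupoid_algebra {R : realType} {k : nat} (L : kgraph k)
    (rfL : row_finite L) :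
  is_groupoid_algebra (@path_groupoid k L) (graph_algebra (R := R) L).
Proof.
pose s := graph_gen (R := R) (L := L); have ck : cuntz_krieger_family s by exact: graph_gen_ck.
exists (integrated s); split.
- exact: integrated_star_hom.
(* Density: the closure of the image of [Cc] is a closed *-subalgebra that contains every generator,
   hence is everything. *)
- have gen : generated_by s by exact: ugen_generated.
  apply: (gen (closure [set integrated s f | f in Cc (G := @path_groupoid k L)])).
  + apply: closure_star_subalgebra; split.
    * exists (fun=> 0); first exact: Cc0.
      exact: (integratedE rfL ck (block_nil s (fun _ _ => True))).
    * move=> _ _ [f cf <-] [f' cf' <-].
      have [w H] := block_sum_exists rfL s cf; have [w' H'] := block_sum_exists rfL s cf'.
      exists (fun g => f g + f' g); first exact: CcD.
      by rewrite (integratedE rfL ck H) (integratedE rfL ck H') (integratedE rfL ck (block_sumD H H')).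
    * move=> z _ [f cf <-]; have [w H] := block_sum_exists rfL s cf.
      have H' := block_sumZ rfL ck z H.
      exists (fun g => z * f g); first exact: (block_sum_Cc rfL H').
      by rewrite (integratedE rfL ck H) (integratedE rfL ck H').
    * move=> _ _ [f cf <-] [f' cf' <-].
      have [w H] := block_sum_exists rfL s cf; have [w' H'] := block_sum_exists rfL s cf'.
      have H2 := block_sum_convolution rfL ck H H'.
      exists (convolution f f'); first exact: (block_sum_Cc rfL H2).
      by rewrite (integratedE rfL ck H) (integratedE rfL ck H') (integratedE rfL ck H2).
    * move=> _ [f cf <-]; have [w H] := block_sum_exists rfL s cf.
      have H' := block_sum_star rfL ck H.
      exists (involution f); first exact: (block_sum_Cc rfL H').
      by rewrite (integratedE rfL ck H) (integratedE rfL ck H').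
  + exact: closed_closure.
  + move=> l; apply: subset_closure; exists (blockF l (src l) (fun=> 1)).
      by apply: Cc_block; rewrite ?src_src //; exact: locunif_cst.
    rewrite (integratedE (K := fun _ _ => True) (w := blockW s l (src l) (fun=> 1)) rfL ck).
      exact: blockW1.
    by apply: block_sum1; rewrite ?src_src //; exact: locunif_cst.
- move=> E pi pi_hom; have [phi [h1 h2 h3]] := graph_universal (rep_of_ck rfL pi_hom).
  exists phi => // f cf.
  exact: (phi_integrated rfL pi_hom ck h1 h2 h3).
Qed.

Theorem theorem8p1 (R : realType) (k : nat) (L : kgraph k)
    (k_gt0 : (1 <= k)%N) (L_row_finite : row_finite L) :
  let X := markov_space (@transition k L) in
  exists (S : 'I_k -> X -> X) (S_comm : pairwise_commuting S),
    [/\ forall i, cellular_automaton (S i),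
        forall x : X,
          set_val ((\big[@comp X X X/id]_(i < k) S i) x) = left_shift (set_val x),
        forall i, local_homeomorphism (S i)
      & exists B D : cstar_algebra R,
          [/\ is_groupoid_algebra
                (semidirect_product (iterated_action S_comm)) B,
              is_graph_algebra L D
            & star_isomorphic B D]].
Proof.
move=> X; exists (@unit_shift k L), (@unit_shift_comm k L); split.
- exact: unit_shift_cellular.
- exact: prod_unit_shift.
- by move=> i; exact: sh_local_homeomorphism.
- exists (graph_algebra L), (graph_algebra L); split.
  + exact: graph_algebra_groupoid_algebra.
  + exact: graph_algebraP.
  + by exists id; [split|exists id].
Qed.
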